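(* Let $\lambda=(\lambda_1,\ldots,\lambda_r)$ be a dominant integral weight and let $f\in\mathcal{S}_\lambda=\mathcal{C}^\infty(\mathbb{R}^m,\mathbb{S}_\lambda)$. Then $$\mathcal{R}_\lambda f=0\ \Longrightarrow\ \Delta^{\lambda_1+1}f=0 .$$
   Context: Let $m=2r+1$ be odd, $r\ge1$. Weights of $\mathfrak{so}(m,\mathbb{C})$ (type $B_r$) are written in the standard basis $(\epsilon_i)_{i=1}^r$; a dominant integral weight is a tuple of integers $\lambda_1\ge\cdots\ge\lambda_r\ge0$. For such $\lambda$, $\mathbb{S}_\lambda$ is the complex irreducible representation of $\mathrm{Spin}(m)$ with highest weight $\lambda'=\lambda+(\frac12,\ldots,\frac12)$. The higher spin Dirac operator $\mathcal{R}_\lambda:\mathcal{S}_\lambda\to\mathcal{S}_\lambda$ is the invariant first-order differential operator, unique up to a nonzero constant, obtained by composing the gradient $f\mapsto\nabla f\in\mathcal{C}^\infty(\mathbb{R}^m,(\mathbb{R}^m)^*\otimes\mathbb{S}_\lambda)$ with the $\mathrm{Spin}(m)$-equivariant projection onto the irreducible summand $\mathbb{S}_\lambda$ of $(\mathbb{R}^m)^*\otimes\mathbb{S}_\lambda$. The operator $\Delta=\sum_{i=1}^m\partial_{x_i}^2$ is the Laplace operator acting componentwise. *)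

(* Defs.v *)
From HB Require Import structures.
From mathcomp Require Import all_boot all_order all_algebra.
From mathcomp Require Import complex.
From mathcomp Require Import all_classical all_reals all_analysis.

Set Implicit Arguments.
Unset Strict Implicit.
Unset Printing Implicit Defensive.

Import Order.TTheory GRing.Theory Num.Theory.
Import numFieldNormedType.Exports.

Local Open Scope ring_scope.

Fixpoint ndiff (R : realType) (U : normedModType R) (k : nat) (f : U -> R)
    : Prop :=
  if k is k'.+1 then
    (forall x : U, differentiable f x) /\
    (forall v : U, ndiff k' (fun x => 'D_v f x))
  else True.

Definition smooth (R : realType) (U : normedModType R) (f : U -> R) : Prop :=
  forall k : nat, ndiff k f.

(* R[i] carries no normed R-space structure in the library: smoothness and
   derivatives of complex functions are taken on real and imaginary parts. *)
Definition smoothC (R : realType) (U : normedModType R) (f : U -> R[i]) : Prop :=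
  smooth (fun x => complex.Re (f x)) /\ smooth (fun x => complex.Im (f x)).

Definition deriveC (R : realType) (U : normedModType R) (v : U) (f : U -> R[i])
    (x : U) : R[i] :=
  Complex ('D_v (fun y => complex.Re (f y)) x)
          ('D_v (fun y => complex.Im (f y)) x).

Definition partial (R : realType) (m n : nat) (i : 'I_m)
    (f : 'rV[R]_m -> 'cV[R[i]]_n) (x : 'rV[R]_m) : 'cV[R[i]]_n :=
  \col_k deriveC (delta_mx 0 i) (fun y => f y k 0) x.

Definition smooth_field (R : realType) (m n : nat)
    (f : 'rV[R]_m -> 'cV[R[i]]_n) : Prop :=
  forall k : 'I_n, smoothC (fun x => f x k 0).

Definition laplacian (R : realType) (m n : nat)
    (f : 'rV[R]_m -> 'cV[R[i]]_n) : 'rV[R]_m -> 'cV[R[i]]_n :=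
  fun x => \sum_(i < m) partial i (partial i f) x.

(* (R^m)^* (x) C^n is the space of m x n complex matrices, the elementary
   tensor of the i-th dual basis vector with z having z^T as its i-th row and
   zeros elsewhere; the gradient is the sum over i of eps^i (x) d_i f. *)
Definition gradient (R : realType) (m n : nat)
    (f : 'rV[R]_m -> 'cV[R[i]]_n) (x : 'rV[R]_m) : 'M[R[i]]_(m, n) :=
  \matrix_(i, k) partial i f x k 0.

(* The real Clifford algebra with e_i e_j + e_j e_i = - 2 delta_ij.
   An element is the row of its coordinates on the basis (e_A), where A runs
   over the subsets of 'I_m and e_A is the product of the e_i (i in A) in
   increasing order. *)
Definition cliff (R : realType) (m : nat) := 'rV[R]_#|{set 'I_m}|.

Definition cl_coef (R : realType) (m : nat) (x : cliff R m) (A : {set 'I_m}) : R :=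
  x 0 (enum_rank A).

Definition cl_of (R : realType) (m : nat) (g : {set 'I_m} -> R) : cliff R m :=
  \row_k g (enum_val k).

(* e_A e_B = (-1)^(cl_sign A B) e_(A symmetric difference B): one sign for each
   transposition needed to sort the word, one for each square e_i^2 = -1. *)
Definition cl_sign (m : nat) (A B : {set 'I_m}) : nat :=
  (#|[set p : 'I_m * 'I_m | [&& p.1 \in A, p.2 \in B & p.2 < p.1]]|
   + #|A :&: B|)%N.

Definition symdiff (m : nat) (A B : {set 'I_m}) : {set 'I_m} :=
  (A :\: B) :|: (B :\: A).

Definition cl_mul (R : realType) (m : nat) (x y : cliff R m) : cliff R m :=
  cl_of (fun C => \sum_(A : {set 'I_m}) \sum_(B : {set 'I_m} | symdiff A B == C)
                    (-1) ^+ cl_sign A B * cl_coef x A * cl_coef y B).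

Definition cl_one (R : realType) (m : nat) : cliff R m :=
  cl_of (fun A => (A == finset.set0)%:R).

Definition cl_vec (R : realType) (m : nat) (u : 'rV[R]_m) : cliff R m :=
  cl_of (fun A => \sum_(i < m) u 0 i * (A == [set i]%SET)%:R).

(* Clifford conjugation: the anti-automorphism with e_i |-> - e_i. *)
Definition cl_conj (R : realType) (m : nat) (x : cliff R m) : cliff R m :=
  cl_of (fun A => (-1) ^+ 'C(#|A|.+1, 2) * cl_coef x A).

Definition unit_vec (R : realType) (m : nat) (u : 'rV[R]_m) : bool :=
  \sum_(i < m) u 0 i ^+ 2 == 1.

Definition Spin (R : realType) (m : nat) (s : cliff R m) : Prop :=
  exists us : seq 'rV[R]_m,
    [/\ all (@unit_vec R m) us, ~~ odd (size us)
      & s = \big[@cl_mul R m / cl_one R m]_(u <- us) cl_vec u].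

(* The matrix of v |-> s v s^-1 on R^m; s^-1 = cl_conj s on Spin(m). *)
Definition spin_vec (R : realType) (m : nat) (s : cliff R m) : 'M[R]_m :=
  \matrix_(i, j)
    cl_coef (cl_mul (cl_mul s (cl_vec (delta_mx 0 j))) (cl_conj s)) [set i]%SET.

(* Spin(m) is a closed submanifold of the Clifford algebra, so a smooth map on
   it is the restriction of a smooth map on the whole algebra; the values of
   rho outside Spin(m) play no role below. *)
Definition spin_rep (R : realType) (m n : nat)
    (rho : cliff R m -> 'M[R[i]]_n) : Prop :=
  [/\ forall i j, smoothC (fun s : cliff R m => rho s i j),
      rho (cl_one R m) = 1%:M
    & forall s t, Spin s -> Spin t -> rho (cl_mul s t) = rho s *m rho t].

Definition spin_irreducible (R : realType) (m n : nat)
    (rho : cliff R m -> 'M[R[i]]_n) : Prop :=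
  (0 < n)%N /\
  forall U : {vspace 'cV[R[i]]_n},
    (forall s u, Spin s -> u \in U -> rho s *m u \in U) ->
    U = 0%VS \/ U = fullv.

(* The elements exp(theta/2 e_(2j) e_(2j+1)) (indices from 0), which cover the
   rotations of angle theta in the plane (e_(2j), e_(2j+1)); together they
   generate a maximal torus of Spin(2r+1). *)
Definition spin_torus (R : realType) (r : nat) (j : 'I_r) (theta : R)
    : cliff R r.*2.+1 :=
  cos (theta / 2) *: cl_one R r.*2.+1
  + sin (theta / 2) *: cl_mul (cl_vec (delta_mx 0 (inord j.*2)))
                              (cl_vec (delta_mx 0 (inord j.*2.+1))).

(* nu is given by its coordinates in the basis (epsilon_j): the infinitesimal
   rotation in the j-th plane acts on the weight space by 'i * nu_j. *)
Definition spin_weight (R : realType) (r n : nat)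
    (rho : cliff R r.*2.+1 -> 'M[R[i]]_n) (nu : 'I_r -> R) : Prop :=
  exists2 v : 'cV[R[i]]_n, v != 0 &
    forall (j : 'I_r) (theta : R),
      rho (spin_torus j theta) *m v
      = Complex (cos (nu j * theta)) (sin (nu j * theta)) *: v.

(* Type B_r: epsilon_k - epsilon_(k+1) for k < r - 1, and epsilon_(r-1). *)
Definition simple_root (R : realType) (r : nat) (k i : 'I_r) : R :=
  (i == k)%:R - (i == k.+1 :> nat)%:R.

Definition spin_highest_weight (R : realType) (r n : nat)
    (rho : cliff R r.*2.+1 -> 'M[R[i]]_n) (nu : 'I_r -> R) : Prop :=
  spin_weight rho nu /\
  forall mu : 'I_r -> R, spin_weight rho mu ->
    exists a : 'I_r -> nat,
      forall i : 'I_r, nu i - mu i = \sum_(k < r) (a k)%:R * simple_root R k i.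

Definition dominant (r : nat) (lam : 'I_r -> nat) : Prop :=
  forall i j : 'I_r, (i <= j)%N -> (lam j <= lam i)%N.

Definition spin_irrep (R : realType) (r n : nat) (lam : 'I_r -> nat)
    (rho : cliff R r.*2.+1 -> 'M[R[i]]_n) : Prop :=
  [/\ spin_rep rho, spin_irreducible rho
    & spin_highest_weight rho (fun i => (lam i)%:R + 2^-1)].

(* Contragredient of spin_vec tensored with rho. *)
Definition tensor_act (R : realType) (m n : nat)
    (rho : cliff R m -> 'M[R[i]]_n) (s : cliff R m) (T : 'M[R[i]]_(m, n))
    : 'M[R[i]]_(m, n) :=
  map_mx (real_complex R) (invmx (spin_vec s))^T *m T *m (rho s)^T.

(* proj is the Spin(m)-equivariant projection of (R^m)^* (x) S onto a direct
   summand isomorphic to S, this summand (the image of iota) being identified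
   with S through iota. For S irreducible, both identification and projection
   are unique up to nonzero constants. *)
Definition summand_projection (R : realType) (m n : nat)
    (rho : cliff R m -> 'M[R[i]]_n)
    (proj : {linear 'M[R[i]]_(m, n) -> 'cV[R[i]]_n}) : Prop :=
  (forall s T, Spin s -> proj (tensor_act rho s T) = rho s *m proj T) /\
  exists iota : {linear 'cV[R[i]]_n -> 'M[R[i]]_(m, n)},
    (forall s z, Spin s -> iota (rho s *m z) = tensor_act rho s (iota z)) /\
    (forall z, proj (iota z) = z).

Definition higher_spin_dirac (R : realType) (m n : nat)
    (proj : {linear 'M[R[i]]_(m, n) -> 'cV[R[i]]_n})
    (f : 'rV[R]_m -> 'cV[R[i]]_n) : 'rV[R]_m -> 'cV[R[i]]_n :=
  fun x => proj (gradient f x).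

(* Main.v *)
Require Import Defs.
From HB Require Import structures.
From mathcomp Require Import all_boot all_order all_algebra.
From mathcomp Require Import complex.
From mathcomp Require Import all_classical all_reals all_analysis.
From mathcomp Require Import ring lra zify.

Set Implicit Arguments.
Unset Strict Implicit.
Unset Printing Implicit Defensive.

Import Order.TTheory GRing.Theory Num.Theory.
Import numFieldNormedType.Exports.

Local Open Scope ring_scope.

(** The operator [R_lambda] has constant coefficients; write
    [P(x) = \sum_i x_i P_i] for its symbol, with [P_i z] the projection of
    [eps^i (x) z].  The theorem follows from an identity of matrices of
    polynomials [Q(x) P(x) = c (x_1^2 + ... + x_m^2)^(lambda_1 + 1)] with
    [c != 0]: substituting derivatives for the variables, which is legitimate
    because the partial derivatives of a smooth function commute, the left hand
    side annihilates [f] and the right hand side is a multiple of the power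
    [lambda_1 + 1] of the Laplacian ([system_polyharmonic]).  The factor [Q] is
    obtained from three facts ([symbol_divides]).

    The symbol is equivariant, [rho(s) P(x) = P(s x) rho(s)], and elliptic: [P(x)]
    is invertible for real [x != 0] ([symbol_injective]).  For ellipticity let
    [X_jk] be the infinitesimal rotations of the representation.  The Casimir
    element commutes with the [P_l], and the Leibniz rule turns this into
    [\sum_k P_k X_lk = r P_l] ([casimir_relation]).  On a vector [z] with
    [P_m z = 0] that is killed by the raising operators of the rotations of the
    first [2 r] coordinates, this relation is triangular in an isotropic basis
    ordered by height, and its diagonal entries are an integer plus or minus a
    weight coordinate.  The weights of a spinor-type representation are
    half-integral, so no diagonal entry is zero and every [P_l z] vanishes
    ([symbol_kernel]); by irreducibility [z = 0].

    By ellipticity and transitivity on the sphere, [det P(x) ^ 2] is a nonzero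
    constant times [q(x) ^ n], where [q] is the quadratic form.  Hence
    [B = det(P) adj(P)] satisfies [B P = c q^j] with [j = n].

    It remains to lower [j].  Such a [B] is equivariant and homogeneous of degree
    [2 j - 1].  At a null vector of the first coordinate plane, the rotations
    of that plane act by a character, so [B] shifts the eigenvalues of the
    first torus generator by [2 j - 1].  These eigenvalues are the first
    coordinates of the weights, of absolute value at most [lambda_1 + 1/2]; so a
    shift by [2 j - 1 > 2 lambda_1 + 1] is impossible and [B] vanishes there
    ([quot_at_zeta0], a Sylvester equation).  By equivariance [B] vanishes on
    enough of the null cone to be divisible by [q], and the quotient satisfies
    the same identity with [j - 1].  The descent stops at [j = lambda_1 + 1]. *)

(** * The Clifford algebra *)

Section Clifford.
Variables (R : realType) (m : nat).
Implicit Types (A B C : {set 'I_m}) (x y z s t : cliff R m) (u v w : 'rV[R]_m).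
Local Notation "x '**' y" := (cl_mul x y) (at level 40, left associativity).

Lemma in_symdiff A B i : (i \in symdiff A B) = (i \in A) (+) (i \in B).
Proof. by rewrite !inE; case: (i \in A); case: (i \in B). Qed.

Lemma symdiffC A B : symdiff A B = symdiff B A.
Proof. by apply/setP => i; rewrite !in_symdiff addbC. Qed.

Lemma symdiffA A B C : symdiff A (symdiff B C) = symdiff (symdiff A B) C.
Proof. by apply/setP => i; rewrite !in_symdiff addbA. Qed.

Lemma symdiffK A B : symdiff A (symdiff A B) = B.
Proof. by apply/setP => i; rewrite !in_symdiff addbA addbb. Qed.

Lemma symdiff0 A : symdiff A finset.set0 = A.
Proof. by apply/setP => i; rewrite in_symdiff inE addbF. Qed.

Lemma symdiffv A : symdiff A A = finset.set0.
Proof. by apply/setP => i; rewrite in_symdiff inE addbb. Qed.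

Lemma symdiff_eq A B C : (symdiff A B == C) = (B == symdiff A C).
Proof. by apply/eqP/eqP => [<-|->]; rewrite symdiffK. Qed.

(** The sign in [e_A e_B] is a bilinear form over the field with two elements:
    one factor for each pair [(a, b)] with [b <= a], the diagonal pairs
    accounting for the squares [e_i^2 = -1].  Bilinearity makes associativity a
    one-line identity. *)
Definition sgnAB A B : R :=
  \prod_(p : 'I_m * 'I_m | (p.2 <= p.1)%N) (-1) ^+ ((p.1 \in A) && (p.2 \in B)).

Lemma sgn_count (P : pred ('I_m * 'I_m)) :
  (-1) ^+ #|[set p | P p]| = \prod_p (-1) ^+ (P p) :> R.
Proof.
rewrite -sum1_card big_mkcond /= -prodrXr //.
by apply: eq_bigr => p _; rewrite inE; case: (P p).
Qed.

Lemma sgnABE A B : (-1) ^+ cl_sign A B = sgnAB A B.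
Proof.
have -> : cl_sign A B =
    #|[set p : 'I_m * 'I_m | [&& p.1 \in A, p.2 \in B & (p.2 <= p.1)%N]]|.
  rewrite /cl_sign.
  have -> : [set p : 'I_m * 'I_m | [&& p.1 \in A, p.2 \in B & (p.2 <= p.1)%N]]%SET =
   ([set p : 'I_m * 'I_m | [&& p.1 \in A, p.2 \in B & (p.2 < p.1)%N]]
    :|: [set (i, i) | i in A :&: B])%SET.
    apply/setP => -[i j]; rewrite !inE /= leq_eqVlt.
    apply/idP/idP.
      case/and3P => iA jB /orP[/eqP ij|->]; last by rewrite iA jB.
      apply/orP; right; apply/imsetP; exists i.
        by rewrite !inE iA (ord_inj (esym ij)).
      by rewrite (ord_inj ij).
    case/orP => [/and3P[-> -> ->]|/imsetP[k]]; first by rewrite orbT.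
    by rewrite !inE => /andP[kA kB] [-> ->]; rewrite kA kB eqxx.
  set U := [set p | _]%SET; set V := [set (i, i) | i in _]%SET.
  have UV0 : U :&: V = finset.set0.
    apply/setP => -[i j]; rewrite !inE /=.
    apply/negP => /andP[/and3P[_ _ lt_ji]] /imsetP[k _] [ik jk].
    by rewrite ik jk ltnn in lt_ji.
  rewrite cardsU UV0 cards0 subn0; congr (_ + _)%N.
  by rewrite card_imset // => i j [].
rewrite sgn_count /sgnAB [RHS]big_mkcond /=.
apply: eq_bigr => p _; case: ifP => _; last by rewrite !andbF.
by rewrite andbT.
Qed.

Lemma sgnABDl A B C : sgnAB (symdiff A B) C = sgnAB A C * sgnAB B C.
Proof.
rewrite -big_split /=; apply: eq_bigr => p _.
by rewrite -signr_addb -andb_addl in_symdiff.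
Qed.

Lemma sgnABDr A B C : sgnAB A (symdiff B C) = sgnAB A B * sgnAB A C.
Proof.
rewrite -big_split /=; apply: eq_bigr => p _.
by rewrite -signr_addb -andb_addr in_symdiff.
Qed.

Lemma sgnAB_sq A B : sgnAB A B * sgnAB A B = 1.
Proof. by rewrite -sgnABE -expr2 sqrr_sign. Qed.

Lemma sgnAB0l A : sgnAB finset.set0 A = 1.
Proof. by rewrite /sgnAB big1 // => p _; rewrite inE. Qed.

Lemma sgnAB0r A : sgnAB A finset.set0 = 1.
Proof. by rewrite /sgnAB big1 // => p _; rewrite inE andbF. Qed.

(** Clifford conjugation is the sign of [e_A e_A], the quadratic form of the
    bilinear form above; this is why it reverses products. *)
Lemma sgnAB_diag A : (-1) ^+ 'C(#|A|.+1, 2) = sgnAB A A.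
Proof.
rewrite -sgnABE /cl_sign finset.setIid; congr (_ ^+ _).
rewrite binS bin1; congr (_ + _)%N.
pose Lt := [set p : 'I_m * 'I_m | [&& p.1 \in A, p.2 \in A & (p.2 < p.1)%N]]%SET.
rewrite -/Lt.
pose Gt := [set p : 'I_m * 'I_m | [&& p.1 \in A, p.2 \in A & (p.1 < p.2)%N]]%SET.
pose Dg := [set (i, i) | i in A]%SET.
have cG : #|Gt| = #|Lt|.
  have -> : Gt = [set (p.2, p.1) | p in Lt]%SET.
    apply/setP => -[i j]; apply/idP/imsetP => [|[[k l]]].
      by rewrite inE /= => /and3P[? ? ?]; exists (j, i) => //; rewrite inE /=; exact/and3P.
    by rewrite !inE /= => /and3P[? ? ?] [-> ->]; exact/and3P.
  by rewrite card_imset // => -[? ?] [? ?] [-> ->].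
have cD : #|Dg| = #|A| by rewrite card_imset // => i j [].
have : #|finset.setX A A| = (#|Lt| + #|Gt| + #|Dg|)%N.
  have -> : finset.setX A A = (Lt :|: Gt :|: Dg)%SET.
    apply/setP => -[i j]; rewrite !inE /=; apply/idP/idP.
      case/andP => iA jA; rewrite iA jA /=.
      case: ltngtP => //= ij; apply/imsetP; exists i => //.
      by rewrite (ord_inj ij).
    case/orP => [/orP[]/and3P[-> -> _] //|/imsetP[k kA [-> ->]]].
    by rewrite kA.
  rewrite cardsU cardsU [Lt :&: Gt]disjoint_setI0 ?cards0 ?subn0; last first.
    rewrite -setI_eq0; apply/eqP/setP => -[i j]; rewrite !inE /=.
    by apply/negP => /andP[/and3P[_ _ h] /and3P[_ _]]; rewrite ltnNge ltnW.
  rewrite disjoint_setI0 ?cards0 ?subn0 // -setI_eq0.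
  apply/eqP/setP => -[i j]; rewrite !inE /=.
  apply/negP => /andP[h] /imsetP[k _ [ik jk]]; move: h.
  by rewrite ik jk ltnn !andbF.
rewrite cardsX cG cD bin2 => h.
have -> : (#|A| * #|A|.-1)%N = (#|Lt|.*2)%N.
  by case: #|A| h => [|k] /=; lia.
by rewrite doubleK.
Qed.

Lemma cl_coef_of (g : {set 'I_m} -> R) A : cl_coef (cl_of g) A = g A.
Proof. by rewrite /cl_coef mxE enum_rankK. Qed.

Lemma cl_ext x y : (forall A, cl_coef x A = cl_coef y A) -> x = y.
Proof.
move=> h; apply/rowP => k; move: (h (enum_val k)).
by rewrite /cl_coef enum_valK.
Qed.

Lemma cl_coefD x y A : cl_coef (x + y) A = cl_coef x A + cl_coef y A.
Proof. by rewrite /cl_coef mxE. Qed.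

Lemma cl_coefZ (a : R) x A : cl_coef (a *: x) A = a * cl_coef x A.
Proof. by rewrite /cl_coef mxE. Qed.

(** The product as a convolution on the group of subsets: only one [B] has
    symmetric difference [C] with a given [A]. *)
Lemma cl_coef_mul x y C :
  cl_coef (x ** y) C =
  \sum_A sgnAB A (symdiff A C) * cl_coef x A * cl_coef y (symdiff A C).
Proof.
rewrite cl_coef_of; apply: eq_bigr => A _.
rewrite (eq_bigl (pred1 (symdiff A C))); last by move=> B; rewrite symdiff_eq.
by rewrite big_pred1_eq sgnABE.
Qed.

Lemma cl_mulDl x y z : (x + y) ** z = x ** z + y ** z.
Proof.
apply: cl_ext => A; rewrite cl_coefD !cl_coef_mul -big_split /=.
by apply: eq_bigr => B _; rewrite cl_coefD; ring.
Qed.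

Lemma cl_mulDr x y z : x ** (y + z) = x ** y + x ** z.
Proof.
apply: cl_ext => A; rewrite cl_coefD !cl_coef_mul -big_split /=.
by apply: eq_bigr => B _; rewrite cl_coefD; ring.
Qed.

Lemma cl_mulZl a x y : (a *: x) ** y = a *: (x ** y).
Proof.
apply: cl_ext => A; rewrite cl_coefZ !cl_coef_mul big_distrr /=.
by apply: eq_bigr => B _; rewrite cl_coefZ; ring.
Qed.

Lemma cl_mulZr a x y : x ** (a *: y) = a *: (x ** y).
Proof.
apply: cl_ext => A; rewrite cl_coefZ !cl_coef_mul big_distrr /=.
by apply: eq_bigr => B _; rewrite cl_coefZ; ring.
Qed.

Lemma cl_mul1l x : cl_one R m ** x = x.
Proof.
apply: cl_ext => A; rewrite cl_coef_mul (bigD1 finset.set0) //= big1 ?addr0.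
  by rewrite cl_coef_of eqxx mulr1 sgnAB0l mul1r symdiffC symdiff0.
by move=> B /negPf nB; rewrite cl_coef_of nB mulr0 mul0r.
Qed.

Lemma cl_mul1r x : x ** cl_one R m = x.
Proof.
apply: cl_ext => A; rewrite cl_coef_mul (bigD1 A) //= big1 ?addr0.
  by rewrite symdiffv cl_coef_of eqxx mulr1 sgnAB0r mul1r.
move=> B nB; rewrite cl_coef_of symdiff_eq symdiff0 eq_sym (negPf nB).
by rewrite mulr0.
Qed.

Lemma cl_mulA x y z : x ** (y ** z) = x ** y ** z.
Proof.
apply: cl_ext => D; rewrite !cl_coef_mul.
under [RHS]eq_bigr => C _.
  rewrite cl_coef_mul mulr_sumr mulr_suml; over.
rewrite exchange_big /=; apply: eq_bigr => A _.
rewrite cl_coef_mul mulr_sumr.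
rewrite [RHS](reindex_inj (can_inj (symdiffK A))) /=.
apply: eq_bigr => B _; rewrite symdiffK.
have -> : symdiff (symdiff A B) D = symdiff B (symdiff A D).
  by rewrite symdiffA (symdiffC B).
have -> : sgnAB A (symdiff A D) = sgnAB A (symdiff B (symdiff B (symdiff A D))).
  by rewrite symdiffK.
by rewrite sgnABDr sgnABDl; ring.
Qed.

Lemma cl_conjM x y : cl_conj (x ** y) = cl_conj y ** cl_conj x.
Proof.
apply: cl_ext => C; rewrite cl_coef_of !cl_coef_mul mulr_sumr.
rewrite [RHS](reindex_inj (can_inj (fun B => symdiffK C B))) /=.
apply: eq_bigr => A _; rewrite !cl_coef_of !sgnAB_diag.
rewrite (symdiffC C A).
have -> : symdiff (symdiff A C) C = A by rewrite symdiffC (symdiffC A) symdiffK.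
have : C = symdiff A (symdiff A C) by rewrite symdiffK.
move: (symdiff A C) => B ->; rewrite (symdiffC A B) !sgnABDl !sgnABDr.
have := sgnAB_sq A B.
set a := sgnAB A B; set b := sgnAB B A => e.
transitivity ((a * a) * (sgnAB A A * b * sgnAB B B) * (cl_coef x A * cl_coef y B));
  by [ring | rewrite e; ring].
Qed.

Lemma cl_conj1 : cl_conj (cl_one R m) = cl_one R m.
Proof.
apply: cl_ext => A; rewrite !cl_coef_of; case: eqP => [->|_]; last by rewrite mulr0.
by rewrite cards0 mulr1.
Qed.

Lemma cl_coef_vec u A : cl_coef (cl_vec u) A = \sum_i u 0 i * (A == [set i]%SET)%:R.
Proof. by rewrite cl_coef_of. Qed.

Lemma cl_coef_vec1 u i : cl_coef (cl_vec u) [set i]%SET = u 0 i.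
Proof.
rewrite cl_coef_vec (bigD1 i) //= eqxx mulr1 big1 ?addr0 // => j ji.
by rewrite (inj_eq finset.set1_inj) eq_sym (negPf ji) mulr0.
Qed.

Lemma cl_vecD u v : cl_vec (u + v) = cl_vec u + cl_vec v.
Proof.
apply: cl_ext => A; rewrite cl_coefD !cl_coef_vec -big_split /=.
by apply: eq_bigr => i _; rewrite mxE mulrDl.
Qed.

Lemma cl_vecZ a u : cl_vec (a *: u) = a *: cl_vec u.
Proof.
apply: cl_ext => A; rewrite cl_coefZ !cl_coef_vec mulr_sumr /=.
by apply: eq_bigr => i _; rewrite mxE mulrA.
Qed.

Lemma cl_conj_vec u : cl_conj (cl_vec u) = - cl_vec u.
Proof.
apply: cl_ext => A; rewrite -scaleN1r cl_coefZ !cl_coef_of !mulr_sumr.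
apply: eq_bigr => i _; case: eqP => [->|_]; last by rewrite !mulr0.
by rewrite cards1 expr1.
Qed.

End Clifford.

(** * The action of the spin group on vectors *)

Section SpinAction.
Variables (R : realType) (m : nat).
Implicit Types (A B C : {set 'I_m}) (x y z s t : cliff R m) (u v w a b : 'rV[R]_m).
Local Notation "x '**' y" := (cl_mul x y) (at level 40, left associativity).
Local Notation "1c" := (cl_one R m).
Local Notation ev i := (delta_mx 0 i : 'rV[R]_m).

Definition dotv u v : R := \sum_i u 0 i * v 0 i.

Lemma dotvC u v : dotv u v = dotv v u.
Proof. by apply: eq_bigr => i _; rewrite mulrC. Qed.

Lemma mulmx_dotv u v : u *m v^T = (dotv u v)%:M.
Proof.
apply/matrixP => i j; rewrite !ord1 !mxE eqxx mulr1n.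
by apply: eq_bigr => k _; rewrite mxE.
Qed.

Lemma unit_vecE u : unit_vec u = (dotv u u == 1).
Proof. by congr (_ == 1); apply: eq_bigr => i _; rewrite expr2. Qed.

Lemma cl_mul0l x : 0 ** x = 0.
Proof. by rewrite -[X in X ** _](scale0r (0 : cliff R m)) cl_mulZl scale0r. Qed.

Lemma cl_mul0r x : x ** 0 = 0.
Proof. by rewrite -[X in _ ** X](scale0r (0 : cliff R m)) cl_mulZr scale0r. Qed.

Lemma cl_mulNl x y : (- x) ** y = - (x ** y).
Proof. by rewrite -scaleN1r cl_mulZl scaleN1r. Qed.

Lemma cl_mulNr x y : x ** (- y) = - (x ** y).
Proof. by rewrite -scaleN1r cl_mulZr scaleN1r. Qed.

Lemma cl_mul_suml (I : Type) (r : seq I) (P : pred I) (F : I -> cliff R m) y :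
  (\sum_(i <- r | P i) F i) ** y = \sum_(i <- r | P i) (F i ** y).
Proof. by elim/big_rec2: _ => [|i z z' _ <-]; rewrite ?cl_mul0l ?cl_mulDl. Qed.

Lemma cl_mul_sumr (I : Type) (r : seq I) (P : pred I) (F : I -> cliff R m) y :
  y ** (\sum_(i <- r | P i) F i) = \sum_(i <- r | P i) (y ** F i).
Proof. by elim/big_rec2: _ => [|i z z' _ <-]; rewrite ?cl_mul0r ?cl_mulDr. Qed.

Lemma cl_vecN u : cl_vec (- u) = - cl_vec u.
Proof. by rewrite -scaleN1r cl_vecZ scaleN1r. Qed.

Lemma cl_vec_sum u : cl_vec u = \sum_i u 0 i *: cl_vec (ev i).
Proof.
rewrite [in LHS](row_sum_delta u); elim/big_rec2: _ => [|i z z' _ <-].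
  by apply/rowP => k; rewrite !mxE big1 // => i _; rewrite mxE mul0r.
by rewrite cl_vecD cl_vecZ.
Qed.

Lemma cl_coef_ev i A : cl_coef (cl_vec (ev i)) A = (A == [set i]%SET)%:R.
Proof.
rewrite cl_coef_vec (bigD1 i) //= mxE !eqxx mul1r big1 ?addr0 // => j ji.
by rewrite mxE (negPf ji) andbF mul0r.
Qed.

Lemma cl_mul_ev i j C : cl_coef (cl_vec (ev i) ** cl_vec (ev j)) C =
  sgnAB R [set i]%SET [set j]%SET * (C == symdiff [set i]%SET [set j]%SET)%:R.
Proof.
rewrite cl_coef_mul (bigD1 [set i]%SET) //= big1 ?addr0; last first.
  by move=> B nB; rewrite cl_coef_ev (negPf nB) mulr0 mul0r.
rewrite !cl_coef_ev eqxx mulr1 symdiff_eq.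
by case: eqP => [->|]; rewrite ?mulr0 // symdiffK.
Qed.

Lemma sgnAB1 (i j : 'I_m) : sgnAB R [set i]%SET [set j]%SET = (-1) ^+ (j <= i)%N.
Proof.
rewrite /sgnAB; case: leqP => ji.
  rewrite (bigD1 (i, j)) //= !inE !eqxx /= big1 ?mulr1 // => -[k l] /= /andP[_ kl].
  by rewrite !inE -xpair_eqE (negPf kl).
rewrite big1 // => -[k l] /= lk; rewrite !inE -xpair_eqE.
by case: eqP => // -[ki lj]; move: lk; rewrite ki lj leqNgt ji.
Qed.

Lemma cl_ev_anti i j :
  cl_vec (ev i) ** cl_vec (ev j) + cl_vec (ev j) ** cl_vec (ev i) =
  (- ((i == j)%:R *+ 2)) *: 1c.
Proof.
apply: cl_ext => C; rewrite cl_coefD cl_coefZ !cl_mul_ev cl_coef_of !sgnAB1.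
case: (eqVneq i j) => [->|ij].
  by rewrite symdiffv leqnn /=; case: eqP => _; rewrite /= ?mulr1 ?mulr0 ?addr0 //; ring.
rewrite (symdiffC [set j]%SET) mul0rn oppr0 mul0r.
have : i != j :> nat by [].
by case: ltngtP => // _ _; case: (C == _); rewrite /=; ring.
Qed.

Lemma cl_vec_anti u v :
  cl_vec u ** cl_vec v + cl_vec v ** cl_vec u = (- (dotv u v *+ 2)) *: 1c.
Proof.
rewrite [cl_vec u]cl_vec_sum [cl_vec v]cl_vec_sum.
rewrite cl_mul_suml cl_mul_sumr -big_split /=.
rewrite /dotv -sumrMnl -sumrN scaler_suml; apply: eq_bigr => i _.
rewrite cl_mul_suml cl_mul_sumr -big_split /= (bigD1 i) //= big1 ?addr0.
  rewrite !cl_mulZl !cl_mulZr !scalerA (mulrC (v 0 i)) -scalerDr.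
  by rewrite cl_ev_anti eqxx scalerA mulrN mulrnAr mulr1.
move=> j ji; rewrite !cl_mulZl !cl_mulZr !scalerA (mulrC (v 0 j)) -scalerDr.
by rewrite cl_ev_anti eq_sym (negPf ji) mul0rn oppr0 scale0r scaler0.
Qed.

Lemma cl_vec_sq u : cl_vec u ** cl_vec u = (- dotv u u) *: 1c.
Proof.
apply/rowP => k; have /rowP/(_ k) := cl_vec_anti u u.
by rewrite !mxE; move: (cl_one R m 0 k) (dotv u u) => p q; lra.
Qed.

(** Minus the reflection in the hyperplane orthogonal to a unit vector [a]: it
    fixes [a] and negates its orthogonal complement.  This sign is the one
    produced by conjugation with [a] in the Clifford algebra. *)
Definition reflm a : 'M[R]_m := (2 : R) *: (a^T *m a) - 1%:M.

Lemma reflm_tr a : (reflm a)^T = reflm a.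
Proof. by rewrite /reflm linearB linearZ /= trmx_mul trmxK trmx1. Qed.

Lemma mul_reflm u a : u *m reflm a = (2 * dotv u a) *: a - u.
Proof.
by rewrite mulmxBr mulmx1 -scalemxAr mulmxA mulmx_dotv mul_scalar_mx scalerA.
Qed.

Lemma reflmN a : reflm (- a) = reflm a.
Proof. by rewrite /reflm (_ : (- a)^T = - a^T) ?mulNmx ?mulmxN ?opprK //; apply/matrixP => i j; rewrite !mxE. Qed.

Lemma reflmK a : unit_vec a -> reflm a *m reflm a = 1%:M.
Proof.
rewrite unit_vecE => /eqP a1; apply/row_matrixP => i.
rewrite -[in LHS](mul1mx (_ *m _)) row_mul row1 mulmxA [delta_mx 0 i *m _]mul_reflm mulmxBl.
rewrite -scalemxAl !mul_reflm a1; move: (2 * dotv _ a) => c.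
by apply/rowP => k; rewrite !mxE; ring.
Qed.

Lemma cl_vec_conj u v : unit_vec u ->
  cl_vec u ** cl_vec v ** cl_conj (cl_vec u) = cl_vec (v *m reflm u).
Proof.
rewrite unit_vecE => /eqP u1; rewrite cl_conj_vec cl_mulNr.
have -> : cl_vec u ** cl_vec v = (- (dotv u v *+ 2)) *: 1c - cl_vec v ** cl_vec u.
  by rewrite -cl_vec_anti addrK.
rewrite cl_mulDl cl_mulZl cl_mul1l cl_mulNl -cl_mulA cl_vec_sq u1.
rewrite cl_mulZr cl_mul1r mul_reflm cl_vecD cl_vecZ cl_vecN.
rewrite dotvC; move: (cl_vec u) (cl_vec v) (dotv v u) => p q c.
by apply/rowP => k; rewrite !mxE; ring.
Qed.

(** Conjugation by [s] acts on vectors by [S]; the transpose is there because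
    vectors are rows. *)
Definition cl_acts s (S : 'M[R]_m) := forall v,
  s ** cl_vec v ** cl_conj s = cl_vec (v *m S^T).

Lemma cl_acts_spin_vec s S : cl_acts s S -> spin_vec s = S.
Proof.
move=> h; apply/matrixP => i j.
by rewrite mxE h cl_coef_vec1 -rowE !mxE.
Qed.

Definition clprod (us : seq 'rV[R]_m) : cliff R m :=
  \big[@cl_mul R m / 1c]_(u <- us) cl_vec u.

Definition reflms (us : seq 'rV[R]_m) : 'M[R]_m :=
  foldr (fun u M => reflm u *m M) 1%:M us.

Lemma clprod_cons u us : clprod (u :: us) = cl_vec u ** clprod us.
Proof. by rewrite /clprod big_cons. Qed.

Lemma clprod_cat us vs : clprod (us ++ vs) = clprod us ** clprod vs.
Proof.
elim: us => [|u us IH]; first by rewrite /clprod big_nil cl_mul1l.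
by rewrite cat_cons !clprod_cons IH cl_mulA.
Qed.

Lemma clprod_acts us : all (@unit_vec R m) us -> cl_acts (clprod us) (reflms us).
Proof.
elim: us => [_ v|u us IH /= /andP[u1 us1] v].
  by rewrite /clprod big_nil /= cl_mul1l cl_conj1 cl_mul1r trmx1 mulmx1.
rewrite clprod_cons cl_conjM !cl_mulA -[_ ** _ ** cl_vec v]cl_mulA.
rewrite -[cl_vec u ** (_ ** _) ** _]cl_mulA IH // cl_vec_conj //.
by rewrite trmx_mul reflm_tr mulmxA.
Qed.

Lemma reflms_orth us : all (@unit_vec R m) us -> reflms us *m (reflms us)^T = 1%:M.
Proof.
elim: us => [_|u us IH /= /andP[u1 us1]]; first by rewrite trmx1 mulmx1.
rewrite trmx_mul mulmxA -[_ *m reflms us *m _]mulmxA IH // mulmx1.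
by rewrite reflm_tr reflmK.
Qed.

Lemma clprod_conj us :
  cl_conj (clprod us) = clprod [seq - u | u <- rev us].
Proof.
elim: us => [|u us IH]; first by rewrite /clprod !big_nil cl_conj1.
rewrite clprod_cons cl_conjM IH rev_cons map_rcons -cats1 clprod_cat.
rewrite clprod_cons [clprod [::]]big_nil cl_mul1r cl_conj_vec.
by rewrite cl_vecN.
Qed.

Lemma unit_vecN u : unit_vec (- u) = unit_vec u.
Proof.
by rewrite !unit_vecE /dotv; congr (_ == 1); apply: eq_bigr => i _; rewrite mxE mulrNN.
Qed.

Lemma clprodV us : all (@unit_vec R m) us ->
  (clprod us ** cl_conj (clprod us) = 1c) * (cl_conj (clprod us) ** clprod us = 1c).
Proof.
elim: us => [_|u us IH /= /andP[u1 /IH[IH1 IH2]]].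
  by rewrite /clprod big_nil cl_conj1 cl_mul1l.
have uu : cl_vec u ** cl_vec u = - 1c.
  by rewrite cl_vec_sq; move: u1; rewrite unit_vecE => /eqP ->; rewrite scaleN1r.
rewrite clprod_cons cl_conjM cl_conj_vec !cl_mulNr !cl_mulA; split.
  rewrite -[_ ** _ ** cl_conj _]cl_mulA IH1 cl_mul1r.
  by rewrite uu opprK.
rewrite cl_mulNl -[_ ** _ ** cl_vec u]cl_mulA uu cl_mulNr cl_mul1r.
by rewrite !cl_mulNl !opprK IH2.
Qed.

Lemma Spin_vec_act s : Spin s -> cl_acts s (spin_vec s).
Proof.
case=> us [us1 _ ->] v; have h := clprod_acts us1.
by rewrite (cl_acts_spin_vec h) -h.
Qed.

Lemma SpinM s t : Spin s -> Spin t -> Spin (s ** t).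
Proof.
case=> us [us1 us2 ->] [vs [vs1 vs2 ->]]; exists (us ++ vs); split.
- by rewrite all_cat us1.
- by rewrite size_cat oddD (negPf us2) (negPf vs2).
- by rewrite -!/(clprod _) clprod_cat.
Qed.

Lemma SpinV s : Spin s -> Spin (cl_conj s).
Proof.
case=> us [us1 us2 ->]; exists [seq - u | u <- rev us]; split.
- rewrite all_map all_rev; apply: sub_all us1 => u /=.
  by rewrite unit_vecN.
- by rewrite size_map size_rev.
- by rewrite -!/(clprod _) clprod_conj.
Qed.

Lemma Spin_conjr s : Spin s -> s ** cl_conj s = 1c.
Proof. by case=> us [us1 us2 ->]; rewrite -/(clprod us) clprodV. Qed.

Lemma Spin_conjl s : Spin s -> cl_conj s ** s = 1c.
Proof. by case=> us [us1 us2 ->]; rewrite -/(clprod us) clprodV. Qed.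

Lemma spin_vec_orth s : Spin s -> spin_vec s *m (spin_vec s)^T = 1%:M.
Proof.
case=> us [us1 _ ->]; rewrite -/(clprod us).
by rewrite (cl_acts_spin_vec (clprod_acts us1)) reflms_orth.
Qed.

Lemma Spin_pair u v : unit_vec u -> unit_vec v -> Spin (cl_vec u ** cl_vec v).
Proof.
move=> u1 v1; exists [:: u; v]; split; rewrite ?all_seq2 /= ?u1 ?v1 //.
by rewrite !big_cons big_nil cl_mul1r.
Qed.

Lemma spin_vec_pair u v : unit_vec u -> unit_vec v ->
  spin_vec (cl_vec u ** cl_vec v) = reflm u *m reflm v.
Proof.
move=> u1 v1; apply: cl_acts_spin_vec.
have := @clprod_acts [:: u; v]; rewrite /= u1 v1 mulmx1 => /(_ isT).
by rewrite /clprod !big_cons big_nil cl_mul1r.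
Qed.

(** The lift to the spin group of the rotation by [th] in the oriented plane
    spanned by [ev j] and [ev k]; the half angle comes from the double cover. *)
Definition spin_rot (j k : 'I_m) (th : R) : cliff R m :=
  cos (th / 2) *: 1c + sin (th / 2) *: (cl_vec (ev j) ** cl_vec (ev k)).

(** A rotation by [th] is the product of the reflections in two vectors at angle
    [th / 2]. *)
Definition half_vec (j k : 'I_m) (th : R) : 'rV[R]_m :=
  cos (th / 2) *: ev j + sin (th / 2) *: ev k.

Lemma dotv_ev i j : dotv (ev i) (ev j) = (i == j)%:R.
Proof.
rewrite /dotv (bigD1 i) //= big1 ?addr0; first by rewrite !mxE !eqxx mul1r.
by move=> k ki; rewrite mxE (negPf ki) andbF mul0r.
Qed.

Lemma unit_ev i : unit_vec (ev i).
Proof. by rewrite unit_vecE dotv_ev eqxx. Qed.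

Lemma dotvDl u v w : dotv (u + v) w = dotv u w + dotv v w.
Proof. by rewrite -big_split /=; apply: eq_bigr => i _; rewrite mxE mulrDl. Qed.

Lemma dotvZl c u v : dotv (c *: u) v = c * dotv u v.
Proof. by rewrite /dotv mulr_sumr; apply: eq_bigr => i _; rewrite mxE mulrA. Qed.

Lemma unit_half_vec j k th : j != k -> unit_vec (half_vec j k th).
Proof.
move=> jk; rewrite unit_vecE /half_vec dotvDl !dotvZl.
rewrite ![dotv _ (_ + _)]dotvC !dotvDl !dotvZl !dotv_ev !eqxx (eq_sym k) (negPf jk).
by rewrite ?(mulr0, mulr1, addr0, add0r) -!expr2 cos2Dsin2.
Qed.

Lemma spin_rotE j k th : j != k ->
  spin_rot j k th = cl_vec (half_vec j k th) ** cl_vec (- ev j).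
Proof.
move=> jk; rewrite /half_vec cl_vecD !cl_vecZ cl_vecN.
rewrite cl_mulNr cl_mulDl !cl_mulZl cl_vec_sq dotv_ev eqxx scaleN1r.
have -> : cl_vec (ev k) ** cl_vec (ev j) = - (cl_vec (ev j) ** cl_vec (ev k)).
  apply/eqP; rewrite -addr_eq0 addrC cl_ev_anti (negPf jk).
  by rewrite mul0rn oppr0 scale0r.
by rewrite !scalerN opprD !opprK.
Qed.

Lemma Spin_rot j k th : j != k -> Spin (spin_rot j k th).
Proof.
by move=> jk; rewrite spin_rotE //; apply: Spin_pair; rewrite ?unit_half_vec ?unit_vecN ?unit_ev.
Qed.

Lemma spin_vec_rot j k th : j != k ->
  spin_vec (spin_rot j k th) = reflm (half_vec j k th) *m reflm (ev j).
Proof.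
move=> jk; rewrite spin_rotE // spin_vec_pair ?unit_half_vec ?unit_vecN ?unit_ev //.
by rewrite reflmN.
Qed.

Lemma spin_rot0 j k : spin_rot j k 0 = 1c.
Proof. by rewrite /spin_rot mul0r cos0 sin0 scale1r scale0r addr0. Qed.

Lemma spin_rotD (j k : 'I_m) (a b : R) : j != k ->
  spin_rot j k (a + b) = spin_rot j k a ** spin_rot j k b.
Proof.
move=> jk; rewrite /spin_rot mulrDl cosD sinD.
set X := cl_vec _ ** cl_vec _.
have XX : X ** X = - 1c.
  rewrite /X cl_mulA -[_ ** _ ** cl_vec (ev j)]cl_mulA.
  have -> : cl_vec (ev k) ** cl_vec (ev j) = - (cl_vec (ev j) ** cl_vec (ev k)).
    apply/eqP; rewrite -addr_eq0 addrC cl_ev_anti (negPf jk).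
    by rewrite mul0rn oppr0 scale0r.
  rewrite cl_mulNr !cl_mulNl cl_mulA cl_vec_sq -cl_mulA cl_vec_sq.
  by rewrite !dotv_ev !eqxx cl_mulZr cl_mulZl cl_mul1l scalerA mulrNN mulr1 scale1r.
rewrite !(cl_mulDl, cl_mulDr, cl_mulZl, cl_mulZr) !cl_mul1l !cl_mul1r XX.
clearbody X; move: {XX}(cl_one R m) => e.
by apply/rowP => i; rewrite !mxE; ring.
Qed.

(** Transitivity on the unit sphere: up to sign, the reflection in the bisector
    hyperplane of [u] and [v] exchanges them, and it acts by [-1] on the vectors
    that have the same inner product with both.  A product of two such maps is
    in the image of the spin group. *)
Lemma reflm_swap u v w : unit_vec u -> unit_vec v -> u != v ->
  let a := (Num.sqrt (dotv (u - v) (u - v)))^-1 *: (u - v) in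
  [/\ unit_vec a, u *m reflm a = - v &
      dotv u w = dotv v w -> w *m reflm a = - w].
Proof.
rewrite !unit_vecE => /eqP u1 /eqP v1 uv a.
have dp : 0 < dotv (u - v) (u - v).
  have : dotv (u - v) (u - v) != 0.
    apply/negP; rewrite /dotv psumr_eq0; last by move=> i _; rewrite -expr2 sqr_ge0.
    move=> /allP h; move/eqP: uv; apply; apply/rowP => i.
    have := h i (mem_index_enum _); rewrite -expr2 sqrf_eq0 !mxE subr_eq0.
    by move/eqP.
  by rewrite lt_def => ->; apply: sumr_ge0 => i _; rewrite -expr2 sqr_ge0.
set d := dotv (u - v) (u - v) in a dp *.
have aa : (Num.sqrt d)^-1 * (Num.sqrt d)^-1 = d^-1.
  by rewrite -invfM -expr2 sqr_sqrtr // ltW.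
have h w' : w' *m reflm a = (2 * dotv w' (u - v) / d) *: (u - v) - w'.
  rewrite mul_reflm /a dotvC dotvZl (dotvC _ w') scalerA; congr (_ *: _ - _).
  by rewrite -[in RHS]aa !mulrA [in RHS]mulrAC -!mulrA; congr (_ * _); rewrite mulrC mulrA.
have dN (p q z' : 'rV[R]_m) : dotv p (q - z') = dotv p q - dotv p z'.
  by rewrite !(dotvC p) dotvDl -(scaleN1r z') dotvZl mulN1r.
split.
- by rewrite unit_vecE /a dotvZl dotvC dotvZl mulrA aa mulVf // gt_eqF.
- have -> : - v = (u - v) - u by rewrite addrAC subrr add0r.
  rewrite h; congr (_ - _); rewrite -[RHS]scale1r; congr (_ *: _).
  have dE : d = 2 * dotv u (u - v).
    by rewrite /d !dN (dotvC _ u) (dotvC _ v) !dN u1 v1 (dotvC v u); ring.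
  by rewrite -dE divff // gt_eqF.
- by move=> e; rewrite h dN !(dotvC w) e subrr mulr0 mul0r scale0r sub0r.
Qed.

End SpinAction.

(** * Curves in complex matrices *)

Section ComplexCalculus.
Variable R : realType.
Local Notation C := (R[i]).
Implicit Types (F G : R -> C) (t : R) (d e : C).

(** Complex differentiability along a real parameter, on real and imaginary
    parts. *)
Definition cder F t d : Prop :=
  is_derive t 1 (fun s => complex.Re (F s)) (complex.Re d) /\
  is_derive t 1 (fun s => complex.Im (F s)) (complex.Im d).

Lemma cder_eq F t d e : cder F t d -> d = e -> cder F t e.
Proof. by move=> h <-. Qed.

Lemma cder_ext F G t d : F =1 G -> cder F t d -> cder G t d.
Proof. by move=> /funext ->. Qed.

Lemma cder_cst (c : C) t : cder (fun=> c) t 0.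
Proof. by split; apply: is_derive_cst. Qed.

Lemma Re_add (x y : C) : complex.Re (x + y) = complex.Re x + complex.Re y.
Proof. by case: x; case: y. Qed.

Lemma Im_add (x y : C) : complex.Im (x + y) = complex.Im x + complex.Im y.
Proof. by case: x; case: y. Qed.

Lemma cder_add F G t d e : cder F t d -> cder G t e ->
  cder (fun s => F s + G s) t (d + e).
Proof.
case=> [f1 f2] [g1 g2]; split.
  have -> : (fun s => complex.Re (F s + G s)) =
    (fun s => complex.Re (F s)) \+ (fun s => complex.Re (G s)).
    by apply/funext => s /=; rewrite Re_add.
  by rewrite Re_add; apply: is_deriveD.
have -> : (fun s => complex.Im (F s + G s)) =
    (fun s => complex.Im (F s)) \+ (fun s => complex.Im (G s)).
  by apply/funext => s /=; rewrite Im_add.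
by rewrite Im_add; apply: is_deriveD.
Qed.

Lemma Re_mul (x y : C) : complex.Re (x * y) =
  complex.Re x * complex.Re y - complex.Im x * complex.Im y.
Proof. by case: x; case: y. Qed.

Lemma Im_mul (x y : C) : complex.Im (x * y) =
  complex.Re x * complex.Im y + complex.Im x * complex.Re y.
Proof. by case: x; case: y. Qed.

Lemma cder_mul F G t d e : cder F t d -> cder G t e ->
  cder (fun s => F s * G s) t (d * G t + F t * e).
Proof.
case=> [f1 f2] [g1 g2]; split.
  have -> : (fun s => complex.Re (F s * G s)) =
    (fun s => complex.Re (F s)) * (fun s => complex.Re (G s)) -
    (fun s => complex.Im (F s)) * (fun s => complex.Im (G s)).
    by apply/funext => s /=; rewrite Re_mul.
  apply: (is_derive_eq (is_deriveB (is_deriveM f1 g1) (is_deriveM f2 g2))).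
  by rewrite Re_add !Re_mul /GRing.scale /=; ring.
have -> : (fun s => complex.Im (F s * G s)) =
    (fun s => complex.Re (F s)) * (fun s => complex.Im (G s)) +
    (fun s => complex.Im (F s)) * (fun s => complex.Re (G s)).
  by apply/funext => s /=; rewrite Im_mul.
apply: (is_derive_eq (is_deriveD (is_deriveM f1 g2) (is_deriveM f2 g1))).
by rewrite Im_add !Im_mul /GRing.scale /=; ring.
Qed.

Lemma cder_sum (I : Type) (r : seq I) (P : pred I) (F : I -> R -> C) t (d : I -> C) :
  (forall i, P i -> cder (F i) t (d i)) ->
  cder (fun s => \sum_(i <- r | P i) F i s) t (\sum_(i <- r | P i) d i).
Proof.
move=> h; elim: r => [|i r IH].
  by rewrite big_nil; apply: cder_ext (cder_cst 0 t) => s; rewrite big_nil.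
rewrite big_cons; case: ifP => Pi.
  by apply: cder_ext (cder_add (h i Pi) IH) => s; rewrite big_cons Pi.
by apply: cder_ext IH => s; rewrite big_cons Pi.
Qed.

Lemma cder_uniq F t d e : cder F t d -> cder F t e -> d = e.
Proof.
case=> [f1 f2] [g1 g2]; case: d e f1 f2 g1 g2 => [a b] [c e] /= f1 f2 g1 g2.
congr Complex; first by rewrite -(@derive_val _ _ _ _ _ _ _ f1); apply: derive_val.
by rewrite -(@derive_val _ _ _ _ _ _ _ f2); apply: derive_val.
Qed.

Lemma cder_real (g : R -> R) t (d : R) :
  is_derive t 1 g d -> cder (fun s => (g s)%:C%C) t (d%:C%C).
Proof. by move=> h; split => //=; apply: is_derive_cst. Qed.

Lemma cder0_cst F : (forall t, cder F t 0) -> forall t, F t = F 0.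
Proof.
move=> h t.
have hR := @is_derive_0_is_cst R (fun s => complex.Re (F s)) t 0 (fun x => (h x).1).
have hI := @is_derive_0_is_cst R (fun s => complex.Im (F s)) t 0 (fun x => (h x).2).
by move: hR hI => /=; case: (F t) => a b; case: (F 0) => a' b' /= -> ->.
Qed.

Definition mxder p q (F : R -> 'M[C]_(p, q)) t (D : 'M[C]_(p, q)) : Prop :=
  forall i j, cder (fun s => F s i j) t (D i j).

Lemma mxder_eq p q (F : R -> 'M[C]_(p, q)) t D E : mxder F t D -> D = E -> mxder F t E.
Proof. by move=> h <-. Qed.

Lemma mxder_ext p q (F G : R -> 'M[C]_(p, q)) t D :
  F =1 G -> mxder F t D -> mxder G t D.
Proof. by move=> /funext ->. Qed.

Lemma mxder_cst p q (A : 'M[C]_(p, q)) t : mxder (fun=> A) t 0.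
Proof. by move=> i j; rewrite mxE; apply: cder_cst. Qed.

Lemma mxder_mul p q k (F : R -> 'M[C]_(p, q)) (G : R -> 'M[C]_(q, k)) t D E :
  mxder F t D -> mxder G t E ->
  mxder (fun s => F s *m G s) t (D *m G t + F t *m E).
Proof.
move=> f g i j; rewrite !mxE -big_split /=.
apply: cder_ext (cder_sum _ (fun k _ => cder_mul (f i k) (g k j))) => s.
by rewrite mxE.
Qed.

Lemma mxder_scale p q (F : R -> C) (G : R -> 'M[C]_(p, q)) t d E :
  cder F t d -> mxder G t E -> mxder (fun s => F s *: G s) t (d *: G t + F t *: E).
Proof.
by move=> f g i j; rewrite !mxE; apply: cder_ext (cder_mul f (g i j)) => s; rewrite mxE.
Qed.

Lemma mxder_sum p q (I : Type) (r : seq I) (P : pred I) (F : I -> R -> 'M[C]_(p, q)) t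
    (D : I -> 'M[C]_(p, q)) :
  (forall i, P i -> mxder (F i) t (D i)) ->
  mxder (fun s => \sum_(i <- r | P i) F i s) t (\sum_(i <- r | P i) D i).
Proof.
move=> h i j; rewrite summxE.
by apply: cder_ext (cder_sum _ (fun k Pk => h k Pk i j)) => s; rewrite summxE.
Qed.

Lemma mxder_uniq p q (F : R -> 'M[C]_(p, q)) t D E :
  mxder F t D -> mxder F t E -> D = E.
Proof. by move=> f g; apply/matrixP => i j; apply: cder_uniq (f i j) (g i j). Qed.

Lemma mxder0_cst p q (F : R -> 'M[C]_(p, q)) :
  (forall t, mxder F t 0) -> forall t, F t = F 0.
Proof.
move=> h t; apply/matrixP => i j.
apply: (@cder0_cst (fun s => F s i j)) => s.
by have := h s i j; rewrite mxE.
Qed.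

Lemma is_derive_half : is_derive (0 : R) 1 (fun s : R => s / 2) 2^-1.
Proof.
apply: (is_derive_eq (is_deriveM (is_derive_id _ _) (is_derive_cst _ _ _))).
by rewrite /GRing.scale /= mulr0 mulr1 add0r.
Qed.

Lemma is_derive_cos_half : is_derive (0 : R) 1 (fun s : R => cos (s / 2)) 0.
Proof.
apply: (is_derive_eq (@is_derive1_comp _ cos (fun s => s / 2) 0 _ _ (is_derive_cos _) is_derive_half)).
by rewrite mul0r sin0 oppr0 mul0r.
Qed.

Lemma is_derive_sin_half : is_derive (0 : R) 1 (fun s : R => sin (s / 2)) 2^-1.
Proof.
apply: (is_derive_eq (@is_derive1_comp _ sin (fun s => s / 2) 0 _ _ (is_derive_sin _) is_derive_half)).
by rewrite mul0r cos0 mul1r.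
Qed.

(** The entries of a rotation matrix are quadratic in the sine and the cosine of
    the half angle. *)
Lemma is_derive_quad_half (A B D E : R) :
  is_derive (0 : R) 1 (fun th : R => A * cos (th / 2) ^+ 2
     + B * (cos (th / 2) * sin (th / 2)) + D * sin (th / 2) ^+ 2 + E) (B * 2^-1).
Proof.
pose c := fun th : R => cos (th / 2); pose s := fun th : R => sin (th / 2).
have hc : is_derive (0 : R) 1 c 0 := is_derive_cos_half.
have hs : is_derive (0 : R) 1 s 2^-1 := is_derive_sin_half.
have -> : (fun th : R => A * cos (th / 2) ^+ 2
     + B * (cos (th / 2) * sin (th / 2)) + D * sin (th / 2) ^+ 2 + E) =
   A *: (c * c) + B *: (c * s) + D *: (s * s) + cst E.
  by apply/funext => th; rewrite !expr2.
apply: (is_derive_eq (is_deriveD (is_deriveD (is_deriveD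
  (is_deriveZ A (is_deriveM hc hc)) (is_deriveZ B (is_deriveM hc hs)))
  (is_deriveZ D (is_deriveM hs hs))) (is_derive_cst E _ _))).
rewrite /c /s mul0r cos0 sin0 /GRing.scale /=; ring.
Qed.

Section ChainRule.
Variables (U : normedModType R).

Lemma smooth_differentiable (g : U -> R) : smooth g -> forall x, differentiable g x.
Proof. by move=> /(_ 1%N) []. Qed.

(** The derivative of a representation along [spin_rot] depends only on its
    differential at the unit. *)
Lemma is_derive_rot_curve (g : U -> R) (a b : U) : differentiable g a ->
  is_derive (0 : R) 1 (fun s : R => g (cos (s / 2) *: a + sin (s / 2) *: b))
    ('D_(2^-1 *: b) g a).
Proof.
move=> dg.
pose c := fun s : R => cos (s / 2) *: a + sin (s / 2) *: b.
have c0 : c 0 = a by rewrite /c mul0r cos0 sin0 scale1r scale0r addr0.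
have hc := is_derive_cos_half; have hs := is_derive_sin_half.
have dhc : differentiable (fun s : R => cos (s / 2)) (0 : R).
  by apply/derivable1_diffP; case: hc.
have dhs : differentiable (fun s : R => sin (s / 2)) (0 : R).
  by apply/derivable1_diffP; case: hs.
have dc1 : differentiable (fun s : R => cos (s / 2) *: a) (0 : R).
  exact: differentiableZl.
have dc2 : differentiable (fun s : R => sin (s / 2) *: b) (0 : R).
  exact: differentiableZl.
have dc : differentiable c (0 : R) by apply: differentiableD.
have cE : 'd c 0 1 = 2^-1 *: b.
  rewrite (diffD dc1 dc2) /= !diffZl //=.
  by rewrite -!deriveE // !derive_val scale0r add0r.
have gc : differentiable (g \o c) (0 : R).
  by apply: differentiable_comp => //; rewrite c0.
have : is_derive (0 : R) 1 (g \o c) ('D_1 (g \o c) 0).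
  by apply: derivableP; apply: diff_derivable.
move/is_derive_eq; apply.
by rewrite deriveE // diff_comp ?c0 //= cE deriveE.
Qed.

Lemma derive_addv (f : U -> R) (a v w : U) : differentiable f a ->
  'D_(v + w) f a = 'D_v f a + 'D_w f a.
Proof.
move=> df; rewrite (deriveE (v + w) df) (deriveE v df) (deriveE w df).
exact: (linearD ('d f a) v w).
Qed.

Lemma derive_scalev (f : U -> R) (a v : U) (c : R) : differentiable f a ->
  'D_(c *: v) f a = c * 'D_v f a.
Proof.
move=> df; rewrite (deriveE (c *: v) df) (deriveE v df).
exact: (linearZ_LR ('d f a) c v).
Qed.

Lemma deriveC_add (g : U -> C) (a v w : U) :
  differentiable (fun x => complex.Re (g x)) a ->
  differentiable (fun x => complex.Im (g x)) a ->
  deriveC (v + w) g a = deriveC v g a + deriveC w g a.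
Proof.
by move=> dR dI; congr Complex; apply: derive_addv.
Qed.

Lemma deriveC_scale (g : U -> C) (a v : U) (c : R) :
  differentiable (fun x => complex.Re (g x)) a ->
  differentiable (fun x => complex.Im (g x)) a ->
  deriveC (c *: v) g a = c%:C%C * deriveC v g a.
Proof.
move=> dR dI; rewrite /deriveC (derive_scalev _ _ dR) (derive_scalev _ _ dI).
by apply/eqP; rewrite eq_complex /= !mul0r subr0 addr0 !eqxx.
Qed.

End ChainRule.
End ComplexCalculus.

(** * The derived representation *)

Section Generators.
Variables (R : realType) (m n : nat).
Local Notation C := (R[i]).
Local Notation "x '**' y" := (cl_mul x y) (at level 40, left associativity).
Local Notation "1c" := (cl_one R m).
Local Notation ev i := (delta_mx 0 i : 'rV[R]_m).
Variable rho : cliff R m -> 'M[C]_n.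

(** The differential of [rho] at the unit, in the direction [b / 2]; the factor
    makes [e_j e_k] the generator of the rotations of unit speed. *)
Definition gen (b : cliff R m) : 'M[C]_n :=
  \matrix_(i, j) deriveC (2^-1 *: b) (fun s => rho s i j) 1c.

(** [e_j e_j] is a scalar, not an element of the Lie algebra, hence the diagonal
    value. *)
Definition Xgen (j k : 'I_m) : 'M[C]_n :=
  if j == k then 0 else gen (cl_vec (ev j) ** cl_vec (ev k)).

Lemma Xgen_diag j : Xgen j j = 0.
Proof. by rewrite /Xgen eqxx. Qed.

Hypothesis hrho : spin_rep rho.

Lemma rho_differentiable i j a :
  differentiable (fun s => complex.Re (rho s i j)) a /\
  differentiable (fun s => complex.Im (rho s i j)) a.
Proof.
by have [h _ _] := hrho; have [h1 h2] := h i j; split; apply: smooth_differentiable.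
Qed.

Lemma gen_add b c : gen (b + c) = gen b + gen c.
Proof.
apply/matrixP => i j; rewrite !mxE.
have [dR dI] := rho_differentiable i j 1c.
by rewrite scalerDr; apply: deriveC_add.
Qed.

Lemma gen_scale (a : R) b : gen (a *: b) = a%:C%C *: gen b.
Proof.
apply/matrixP => i j; rewrite !mxE.
have [dR dI] := rho_differentiable i j 1c.
by rewrite scalerA (mulrC _ a) -scalerA; apply: deriveC_scale.
Qed.

Lemma gen0 : gen 0 = 0.
Proof. by rewrite -(scale0r (0 : cliff R m)) gen_scale scale0r. Qed.

Lemma gen_sum (I : Type) (r : seq I) (Q : pred I) (F : I -> cliff R m) :
  gen (\sum_(i <- r | Q i) F i) = \sum_(i <- r | Q i) gen (F i).
Proof. by elim/big_rec2: _ => [|i y z _ <-]; rewrite ?gen0 ?gen_add. Qed.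

Lemma gen_curve b :
  mxder (fun th : R => rho (cos (th / 2) *: 1c + sin (th / 2) *: b)) 0 (gen b).
Proof.
move=> i j; rewrite mxE; have [dR dI] := rho_differentiable i j 1c.
by split; apply: is_derive_rot_curve.
Qed.

Lemma gen_rot j k : j != k ->
  mxder (fun th : R => rho (spin_rot j k th)) 0 (Xgen j k).
Proof. by move=> jk; rewrite /Xgen (negPf jk); apply: gen_curve. Qed.

Lemma Xgen_anti j k : Xgen k j = - Xgen j k.
Proof.
rewrite /Xgen eq_sym; case: (eqVneq j k) => [_|jk]; first by rewrite oppr0.
apply/eqP; rewrite -addr_eq0 -gen_add addrC cl_ev_anti (negPf jk).
by rewrite mul0rn oppr0 scale0r gen0.
Qed.

Lemma rho1 : rho 1c = 1%:M. Proof. by case: hrho. Qed.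

Lemma rhoM s t : Spin s -> Spin t -> rho (s ** t) = rho s *m rho t.
Proof. by case: hrho => _ _; apply. Qed.

Lemma rho_conjr s : Spin s -> rho s *m rho (cl_conj s) = 1%:M.
Proof. by move=> Ss; rewrite -rhoM ?Spin_conjr ?rho1 //; apply: SpinV. Qed.

Lemma rho_conjl s : Spin s -> rho (cl_conj s) *m rho s = 1%:M.
Proof. by move=> Ss; rewrite -rhoM ?Spin_conjl ?rho1 //; apply: SpinV. Qed.

Lemma spin_vec_orthl (s : cliff R m) : Spin s -> (spin_vec s)^T *m spin_vec s = 1%:M.
Proof. by move=> /spin_vec_orth /mulmx1C. Qed.

(** Conjugation by [s] acts on bivectors through the rotation of [s].  Both sides
    are derivatives of [rho] along the conjugated curve; expanding the
    conjugated bivector in the basis produces scalar terms, whose total is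
    proportional to the inner product of the images of [e_j] and [e_k], that is,
    zero. *)
Lemma Xgen_conj s j k : Spin s ->
  rho s *m Xgen j k *m rho (cl_conj s) =
  \sum_a \sum_b (spin_vec s a j * spin_vec s b k)%:C%C *: Xgen a b.
Proof.
move=> Ss; set S := spin_vec s.
have Sev l : ev l *m S^T = \row_a S a l by apply/rowP => a; rewrite -rowE !mxE.
have [<-|jk] := eqVneq j k.
  rewrite Xgen_diag mulmx0 mul0mx.
  (* Exchanging the summation indices, antisymmetry gives [T = - T]. *)
  set T := \sum_a _; have TN : T = - T.
    rewrite {2}/T exchange_big /= -sumrN; apply: eq_bigr => a _.
    rewrite -sumrN; apply: eq_bigr => b _.
    by rewrite (Xgen_anti a b) scalerN opprK mulrC.
  apply/esym/eqP; move/eqP: TN; rewrite -addr_eq0 -mulr2n.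
  by rewrite -scaler_nat scaler_eq0 pnatr_eq0.
have -> : rho s *m Xgen j k *m rho (cl_conj s) =
          gen (s ** (cl_vec (ev j) ** cl_vec (ev k)) ** cl_conj s).
  (* Both matrices are the derivative at 0 of the conjugated curve. *)
  apply: (@mxder_uniq _ _ _ (fun th : R => rho s *m rho (spin_rot j k th) *m rho (cl_conj s)) 0).
    have := mxder_mul (mxder_mul (mxder_cst (rho s) 0) (gen_rot jk)) (mxder_cst (rho (cl_conj s)) 0).
    by rewrite mulmx0 addr0 mul0mx add0r.
  apply: mxder_ext (gen_curve _) => th.
  have SV := SpinV Ss; have Sr := Spin_rot th jk.
  rewrite -!rhoM //; last exact: SpinM.
  congr rho; rewrite /spin_rot cl_mulDr cl_mulDl !cl_mulZr !cl_mulZl cl_mul1r.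
  by rewrite Spin_conjr.
have -> : s ** (cl_vec (ev j) ** cl_vec (ev k)) ** cl_conj s =
    cl_vec (ev j *m S^T) ** cl_vec (ev k *m S^T).
  rewrite -!(Spin_vec_act Ss) !cl_mulA; congr (_ ** _ ** _).
  by rewrite -[_ ** _ ** s]cl_mulA Spin_conjl // cl_mul1r.
have uE (u : 'rV[R]_m) : cl_vec u = \sum_a u 0 a *: cl_vec (ev a) by exact: cl_vec_sum.
rewrite [cl_vec (ev j *m _)]uE [cl_vec (ev k *m _)]uE.
rewrite cl_mul_suml gen_sum.
have Eab a b : gen (cl_vec (ev a) ** cl_vec (ev b)) = Xgen a b + (- (a == b)%:R)%:C%C *: gen 1c.
  rewrite /Xgen; case: (eqVneq a b) => [->|ab]; last by rewrite oppr0 scale0r addr0.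
  by rewrite add0r cl_vec_sq gen_scale dotv_ev eqxx.
transitivity (\sum_a \sum_b ((S a j * S b k)%:C%C *: Xgen a b +
   (S a j * S b k * - (a == b)%:R)%:C%C *: gen 1c)).
  apply: eq_bigr => a _; rewrite cl_mul_sumr gen_sum; apply: eq_bigr => b _.
  rewrite cl_mulZl cl_mulZr scalerA gen_scale Eab scalerDr scalerA !Sev !mxE.
  by congr (_ + _ *: _); rewrite -rmorphM.
under eq_bigr => a _ do rewrite big_split /=.
rewrite big_split /=.
rewrite [X in _ + X](_ : _ = 0) ?addr0 //.
under eq_bigr => a _.
  rewrite (bigD1 a) //= big1 ?addr0 => [|b ba]; last first.
    by rewrite eq_sym (negPf ba) oppr0 mulr0 scale0r.
  rewrite eqxx mulrN1; over.
rewrite -scaler_suml -rmorph_sum /=.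
have /matrixP/(_ j k) := spin_vec_orthl Ss.
rewrite !mxE (negPf jk) mulr0n => h.
rewrite sumrN (_ : \sum_i _ = 0) ?oppr0 ?scale0r //.
by rewrite -[RHS]h; apply: eq_bigr => a _; rewrite [_^T _ _]mxE.
Qed.

(** The entry [(a, b)] of the infinitesimal rotation [e_j |-> e_k],
    [e_k |-> - e_j]. *)
Definition Lrot (j k a b : 'I_m) : R := (a == k)%:R * (b == j)%:R - (a == j)%:R * (b == k)%:R.

Lemma spin_vec_rot_entry (j k : 'I_m) (th : R) (a b : 'I_m) : j != k ->
  spin_vec (spin_rot j k th) a b =
  4 * cos (th / 2) * half_vec j k th 0 a * (b == j)%:R
  - 2 * half_vec j k th 0 a * half_vec j k th 0 b
  - 2 * (a == j)%:R * (b == j)%:R + (a == b)%:R.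
Proof.
move=> jk; rewrite spin_vec_rot // /reflm.
have dh : dotv (half_vec j k th) (ev j) = cos (th / 2).
  rewrite /half_vec dotvDl !dotvZl !dotv_ev eqxx eq_sym (negPf jk).
  by rewrite mulr0 mulr1 addr0.
rewrite mulmxBr mulmxBl mulmx1 mul1mx -scalemxAr -scalemxAl scalerA.
rewrite mulmxA -(mulmxA _ (half_vec j k th)) mulmx_dotv dh.
rewrite mul_mx_scalar -scalemxAl.
move: (half_vec j k th) (cos (th / 2)) => h c.
rewrite !mxE !big_ord_recl !big_ord0 !mxE !eqxx /=.
move: (h 0 a) (h 0 b) => p q.
by move: (b == j) (a == j) (a == b) => [] [] []; rewrite /= ?mulr1n ?mulr0n; ring.
Qed.

Lemma spin_vec_rot_der j k a b : j != k ->
  cder (fun th : R => (spin_vec (spin_rot j k th) a b)%:C%C) 0 (Lrot j k a b)%:C%C.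
Proof.
move=> jk; apply: cder_real.
pose A : R := 4 * (a == j)%:R * (b == j)%:R - 2 * (a == j)%:R * (b == j)%:R.
pose B : R := 4 * (a == k)%:R * (b == j)%:R - 2 * (a == j)%:R * (b == k)%:R
   - 2 * (a == k)%:R * (b == j)%:R.
pose D : R := - 2 * (a == k)%:R * (b == k)%:R.
pose E : R := - 2 * (a == j)%:R * (b == j)%:R + (a == b)%:R.
have -> : (fun th : R => spin_vec (spin_rot j k th) a b) =
   (fun th => A * cos (th / 2) ^+ 2 + B * (cos (th / 2) * sin (th / 2))
     + D * sin (th / 2) ^+ 2 + E).
  apply/funext => th; rewrite spin_vec_rot_entry // /half_vec !mxE !eqxx /=.
  by rewrite /A /B /D /E; ring.
have -> : Lrot j k a b = B * 2^-1 by rewrite /B /Lrot; field.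
exact: is_derive_quad_half.
Qed.

Lemma spin_vec_rot0 (j k : 'I_m) : spin_vec (spin_rot j k (0 : R)) = 1%:M.
Proof.
by rewrite spin_rot0; apply: cl_acts_spin_vec => v; rewrite cl_mul1l cl_conj1 cl_mul1r trmx1 mulmx1.
Qed.

Lemma delta_sum (Y : 'I_m -> 'M[C]_n) (x : 'I_m) :
  \sum_c (c == x)%:R *: Y c = Y x.
Proof.
rewrite (bigD1 x) // big1 => [|c /negPf ->]; last by rewrite scale0r.
by rewrite /= eqxx scale1r addr0.
Qed.

Lemma Lrot_sum (j k : 'I_m) (Y : 'I_m -> 'M[C]_n) (x : 'I_m) :
  \sum_c (Lrot j k c x)%:C%C *: Y c = (x == j)%:R *: Y k - (x == k)%:R *: Y j.
Proof.
rewrite -(delta_sum Y k) -(delta_sum Y j) !scaler_sumr -sumrB.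
apply: eq_bigr => c _; rewrite !scalerA -scalerBl; congr (_ *: _).
by rewrite /Lrot rmorphB !rmorphM !rmorph_nat mulrC (mulrC _ (x == k)%:R).
Qed.

(** The commutation relations of the orthogonal Lie algebra, by differentiating
    [Xgen_conj] along a one-parameter group. *)
Lemma Xgen_bracket j k a b : j != k ->
  Xgen j k *m Xgen a b - Xgen a b *m Xgen j k =
  (b == j)%:R *: Xgen a k - (b == k)%:R *: Xgen a j
  + (a == j)%:R *: Xgen k b - (a == k)%:R *: Xgen j b.
Proof.
move=> jk; apply/eqP; rewrite subr_eq; apply/eqP.
pose F := fun th : R => rho (spin_rot j k th) *m Xgen a b.
apply: (@mxder_uniq _ _ _ F 0).
  have := mxder_mul (gen_rot jk) (mxder_cst (Xgen a b) 0).
  by rewrite mulmx0 addr0.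
pose S := fun th : R => spin_vec (spin_rot j k th).
have FE th : (\sum_c (S th c a)%:C%C *: \sum_d (S th d b)%:C%C *: Xgen c d)
    *m rho (spin_rot j k th) = F th.
  have Sr := Spin_rot th jk.
  rewrite /F -[RHS]mulmx1 -(rho_conjl Sr) mulmxA Xgen_conj //; congr (_ *m _).
  apply: eq_bigr => c _; rewrite scaler_sumr; apply: eq_bigr => d _.
  by rewrite rmorphM scalerA.
apply: mxder_ext FE _.
have h := mxder_mul (mxder_sum (index_enum _) (P := xpredT) (fun c _ =>
  mxder_scale (spin_vec_rot_der c a jk)
    (mxder_sum (index_enum _) (P := xpredT) (fun d _ =>
      mxder_scale (spin_vec_rot_der d b jk) (mxder_cst (Xgen c d) 0))))) (gen_rot jk).
apply: mxder_eq h _; rewrite spin_rot0 rho1 mulmx1.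
have S0 c d : (spin_vec 1c c d)%:C%C = (c == d)%:R :> C.
  by rewrite -(spin_rot0 R j k) spin_vec_rot0 mxE rmorph_nat.
under eq_bigr => c _.
  under eq_bigr => d _ do rewrite S0.
  under [X in _ + _ *: X]eq_bigr => d _ do rewrite scaler0 addr0.
  rewrite delta_sum Lrot_sum S0; over.
under [in X in _ + X]eq_bigr => c _.
  under eq_bigr => d _ do rewrite S0.
  rewrite delta_sum S0; over.
rewrite big_split /= !delta_sum Lrot_sum //; congr (_ + _).
by rewrite addrC addrA.
Qed.

Variable P : 'I_m -> 'M[C]_n.
Hypothesis hP : forall s l, Spin s ->
  rho s *m P l = (\sum_a (spin_vec s a l)%:C%C *: P a) *m rho s.

(** The infinitesimal form of the equivariance of [P]. *)
Lemma Xgen_vector_bracket j k l : j != k ->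
  Xgen j k *m P l - P l *m Xgen j k = (l == j)%:R *: P k - (l == k)%:R *: P j.
Proof.
move=> jk; apply/eqP; rewrite subr_eq; apply/eqP.
pose F := fun th : R => rho (spin_rot j k th) *m P l.
apply: (@mxder_uniq _ _ _ F 0).
  have := mxder_mul (gen_rot jk) (mxder_cst (P l) 0).
  by rewrite mulmx0 addr0.
pose S := fun th : R => spin_vec (spin_rot j k th).
have FE th : (\sum_c (S th c l)%:C%C *: P c) *m rho (spin_rot j k th) = F th.
  by rewrite /F hP //; apply: Spin_rot.
apply: mxder_ext FE _.
have h := mxder_mul (mxder_sum (index_enum _) (P := xpredT) (fun c _ =>
  mxder_scale (spin_vec_rot_der c l jk) (mxder_cst (P c) 0))) (gen_rot jk).
apply: mxder_eq h _; rewrite spin_rot0 rho1 mulmx1.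
have S0 c d : (spin_vec 1c c d)%:C%C = (c == d)%:R :> C.
  by rewrite -(spin_rot0 R j k) spin_vec_rot0 mxE rmorph_nat.
under eq_bigr => c _ do rewrite scaler0 addr0.
under [in X in _ + X]eq_bigr => c _ do rewrite S0.
by rewrite delta_sum Lrot_sum.
Qed.

End Generators.

(** * Joint eigenvectors in quotients *)

(** Applies the factors [H - a] one after the other; when the [a] are the roots
    of the characteristic polynomial the result is zero, by Cayley-Hamilton.
    Stopping just before falling into a subspace exhibits an eigenvector modulo
    that subspace. *)
Fixpoint strip (F : closedFieldType) (n : nat) (H : 'M[F]_n) (rs : seq F)
    (z : 'cV[F]_n) : 'cV[F]_n :=
  if rs is a :: rs' then strip H rs' ((H - a%:M) *m z) else z.

Lemma char_poly_eigenvector (F : closedFieldType) (n : nat) (H : 'M[F]_n) a : root (char_poly H) a ->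
  exists2 v : 'cV[F]_n, v != 0 & H *m v = a *: v.
Proof.
have -> : char_poly H = char_poly H^T.
  rewrite /char_poly -det_tr /char_poly_mx; congr (\det _).
  by rewrite linearB /= tr_scalar_mx map_trmx.
rewrite -eigenvalue_root_char => /eigenvalueP[v vH v0].
exists v^T; first by apply: contra v0 => /eqP e; rewrite -(trmxK v) e trmx0.
by rewrite -[H]trmxK -trmx_mul vH linearZ.
Qed.

Lemma strip_annihilates (F : closedFieldType) (n : nat) (H : 'M[F]_n) : exists rs : seq F,
  (forall a, a \in rs -> exists2 v : 'cV[F]_n, v != 0 & H *m v = a *: v) /\
  (forall z, strip H rs z = 0).
Proof.
have [rs rsE] := closed_field_poly_normal (char_poly H).
rewrite (monicP (char_poly_monic H)) scale1r in rsE.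
exists rs; split.
  by move=> a ars; apply: char_poly_eigenvector; rewrite rsE root_prod_XsubC.
case: n H rsE => [|k] H rsE z; first by apply/matrixP => -[].
have CH := Cayley_Hamilton H; rewrite rsE {rsE} in CH.
suff h : forall (qs : seq F) z, strip H qs z = horner_mx H (\prod_(a <- qs) ('X - a%:P)) *m z.
  by rewrite h CH mul0mx.
move=> {z CH rs}; elim=> [|a qs IH] z /=.
  by rewrite big_nil rmorph1 mul1mx.
rewrite big_cons mulrC rmorphM /= IH mulmxA; congr (_ *m _ *m _).
by rewrite rmorphB /= horner_mx_X horner_mx_C.
Qed.

Section JointEigenvectors.
Variables (F : closedFieldType) (n : nat).
Implicit Types (H : 'M[F]_n) (z v : 'cV[F]_n) (K : 'cV[F]_n -> Prop).

(** Subspaces are kept as plain predicates, which suits kernels and quotients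
    defined by conditions rather than by bases. *)
Definition subsp K : Prop := K 0 /\ forall a u v, K u -> K v -> K (a *: u + v).

Definition stable H K : Prop := forall v, K v -> K (H *m v).

Lemma subspD K u v : subsp K -> K u -> K v -> K (u + v).
Proof. by case=> _ h Ku Kv; rewrite -[u]scale1r; apply: h. Qed.

Lemma subspZ K a u : subsp K -> K u -> K (a *: u).
Proof. by case=> K0 h Ku; rewrite -[_ *: _]addr0; apply: h. Qed.

Lemma subspB K u v : subsp K -> K u -> K v -> K (u - v).
Proof. by move=> sK Ku Kv; apply: subspD => //; rewrite -scaleN1r; apply: subspZ. Qed.

Lemma stable_shift H K a : subsp K -> stable H K -> stable (H - a%:M) K.
Proof.
move=> sK st v Kv; rewrite mulmxBl mul_scalar_mx; apply: subspB => //.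
  exact: st.
exact: subspZ.
Qed.

Lemma strip_find H K K0 : subsp K -> stable H K ->
  forall rs z, K z -> ~ K0 z -> K0 (strip H rs z) ->
  exists z' a, [/\ K z', ~ K0 z' & K0 (H *m z' - a *: z')].
Proof.
move=> sK st; elim=> [|a rs IH] z Kz nz //= hs.
have [h|h] := pselect (K0 ((H - a%:M) *m z)).
  by exists z, a; rewrite -mul_scalar_mx -mulmxBl.
by apply: (IH ((H - a%:M) *m z)) => //; apply: stable_shift.
Qed.

(** Eigenvectors in the quotient [K / K0], one operator at a time: the
    eigenspace of the first operator modulo [K0] is stable under the others
    because the family commutes. *)
Lemma joint_eigenvector (I : eqType) (H : I -> 'M[F]_n) (s : seq I) K K0 :
  (forall i j, H i *m H j = H j *m H i) ->
  subsp K -> subsp K0 -> (forall i, stable (H i) K) -> (forall i, stable (H i) K0) ->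
  (exists2 z, K z & ~ K0 z) ->
  exists z (a : I -> F), [/\ K z, ~ K0 z & forall i, i \in s -> K0 (H i *m z - a i *: z)].
Proof.
move=> Hc + sK0 + st0; elim: s K => [|i s IH] K sK stK [z Kz nz].
  by exists z, (fun=> 0).
have [rs [_ rs0]] := strip_annihilates (H i).
have h0 : K0 (strip (H i) rs z) by rewrite rs0; case: sK0.
have [z1 [a [Kz1 nz1 hz1]]] := strip_find sK (stK i) Kz nz h0.
pose K1 v := K v /\ K0 (H i *m v - a *: v).
have [|||z2 [b [[Kz2 hz2] nz2 hb]]] := IH K1.
- split; first by split; rewrite ?mulmx0 ?scaler0 ?subr0; [case: sK|case: sK0].
  move=> c u v [Ku hu] [Kv hv]; split; first by case: sK => _; apply.
  rewrite mulmxDr -scalemxAr scalerDr scalerA (mulrC a) -scalerA opprD addrACA.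
  rewrite -scalerBr; case: sK0 => _; apply => //.
- move=> j v [Kv hv]; split; first exact: stK.
  by rewrite mulmxA Hc -mulmxA scalemxAr -mulmxBr; apply: st0.
- by exists z1.
exists z2, (fun j => if j == i then a else b j); split => // j.
by rewrite inE; case: eqP => [-> //|_ /=]; apply: hb.
Qed.

(** Apply the previous lemma to the eigenspace [K] of [H c], with [K0 = 0]. *)
Lemma eigenvector_extend (I : finType) (H : I -> 'M[F]_n) c (v : 'cV[F]_n) (a : F) :
  (forall i j, H i *m H j = H j *m H i) -> v != 0 -> H c *m v = a *: v ->
  exists z (b : I -> F), [/\ z != 0, b c = a & forall d, H d *m z = b d *: z].
Proof.
move=> Hc v0 Hv.
have [|||||z [b [Kz /eqP z0 hz]]] := @joint_eigenvector I H (enum I)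
   (fun z => H c *m z = a *: z) (fun z => z = 0) Hc.
- split; first by rewrite mulmx0 scaler0.
  by move=> e u w hu hw; rewrite mulmxDr -scalemxAr hu hw scalerDr !scalerA mulrC.
- by split=> // e u w -> ->; rewrite scaler0 addr0.
- by move=> d u hu; rewrite mulmxA Hc -mulmxA hu scalemxAr.
- by move=> d u ->; rewrite mulmx0.
- by exists v => //; apply/eqP.
have hb d : H d *m z = b d *: z.
  by apply/eqP; rewrite -subr_eq0; apply/eqP/hz; rewrite mem_enum.
exists z, b; split=> //; apply/eqP; rewrite -subr_eq0 -[_ == 0]orbF -(negPf z0).
by rewrite -scaler_eq0 scalerBl -Kz hb subrr.
Qed.

(** An eigenvalue on a subquotient is an eigenvalue: modulo [K0] the product of
    the [H - b] acts on [z] by the scalar [\prod_b (a - b)], and it is zero. *)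
Lemma quotient_eigenvalue H K0 rs z a : subsp K0 -> stable H K0 -> ~ K0 z ->
  K0 (H *m z - a *: z) -> (forall v, strip H rs v = 0) -> a \in rs.
Proof.
move=> sK0 st nz hz rs0.
have h : forall (qs : seq F) v, K0 (H *m v - a *: v) ->
    K0 (strip H qs v - (\prod_(b <- qs) (a - b)) *: v).
  elim=> [|b qs IH] v hv /=; first by rewrite big_nil scale1r subrr; case: sK0.
  have hb : K0 ((H - b%:M) *m v - (a - b) *: v).
    by rewrite mulmxBl mul_scalar_mx scalerBl opprB addrA subrK.
  have h1 : K0 (H *m ((H - b%:M) *m v) - a *: ((H - b%:M) *m v)).
    have -> : H *m ((H - b%:M) *m v) - a *: ((H - b%:M) *m v) =
       (H - b%:M) *m (H *m v - a *: v).
      rewrite mulmxBr -scalemxAr; congr (_ - _).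
      by rewrite !mulmxBl !mul_scalar_mx mulmxBr -scalemxAr.
    exact: stable_shift.
  rewrite big_cons mulrC -scalerA.
  have -> : strip H qs ((H - b%:M) *m v) - (\prod_(j <- qs) (a - j)) *: ((a - b) *: v) =
    (strip H qs ((H - b%:M) *m v) - (\prod_(j <- qs) (a - j)) *: ((H - b%:M) *m v)) +
    (\prod_(j <- qs) (a - j)) *: ((H - b%:M) *m v - (a - b) *: v).
    by rewrite scalerBr addrA subrK.
  by apply: subspD => //; [apply: IH|apply: subspZ].
have := h rs z hz; rewrite rs0 sub0r.
case: (boolP (\prod_(b <- rs) (a - b) == 0)) => [|pn hK].
  by rewrite prodf_seq_eq0 => /hasP[b brs /=]; rewrite subr_eq0 => /eqP ->.
case: nz; have -> : z = - (\prod_(b <- rs) (a - b))^-1 *: - ((\prod_(b <- rs) (a - b)) *: z).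
  by rewrite scalerN scaleNr opprK scalerA mulVf // scale1r.
exact: subspZ.
Qed.

End JointEigenvectors.

(** * Eigenvalues of the torus generators are weights *)

Section OneParameter.
Variable R : realType.
Local Notation C := (R[i]).

Lemma is_derive_comp_lin (g : R -> R) (k t d : R) :
  is_derive (k * t) 1 g d -> is_derive t 1 (fun s => g (k * s)) (d * k).
Proof.
move=> hg; have hk : is_derive t 1 (fun s : R => k * s) k.
  apply: (is_derive_eq (is_deriveZ k (is_derive_id t 1))).
  by rewrite /GRing.scale /= mulr1.
exact: (@is_derive1_comp _ g (fun s => k * s) t _ _ hg hk).
Qed.

Lemma cder_shift (F : R -> C) (t : R) d : cder (fun s => F (s + t)) 0 d -> cder F t d.
Proof.
have h (g : R -> R) (e : R) : is_derive (0 : R) 1 (fun s => g (s + t)) e -> is_derive t 1 g e.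
  move=> hg; have hs : is_derive t 1 (fun u : R => u - t) 1.
    apply: (is_derive_eq (is_deriveB (is_derive_id t 1) (is_derive_cst t t 1))).
    by rewrite subr0.
  have hg' : is_derive (t - t) 1 (fun s => g (s + t)) e by rewrite subrr.
  have := @is_derive1_comp _ (fun s => g (s + t)) (fun u => u - t) t _ _ hg' hs.
  by rewrite mulr1 (_ : _ \o _ = g) //; apply/funext => u /=; rewrite subrK.
by case=> h1 h2; split; apply: h.
Qed.

(** The complex exponential [exp (- a t)]. *)
Definition cexpN (a : C) (t : R) : C :=
  Complex (expR (- complex.Re a * t) * cos (complex.Im a * t))
          (- (expR (- complex.Re a * t) * sin (complex.Im a * t))).

Lemma cexpN0 a : cexpN a 0 = 1.
Proof. by rewrite /cexpN !mulr0 expR0 cos0 sin0 mulr1 mulr0 oppr0. Qed.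

Lemma cder_cexpN a t : cder (cexpN a) t (- a * cexpN a t).
Proof.
have he := is_derive_comp_lin (is_derive_expR (- complex.Re a * t)).
have hc := is_derive_comp_lin (is_derive_cos (complex.Im a * t)).
have hs := is_derive_comp_lin (is_derive_sin (complex.Im a * t)).
split.
  apply: (is_derive_eq (is_deriveM he hc)).
  by case: a {he hc hs} => al be; rewrite /GRing.scale /=; ring.
apply: (is_derive_eq (is_deriveN (is_deriveM he hs))).
by case: a {he hc hs} => al be; rewrite /GRing.scale /=; ring.
Qed.

(** On an eigenvector, [g t] acts as [exp (a t)], since [exp (- a t) g t v] has
    zero derivative.  Returning to the identity at time [p] forces
    [exp (p * Re a) = 1]. *)
Lemma periodic_eigenvalue n (g : R -> 'M[C]_n) (X : 'M[C]_n) (p : R) (a : C) (v : 'cV[C]_n) :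
  (forall t, mxder g t (g t *m X)) -> g 0 = 1%:M -> p != 0 -> g p = 1%:M ->
  v != 0 -> X *m v = a *: v ->
  complex.Re a = 0 /\
  forall t, g t *m v = Complex (cos (complex.Im a * t)) (sin (complex.Im a * t)) *: v.
Proof.
move=> dg g0 p0 gp v0 Xv.
have h t : cexpN a t *: (g t *m v) = v.
  have hd s : mxder (fun t => cexpN a t *: (g t *m v)) s 0.
    apply: mxder_eq (mxder_scale (cder_cexpN a s) (mxder_mul (dg s) (mxder_cst v s))) _.
    rewrite mulmx0 addr0 -mulmxA Xv -scalemxAr scalerA -scalerDl.
    by rewrite mulNr (mulrC a) addNr scale0r.
  by rewrite (mxder0_cst hd) cexpN0 scale1r g0 mul1mx.
have Ep : cexpN a p = 1.
  have : (cexpN a p - 1) *: v = 0 by rewrite scalerBl scale1r -{1}(mul1mx v) -gp h subrr.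
  by move/eqP; rewrite scaler_eq0 (negPf v0) orbF subr_eq0 => /eqP.
have Ra : complex.Re a = 0.
  have [h1 h2] : expR (- complex.Re a * p) * cos (complex.Im a * p) = 1 /\
     expR (- complex.Re a * p) * sin (complex.Im a * p) = 0.
    by case: Ep => -> /eqP; rewrite oppr_eq0 => /eqP ->.
  have : expR (- complex.Re a * p) ^+ 2 = 1.
    rewrite -[LHS]mulr1 -(cos2Dsin2 (complex.Im a * p)) mulrDr -!exprMn h1 h2.
    by rewrite cos2Dsin2 expr1n expr0n addr0.
  rewrite -expRM_natl -[RHS]expR0 => /expR_inj /eqP.
  by rewrite mulf_eq0 pnatr_eq0 /= mulf_eq0 (negPf p0) orbF oppr_eq0 => /eqP.
split=> // t; have := h t; rewrite /cexpN Ra oppr0 mul0r expR0 !mul1r.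
move: (cos2Dsin2 (complex.Im a * t)).
move: (cos _) (sin _) => c s cs /(congr1 (fun x => Complex c s *: x)).
rewrite scalerA => <-; rewrite [X in X *: _](_ : _ = 1) ?scale1r //.
by apply/eqP; rewrite eq_complex /= -cs; apply/andP; split; apply/eqP; ring.
Qed.

End OneParameter.

(** The right hand side of the commutation relations for disjoint planes, stated
    in an abstract module. *)
Lemma bracket_disjoint (F : fieldType) (V : lmodType F) (x y z t : V) :
  (false%:R : F) *: x - (false%:R : F) *: y + (false%:R : F) *: z - (false%:R : F) *: t = 0.
Proof. by rewrite !scale0r !subr0 addr0. Qed.

Section Weights.
Variables (R : realType) (r n : nat).
Local Notation C := (R[i]).
Local Notation m := (r.*2.+1).
Variable rho : cliff R m -> 'M[C]_n.
Hypothesis hrho : spin_rep rho.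

Definition ix0 (c : 'I_r) : 'I_m := inord c.*2.
Definition ix1 (c : 'I_r) : 'I_m := inord c.*2.+1.

Lemma val_ix0 c : ix0 c = c.*2 :> nat.
Proof. by rewrite inordK //; have := ltn_ord c; lia. Qed.

Lemma val_ix1 c : ix1 c = c.*2.+1 :> nat.
Proof. by rewrite inordK //; have := ltn_ord c; lia. Qed.

Lemma ix01 c d : (ix0 c == ix1 d) = false.
Proof. by rewrite -val_eqE /= val_ix0 val_ix1; lia. Qed.

Lemma ix10 c d : (ix1 c == ix0 d) = false.
Proof. by rewrite eq_sym ix01. Qed.

Lemma ix00 c d : (ix0 c == ix0 d) = (c == d).
Proof. by rewrite -!val_eqE /= !val_ix0; lia. Qed.

Lemma ix11 c d : (ix1 c == ix1 d) = (c == d).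
Proof. by rewrite -!val_eqE /= !val_ix1; lia. Qed.

Lemma ix0m c : (ix0 c == ord_max) = false.
Proof. by rewrite -val_eqE /= val_ix0; have := ltn_ord c; lia. Qed.

Lemma ix1m c : (ix1 c == ord_max) = false.
Proof. by rewrite -val_eqE /= val_ix1; have := ltn_ord c; lia. Qed.

(** The derivative of [rho] along the [c]-th circle of the maximal torus. *)
Definition Hgen (c : 'I_r) : 'M[C]_n := Xgen rho (ix0 c) (ix1 c).

Lemma HgenC c d : Hgen c *m Hgen d = Hgen d *m Hgen c.
Proof.
case: (eqVneq c d) => [-> //|cd]; apply/eqP; rewrite -subr_eq0 /Hgen.
rewrite Xgen_bracket ?(ix01, ix10) // !(ix00, ix11) (eq_sym d) (negPf cd).
by apply/eqP; apply: bracket_disjoint.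
Qed.

Lemma spin_torusE (c : 'I_r) (th : R) : spin_torus c th = spin_rot (ix0 c) (ix1 c) th.
Proof. by []. Qed.

Lemma torus_der c t : mxder (fun th => rho (spin_torus c th)) t
  (rho (spin_torus c t) *m Hgen c).
Proof.
have ne : ix0 c != ix1 c by rewrite ix01.
move=> i j; apply: cder_shift.
have hs s : (rho (spin_torus c t) *m rho (spin_torus c s)) i j = rho (spin_torus c (s + t)) i j.
  by rewrite addrC !spin_torusE spin_rotD // (rhoM hrho) //; apply: Spin_rot.
apply: cder_ext hs _.
apply: cder_eq (mxder_mul (mxder_cst _ _) (gen_rot hrho ne) i j) _.
by rewrite mul0mx add0r.
Qed.

Lemma torus_period c : rho (spin_torus c (4 * pi)) = 1%:M.
Proof.
rewrite /spin_torus (_ : 4 * pi / 2 = pi *+ 2); last by rewrite -mulr_natl; field.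
by rewrite cos2pi sin2pi scale1r scale0r addr0 (rho1 hrho).
Qed.

(** Each circle of the torus closes up after [4 * pi], so the eigenvalues are
    imaginary and the torus acts by the corresponding characters. *)
Lemma joint_eigenvector_weight (v : 'cV[C]_n) (a : 'I_r -> C) : v != 0 ->
  (forall c, Hgen c *m v = a c *: v) ->
  (forall c, a c = Complex 0 (complex.Im (a c))) /\
  spin_weight rho (fun c => complex.Im (a c)).
Proof.
move=> v0 av.
have h c : complex.Re (a c) = 0 /\ forall t, rho (spin_torus c t) *m v =
   Complex (cos (complex.Im (a c) * t)) (sin (complex.Im (a c) * t)) *: v.
  apply: (periodic_eigenvalue (torus_der c) _ _ (torus_period c) v0 (av c)).
    by rewrite spin_torusE spin_rot0 (rho1 hrho).
  by rewrite mulf_neq0 ?pnatr_eq0 // gt_eqF ?pi_gt0.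
split; first by move=> c; have [h1 _] := h c; case: (a c) h1 => x y /= ->.
by exists v => // c t; have [_ ->] := h c.
Qed.

(** The torus generators commute, so an eigenvector of one of them can be replaced
    by a weight vector with the same eigenvalue. *)
Lemma eigenvalue_weight c (v : 'cV[C]_n) (a : C) : v != 0 -> Hgen c *m v = a *: v ->
  exists2 nu : 'I_r -> R, spin_weight rho nu & a = Complex 0 (nu c).
Proof.
move=> v0 Hv.
have [z [b [z0 bc hb]]] := eigenvector_extend HgenC v0 Hv.
have [bE wb] := joint_eigenvector_weight z0 hb.
by exists (fun d => complex.Im (b d)) => //; rewrite -bE bc.
Qed.

End Weights.

(** * Ellipticity from the Casimir relation *)

Section Ellipticity.
Variables (F : numClosedFieldType) (ii : F).
Hypothesis ii2 : ii * ii = -1.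
Variables (r n : nat).
Local Notation m := (r.*2.+1).
Implicit Types (x y v w : 'I_m -> F) (z : 'cV[F]_n).
Variables (X : 'I_m -> 'I_m -> 'M[F]_n) (P : 'I_m -> 'M[F]_n).
Hypothesis hXN : forall j k, X k j = - X j k.
Hypothesis hXX : forall j k a b,
  X j k *m X a b - X a b *m X j k =
  (b == j)%:R *: X a k - (b == k)%:R *: X a j
  + (a == j)%:R *: X k b - (a == k)%:R *: X j b.
Hypothesis hXP : forall j k l,
  X j k *m P l - P l *m X j k = (l == j)%:R *: P k - (l == k)%:R *: P j.

(** Bilinear and linear extensions of [X] and [P] to complex vectors, needed for
    the isotropic vectors [zeta] below. *)
Definition Xbil x y : 'M[F]_n := \sum_j \sum_k (x j * y k) *: X j k.
Definition Plin x : 'M[F]_n := \sum_j x j *: P j.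
Definition dotF x y : F := \sum_j x j * y j.
Definition coord_fun (k : 'I_m) : 'I_m -> F := fun j => (j == k)%:R.

Lemma sum_coord_fun (V : lmodType F) (Y : 'I_m -> V) k : \sum_j coord_fun k j *: Y j = Y k.
Proof.
rewrite (bigD1 k) //= big1 ?addr0 => [|j /negPf jk]; rewrite /coord_fun ?jk ?scale0r //.
by rewrite eqxx scale1r.
Qed.

Lemma Plin_coord k : Plin (coord_fun k) = P k.
Proof. exact: sum_coord_fun. Qed.

Lemma Xbil_coordr x k : Xbil x (coord_fun k) = \sum_j x j *: X j k.
Proof.
apply: eq_bigr => j _; under eq_bigr => l _ do rewrite -scalerA.
by rewrite -scaler_sumr sum_coord_fun.
Qed.

Lemma Xbil_coord j k : Xbil (coord_fun j) (coord_fun k) = X j k.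
Proof. by rewrite Xbil_coordr sum_coord_fun. Qed.

Lemma Xbil_sumr x y : Xbil x y = \sum_k y k *: Xbil x (coord_fun k).
Proof.
rewrite /Xbil exchange_big /=; apply: eq_bigr => k _.
rewrite -/(Xbil x (coord_fun k)) Xbil_coordr scaler_sumr; apply: eq_bigr => j _.
by rewrite scalerA mulrC.
Qed.

Lemma Xbil_anti x y : Xbil y x = - Xbil x y.
Proof.
rewrite /Xbil exchange_big /= -sumrN; apply: eq_bigr => j _.
by rewrite -sumrN; apply: eq_bigr => k _; rewrite (hXN j k) scalerN mulrC.
Qed.

Lemma Xbil_diag x : Xbil x x = 0.
Proof.
apply/eqP; have /eqP := Xbil_anti x x; rewrite -addr_eq0 -mulr2n -scaler_nat.
by rewrite scaler_eq0 pnatr_eq0.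
Qed.

Lemma Xbil_extl x x' y : x =1 x' -> Xbil x y = Xbil x' y.
Proof. by move=> h; apply: eq_bigr => j _; apply: eq_bigr => k _; rewrite h. Qed.

Lemma Xbil_extr x y y' : y =1 y' -> Xbil x y = Xbil x y'.
Proof. by move=> h; apply: eq_bigr => j _; apply: eq_bigr => k _; rewrite h. Qed.

Lemma Xbil_scalel a x y : Xbil (fun j => a * x j) y = a *: Xbil x y.
Proof.
rewrite /Xbil scaler_sumr; apply: eq_bigr => j _; rewrite scaler_sumr.
by apply: eq_bigr => k _; rewrite scalerA mulrA.
Qed.

Lemma Xbil_scaler a x y : Xbil x (fun j => a * y j) = a *: Xbil x y.
Proof. by rewrite Xbil_anti Xbil_scalel -scalerN -Xbil_anti. Qed.

Lemma Xbil_Plin x y v :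
  Xbil x y *m Plin v - Plin v *m Xbil x y = dotF x v *: Plin y - dotF y v *: Plin x.
Proof.
have h A : A *m Plin v - Plin v *m A = \sum_l v l *: (A *m P l - P l *m A).
  rewrite mulmx_sumr mulmx_suml -sumrB; apply: eq_bigr => l _.
  by rewrite -scalemxAl -scalemxAr scalerBr.
have h1 l : Xbil x y *m P l - P l *m Xbil x y = x l *: Plin y - y l *: Plin x.
  rewrite mulmx_sumr mulmx_suml -sumrB.
  transitivity (\sum_j \sum_k (x j * y k) *: (X j k *m P l - P l *m X j k)).
    apply: eq_bigr => j _; rewrite mulmx_sumr mulmx_suml -sumrB.
    by apply: eq_bigr => k _; rewrite -scalemxAl -scalemxAr scalerBr.
  transitivity (\sum_j \sum_k (coord_fun l j *: (x j *: (y k *: P k))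
      - coord_fun l k *: (y k *: (x j *: P j)))).
    apply: eq_bigr => j _; apply: eq_bigr => k _; rewrite hXP scalerBr !scalerA.
    by rewrite /coord_fun (eq_sym l) (eq_sym l); congr (_ *: _ - _ *: _); ring.
  under eq_bigr => j _ do rewrite sumrB sum_coord_fun -!scaler_sumr.
  by rewrite sumrB sum_coord_fun -scaler_sumr.
rewrite h; under eq_bigr => l _ do rewrite h1 scalerBr !scalerA.
rewrite sumrB -!scaler_suml /dotF.
by congr (_ *: _ - _ *: _); apply: eq_bigr => l _; rewrite mulrC.
Qed.

(** The action of the infinitesimal rotation [X p q] on vectors. *)
Definition Lr (p q : 'I_m) x : 'I_m -> F := fun j => x p * coord_fun q j - x q * coord_fun p j.

Lemma X_Xbil p q x y :
  X p q *m Xbil x y - Xbil x y *m X p q = Xbil (Lr p q x) y + Xbil x (Lr p q y).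
Proof.
have LrE y' (Y : 'I_m -> 'M[F]_n) : \sum_k Lr p q y' k *: Y k = y' p *: Y q - y' q *: Y p.
  under eq_bigr => k _ do rewrite scalerBl -!scalerA.
  by rewrite sumrB -!scaler_sumr !sum_coord_fun.
have XXE x' y' : Xbil x' y' = \sum_j x' j *: \sum_k y' k *: X j k.
  by apply: eq_bigr => j _; rewrite scaler_sumr; apply: eq_bigr => k _; rewrite scalerA.
have E1 : Xbil (Lr p q x) y = x p *: (\sum_k y k *: X q k) - x q *: (\sum_k y k *: X p k).
  by rewrite XXE LrE.
have E2 : Xbil x (Lr p q y) = \sum_j x j *: (y p *: X j q - y q *: X j p).
  by rewrite XXE; apply: eq_bigr => j _; rewrite LrE.
rewrite E1 E2 XXE mulmx_sumr mulmx_suml -sumrB.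
transitivity (\sum_j x j *: \sum_k y k *: (X p q *m X j k - X j k *m X p q)).
  apply: eq_bigr => j _; rewrite -scalemxAr -scalemxAl -scalerBr; congr (_ *: _).
  rewrite mulmx_sumr mulmx_suml -sumrB; apply: eq_bigr => k _.
  by rewrite -scalemxAr -scalemxAl -scalerBr.
transitivity (\sum_j x j *: ((y p *: X j q - y q *: X j p) +
   (coord_fun p j *: (\sum_k y k *: X q k) - coord_fun q j *: (\sum_k y k *: X p k)))).
  apply: eq_bigr => j _; congr (_ *: _).
  transitivity (\sum_k (coord_fun p k *: (y k *: X j q) - coord_fun q k *: (y k *: X j p) +
       (coord_fun p j *: (y k *: X q k) - coord_fun q j *: (y k *: X p k)))).
    apply: eq_bigr => k _; rewrite hXX -!addrA !(scalerDr, scalerN) !scalerA.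
    by rewrite /coord_fun ![y k * _]mulrC.
  by rewrite big_split /= !sumrB !sum_coord_fun -!scaler_sumr.
under eq_bigr => j _ do rewrite scalerDr [X in _ + X]scalerBr !scalerA
   ![x j * coord_fun _ _]mulrC -!scalerA.
by rewrite big_split /= addrC sumrB !sum_coord_fun.
Qed.

(** The index [(s, c)] stands for the isotropic vector [e_(2c) -+ i e_(2c+1)],
    eigenvector of the [c]-th plane rotation; [star] is complex conjugation, and
    conjugate vectors are dual to each other.  The height is a total order on
    these vectors for which the bivectors [zeta a /\ zeta (star b)] with
    [height b < height a] are the raising operators. *)
Definition branch_sign (s : bool) : F := if s then 1 else -1.
Definition zeta (b : bool * 'I_r) : 'I_m -> F :=
  fun j => coord_fun (ix0 b.2) j - branch_sign b.1 * ii * coord_fun (ix1 b.2) j.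
Definition star (b : bool * 'I_r) : bool * 'I_r := (~~ b.1, b.2).
Definition height (b : bool * 'I_r) : int :=
  if b.1 then (b.2 : nat).+1%:Z else - (b.2 : nat).+1%:Z.

Lemma zeta_ix0 b c : zeta b (ix0 c) = (c == b.2)%:R.
Proof. by rewrite /zeta /coord_fun ix00 ix01 mulr0 subr0. Qed.

Lemma zeta_ix1 b c : zeta b (ix1 c) = - (branch_sign b.1 * ii) * (c == b.2)%:R.
Proof. by rewrite /zeta /coord_fun ix10 ix11 sub0r mulNr. Qed.

Lemma zeta_max b : zeta b ord_max = 0.
Proof.
by rewrite /zeta /coord_fun eq_sym ix0m [ord_max == ix1 _]eq_sym ix1m mulr0 subr0.
Qed.

Lemma branch_sign_sq s : branch_sign s * branch_sign s = 1.
Proof. by case: s; rewrite /branch_sign ?mulr1 ?mulrNN ?mulr1. Qed.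

Lemma branch_signN s : branch_sign (~~ s) = - branch_sign s.
Proof. by case: s; rewrite /branch_sign //= opprK. Qed.

Lemma Lr_zeta c b : Lr (ix0 c) (ix1 c) (zeta b) =1
  (fun j => ((c == b.2)%:R * (branch_sign b.1 * ii)) * zeta b j).
Proof.
move=> j; rewrite /Lr zeta_ix0 zeta_ix1; case: eqP => [->|_]; last first.
  by rewrite !(mul0r, mulr0) subr0.
rewrite /zeta !mul1r mulr1 mulrBr mulrA.
have -> : branch_sign b.1 * ii * (branch_sign b.1 * ii) = - (branch_sign b.1 * branch_sign b.1).
  by rewrite mulrACA ii2 mulrN1.
by rewrite branch_sign_sq; ring.
Qed.

Lemma dotF_coordl k y : dotF (coord_fun k) y = y k.
Proof. exact: (@sum_coord_fun F^o y k). Qed.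

Lemma coord_fun_diag k : coord_fun k k = 1.
Proof. by rewrite /coord_fun eqxx. Qed.

Lemma dotF_coordr k y : dotF y (coord_fun k) = y k.
Proof. by rewrite -dotF_coordl; apply: eq_bigr => j _; rewrite mulrC. Qed.

Lemma dotF_zeta b y : dotF (zeta b) y = y (ix0 b.2) - branch_sign b.1 * ii * y (ix1 b.2).
Proof.
rewrite -(dotF_coordl (ix0 b.2) y) -(dotF_coordl (ix1 b.2) y) /dotF mulr_sumr -sumrB.
by apply: eq_bigr => j _; rewrite /zeta mulrBl mulrA.
Qed.

Lemma dotF_zz a b : dotF (zeta a) (zeta b) = (a == star b)%:R *+ 2.
Proof.
case: a b => s c [s' c']; rewrite dotF_zeta zeta_ix0 zeta_ix1 /star xpair_eqE /=.
case: (c == c'); rewrite /= ?andbT ?andbF; last by rewrite !mulr0 subr0 mul0rn.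
rewrite mulr1 mulrN opprK mulrACA ii2.
by case: s; case: s'; rewrite /branch_sign /=; ring.
Qed.

Lemma starK b : star (star b) = b.
Proof. by case: b => s c; rewrite /star /= negbK. Qed.

Lemma Plin_zeta b : Plin (zeta b) = P (ix0 b.2) - (branch_sign b.1 * ii) *: P (ix1 b.2).
Proof.
rewrite -[in RHS]Plin_coord -[P (ix1 _)]Plin_coord /Plin scaler_sumr -sumrB.
by apply: eq_bigr => j _; rewrite /zeta scalerA -scalerBl.
Qed.

Lemma Xbil_zetar y b :
  Xbil y (zeta b) = Xbil y (coord_fun (ix0 b.2)) - (branch_sign b.1 * ii) *: Xbil y (coord_fun (ix1 b.2)).
Proof.
rewrite Xbil_sumr /zeta; under eq_bigr => k _ do rewrite scalerBl -scalerA.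
by rewrite sumrB -scaler_sumr !sum_coord_fun.
Qed.

Lemma sum_pairs (V : zmodType) (G : 'I_m -> V) :
  \sum_k G k = \sum_(c < r) (G (ix0 c) + G (ix1 c)) + G ord_max.
Proof.
have h (g : nat -> V) : forall k, \sum_(0 <= i < k.*2) g i =
    \sum_(0 <= i < k) (g i.*2 + g i.*2.+1).
  elim=> [|k IH]; first by rewrite !big_geq.
  by rewrite doubleS !big_nat_recr //= IH addrA.
rewrite big_ord_recr /=; congr (_ + _).
transitivity (\sum_(k < r.*2) (fun i => G (inord i)) k).
  by apply: eq_bigr => k _; congr G; apply/val_inj; rewrite /= inordK //; have := ltn_ord k; lia.
rewrite -(big_mkord xpredT (fun i => G (inord i))) h big_mkord.
by apply: eq_bigr.
Qed.

Hypothesis hC : forall l, \sum_k P k *m X l k = r%:R *: P l.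

(** The Casimir relation in the isotropic basis of the hyperplane [y ord_max = 0].
    The term of the missing direction [ord_max] is [P y z], since
    [P ord_max] kills [z]; moving it to the right turns [r] into [r - 1], and the
    factor 2 is the length [dotF (zeta b) (zeta (star b))]. *)
Lemma casimir_hyperplane y z : y ord_max = 0 -> P ord_max *m z = 0 ->
  \sum_b Plin (zeta b) *m Xbil y (zeta (star b)) *m z = (2 * (r%:R - 1)) *: (Plin y *m z).
Proof.
move=> y0 z0.
have h1 : \sum_k P k *m Xbil y (coord_fun k) = r%:R *: Plin y.
  under eq_bigr => k _ do rewrite Xbil_coordr mulmx_sumr.
  rewrite exchange_big /= scaler_sumr; apply: eq_bigr => j _.
  under eq_bigr => k _ do rewrite -scalemxAr.
  by rewrite -scaler_sumr hC !scalerA mulrC.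
have h2 : P ord_max *m Xbil y (coord_fun ord_max) *m z = Plin y *m z.
  have := Xbil_Plin y (coord_fun ord_max) (coord_fun ord_max).
  rewrite dotF_coordr y0 scale0r dotF_coordl coord_fun_diag scale1r sub0r Plin_coord.
  move=> /(congr1 (fun A => A *m z)); rewrite mulmxBl mulNmx -!mulmxA z0 mulmx0 sub0r.
  by move/oppr_inj; rewrite mulmxA.
have h3 : \sum_b Plin (zeta b) *m Xbil y (zeta (star b)) =
  2 *: (r%:R *: Plin y - P ord_max *m Xbil y (coord_fun ord_max)).
  rewrite -h1 sum_pairs addrK scaler_sumr.
  rewrite -(pair_bigA _ (fun s c => Plin (zeta (s, c)) *m Xbil y (zeta (star (s, c))))) /=.
  rewrite exchange_big /=; apply: eq_bigr => c _.
  rewrite big_bool !Plin_zeta !Xbil_zetar /= /branch_sign /= !mul1r !mulN1r !scaleNr !opprK.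
  rewrite !mulmxDl !mulmxDr !mulmxN !mulNmx -!scalemxAl -!scalemxAr !scalerA ii2.
  rewrite !scaleN1r scaler_nat mulr2n.
  move: (P _ *m _) (P _ *m _) (P _ *m _) (P _ *m _) => a b e d.
  by apply/matrixP => i j; rewrite !mxE; ring.
rewrite -mulmx_suml h3 -scalemxAl mulmxBl -scalemxAl h2 -[X in _ - X]scale1r -scalerBl.
by rewrite scalerA.
Qed.

Definition last_ker z : Prop := P ord_max *m z = 0.
Definition common_ker z : Prop := forall l, P l *m z = 0.

Lemma common_kerP z : last_ker z -> (forall b, Plin (zeta b) *m z = 0) -> common_ker z.
Proof.
move=> Kz h.
have h0 c : P (ix0 c) *m z = 0 /\ P (ix1 c) *m z = 0.
  have e1 := h (true, c); have e2 := h (false, c).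
  rewrite Plin_zeta mulmxBl -scalemxAl /branch_sign /= mul1r in e1.
  rewrite Plin_zeta mulmxBl -scalemxAl /branch_sign /= mulN1r scaleNr opprK in e2.
  have e0 : P (ix0 c) *m z = 0.
    have : (2 : F) *: (P (ix0 c) *m z) = 0.
      rewrite scaler_nat mulr2n -[RHS](addr0 (0 : 'cV[F]_n)) -{1}e1 -e2.
      by rewrite addrACA addNr addr0.
    by move/eqP; rewrite scaler_eq0 pnatr_eq0 => /eqP.
  split=> //; move/eqP: e2; rewrite e0 add0r scaler_eq0 => /orP[/eqP i0|/eqP //].
  by move: ii2; rewrite i0 mul0r => /eqP; rewrite eq_sym oppr_eq0 oner_eq0.
move=> l; have [->|lm] := eqVneq l ord_max; first exact: Kz.
have lt_l : (l < r.*2)%N.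
  by have := ltn_ord l; move: lm; rewrite -val_eqE /=; lia.
have lt2 : (l./2 < r)%N by lia.
have [h1 h2] := h0 (Ordinal lt2).
have : l = ix0 (Ordinal lt2) \/ l = ix1 (Ordinal lt2).
  case: (boolP (odd l)) => ol; [right|left]; apply/val_inj; rewrite /= ?val_ix0 ?val_ix1 /=; lia.
by case=> ->.
Qed.

Lemma subsp_last_ker : subsp last_ker.
Proof.
split; first by rewrite /last_ker mulmx0.
by move=> a u v hu hv; rewrite /last_ker mulmxDr -scalemxAr hu hv scaler0 addr0.
Qed.

Lemma subsp_common_ker : subsp common_ker.
Proof.
split; first by move=> l; rewrite mulmx0.
by move=> a u v hu hv l; rewrite mulmxDr -scalemxAr hu hv scaler0 addr0.
Qed.

Lemma stable_Xbil_last_ker x y : x ord_max = 0 -> y ord_max = 0 -> stable (Xbil x y) last_ker.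
Proof.
move=> x0 y0 z Kz; have := Xbil_Plin x y (coord_fun ord_max).
rewrite !dotF_coordr x0 y0 !scale0r subrr Plin_coord => /(congr1 (fun A => A *m z)).
rewrite mul0mx mulmxBl -!mulmxA Kz mulmx0 sub0r => /eqP.
by rewrite oppr_eq0 => /eqP.
Qed.

Lemma stable_Xbil_common_ker x y : stable (Xbil x y) common_ker.
Proof.
move=> z K0z l; have := Xbil_Plin x y (coord_fun l).
have P0 w : Plin w *m z = 0.
  by rewrite mulmx_suml big1 // => j _; rewrite -scalemxAl K0z scaler0.
move=> /(congr1 (fun A => A *m z)).
rewrite !mulmxBl -!scalemxAl !P0 !scaler0 subrr -!mulmxA P0 mulmx0 sub0r.
by rewrite Plin_coord => /eqP; rewrite oppr_eq0 => /eqP.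
Qed.

Definition Htor (c : 'I_r) : 'M[F]_n := X (ix0 c) (ix1 c).

Lemma Htor_stable_last_ker c : stable (Htor c) last_ker.
Proof.
rewrite /Htor -Xbil_coord; apply: stable_Xbil_last_ker; rewrite /coord_fun eq_sym ?ix0m ?ix1m //.
Qed.

Lemma Htor_stable_common_ker c : stable (Htor c) common_ker.
Proof. by rewrite /Htor -Xbil_coord; apply: stable_Xbil_common_ker. Qed.

(** For a vector annihilated modulo [common_ker] by the raising operators, the
    Casimir relation becomes triangular along the height, with diagonal entries
    of the form integer plus or minus [mu]. *)
Lemma highest_vector_common_ker z (mu : 'I_r -> F) : last_ker z ->
  (forall c, common_ker (Htor c *m z - (ii * mu c) *: z)) ->
  (forall c (k : int), mu c + k%:~R != 0) ->
  (forall a b, height b < height a -> common_ker (Xbil (zeta a) (zeta (star b)) *m z)) ->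
  common_ker z.
Proof.
move=> Kz Hz hmu hr; apply: common_kerP => // a.
have P0 w z' : common_ker z' -> Plin w *m z' = 0.
  by move=> K0z; rewrite mulmx_suml big1 // => j _; rewrite -scalemxAl K0z scaler0.
(* Descending induction on the height of [a]. *)
have [k] : exists k : nat, r%:Z - height a < k%:Z.
  by exists (r + r).+2; rewrite /height; case: (a.1); have := ltn_ord a.2; lia.
elim: k a => [|k IH] a ak.
  by move: ak; rewrite /height; case: (a.1); have := ltn_ord a.2; lia.
have hb b : height a < height b -> Plin (zeta b) *m z = 0.
  by move=> ab; apply: IH; lia.
have height_inj b b' : height b = height b' -> b = b'.
  case: b b' => s c [s' c']; rewrite /height /=.
  by case: s; case: s' => h; try (exfalso; lia); congr pair; apply: val_inj => /=; lia.
(* The [b]-th term of [casimir_hyperplane] at [y = zeta a] is a multiple of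
   [Plin (zeta a) *m z]: the terms below [a] contain a raising operator, those
   above reduce by the induction hypothesis to the bracket of [P] and [X]. *)
pose t b : F := if b == a then - (2 * branch_sign a.1 * mu a.2)
  else if b == star a then 0 else (height a < height b)%R%:R *+ 2.
have tE b : Plin (zeta b) *m Xbil (zeta a) (zeta (star b)) *m z = t b *: (Plin (zeta a) *m z).
  rewrite /t; case: eqP => [->|/eqP ba].
    have -> : Xbil (zeta a) (zeta (star a)) = (2 * (branch_sign a.1 * ii)) *: Htor a.2.
      rewrite Xbil_zetar Xbil_anti (Xbil_anti (coord_fun (ix1 _))) !Xbil_zetar !Xbil_diag branch_signN.
      rewrite !Xbil_coord /= (hXN (ix0 a.2) (ix1 a.2)) /Htor.
      by move: (X _ _) => Y; apply/matrixP => i j; rewrite !mxE; ring.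
    rewrite -mulmxA -scalemxAl -scalemxAr.
    have := P0 (zeta a) _ (Hz a.2); rewrite mulmxBr => /eqP; rewrite subr_eq0 => /eqP ->.
    rewrite -scalemxAr scalerA; congr (_ *: _).
    have -> : 2 * (branch_sign a.1 * ii) * (ii * mu a.2) = 2 * branch_sign a.1 * mu a.2 * (ii * ii) by ring.
    by rewrite ii2 mulrN1.
  case: eqP => [->|/eqP bsa]; first by rewrite starK Xbil_diag mulmx0 mul0mx scale0r.
  case: (ltP (height a) (height b)) => ab; last first.
    rewrite -mulmxA P0; first by rewrite mulr0n mul0rn scale0r.
    apply: hr; rewrite lt_neqAle ab andbT.
    by apply: contra ba => /eqP /height_inj ->.
  have := Xbil_Plin (zeta a) (zeta (star b)) (zeta b).
  rewrite !dotF_zz (_ : a == star b = false) ?eqxx; last first.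
    by apply/negP => /eqP e; move: bsa; rewrite e starK eqxx.
  rewrite mul0rn scale0r sub0r => /(congr1 (fun A => A *m z)).
  rewrite mulmxBl -[_ *m Plin _ *m z]mulmxA hb // mulmx0 sub0r mulNmx -scalemxAl.
  by move/oppr_inj.
have := @casimir_hyperplane (zeta a) z (zeta_max a) Kz.
under eq_bigr => b _ do rewrite tE.
rewrite -scaler_suml => /eqP; rewrite -subr_eq0 -scalerBl scaler_eq0 => /orP[|/eqP //].
pose N := \sum_(b | (b != a) && (b != star a)) (height a < height b)%R%:R : int.
have saa : star a != a.
  by apply/eqP => /(congr1 fst) /=; case: a.1.
have -> : \sum_b t b = - (2 * branch_sign a.1 * mu a.2) + N%:~R *+ 2.
  rewrite (bigD1 a) //= {1}/t eqxx; congr (_ + _).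
  rewrite (bigD1 (star a)) //= {1}/t (negPf saa) eqxx add0r /N.
  rewrite rmorph_sum /= -sumrMnl; apply: eq_bigr => b /andP[/negPf ba /negPf bsa].
  by rewrite /t ba bsa; case: (height a < height b)%R.
(* [N] counts the basis vectors above [a] other than its conjugate; the relation equates
   [N - branch_sign a.1 * mu a.2] with [r - 1]. *)
have nz : mu a.2 + (- (if a.1 then 1 else -1) * (N - (r%:Z - 1)))%:~R != 0 by apply: hmu.
move=> /eqP e; case/negP: nz; apply/eqP.
have branch_signE : branch_sign a.1 = (if a.1 then 1 else -1 : int)%:~R by case: a.1; rewrite /branch_sign ?rmorphN.
have e2 : 2 * (- branch_sign a.1 * mu a.2 + (N%:~R - (r%:R - 1))) = 0 by rewrite -[RHS]e; ring.
move/eqP: e2; rewrite mulf_eq0 pnatr_eq0 /= => /eqP e2.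
have : - branch_sign a.1 * (- branch_sign a.1 * mu a.2 + (N%:~R - (r%:R - 1))) = 0 by rewrite e2 mulr0.
rewrite mulrDr mulrA mulrNN branch_sign_sq mul1r => <-; congr (_ + _).
by rewrite rmorphM rmorphN rmorphB rmorphB /= -branch_signE.
Qed.

Lemma HtorC c d : Htor c *m Htor d = Htor d *m Htor c.
Proof.
case: (eqVneq c d) => [-> //|cd]; apply/eqP; rewrite -subr_eq0 /Htor hXX.
rewrite !(ix00, ix11, ix01, ix10) (eq_sym d) (negPf cd).
by rewrite bracket_disjoint.
Qed.

Lemma Htor_zeta_bracket c a b :
  Htor c *m Xbil (zeta a) (zeta (star b)) - Xbil (zeta a) (zeta (star b)) *m Htor c =
  (ii * ((c == a.2)%:R * branch_sign a.1 - (c == b.2)%:R * branch_sign b.1)) *: Xbil (zeta a) (zeta (star b)).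
Proof.
rewrite /Htor X_Xbil (Xbil_extl _ (Lr_zeta c a)) (Xbil_extr _ (Lr_zeta c (star b))).
rewrite Xbil_scalel Xbil_scaler -scalerDl /= branch_signN; congr (_ *: _); ring.
Qed.

(** An element of the torus algebra whose eigenvalue moves by a positive multiple
    of [ii] under every raising operator. *)
Definition height_op : 'M[F]_n := \sum_(c < r) (c : nat).+1%:R *: Htor c.

Lemma zeta_height a : \sum_(c < r) (c : nat).+1%:R * ((c == a.2)%:R * branch_sign a.1) = (height a)%:~R.
Proof.
rewrite (bigD1 a.2) //= eqxx big1 ?addr0 => [|c /negPf ->]; last by rewrite !(mul0r, mulr0).
by rewrite mul1r /branch_sign /height; case: a.1; rewrite ?mulr1 // mulrN1 rmorphN.
Qed.

Lemma progression_bound (rs : seq F) (a : F) :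
  exists N : nat, forall k : nat, a + ii * k%:R \in rs -> (k <= N)%N.
Proof.
have ii0 : ii != 0.
  by apply/eqP => i0; move: ii2; rewrite i0 mul0r => /eqP; rewrite eq_sym oppr_eq0 oner_eq0.
elim: rs => [|b rs [N hN]]; first by exists 0%N => k; rewrite in_nil.
have [[k0 hk0]|nk] := pselect (exists k0 : nat, a + ii * k0%:R = b).
  exists (maxn N k0) => k; rewrite inE => /orP[/eqP e|/hN]; last by lia.
  move: e; rewrite -hk0 => /addrI /(mulfI ii0) /eqP; rewrite eqr_nat => /eqP ->.
  exact: leq_maxr.
exists N => k; rewrite inE => /orP[/eqP e|/hN //].
by case: nk; exists k.
Qed.

Hypothesis hW : forall c (v : 'cV[F]_n) (a : F), v != 0 -> Htor c *m v = a *: v ->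
  exists k : int, a = ii * (k%:~R + 2^-1).

(** Otherwise the quotient of [last_ker] by [common_ker] contains a joint
    eigenvector of the torus.  As long as some raising operator does not kill
    it, its image is another one, with an eigenvalue of [height_op] further up the
    same progression, and this cannot go on for ever; a topmost one contradicts the previous lemma, its
    weight being half-integral. *)
Theorem symbol_kernel z : last_ker z -> common_ker z.
Proof.
move=> Kz; apply: contrapT => nz.
have [rs [_ rs0]] := strip_annihilates height_op.
have joint : exists z (a : 'I_r -> F), [/\ last_ker z, ~ common_ker z & forall c, common_ker (Htor c *m z - a c *: z)].
  have [|z' [a [h1 h2 h3]]] := @joint_eigenvector F n 'I_r Htor (enum 'I_r) last_ker common_ker HtorC
      subsp_last_ker subsp_common_ker Htor_stable_last_ker Htor_stable_common_ker; first by exists z.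
  by exists z', a; split=> // c; apply: h3; rewrite mem_enum.
have heig z' (a : 'I_r -> F) : (forall c, common_ker (Htor c *m z' - a c *: z')) ->
   common_ker (height_op *m z' - (\sum_(c < r) (c : nat).+1%:R * a c) *: z').
  move=> ha l; rewrite mulmx_suml scaler_suml -sumrB mulmx_sumr big1 // => c _.
  by rewrite -scalemxAl -scalerA -scalerBr -scalemxAr ha scaler0.
have st_h : stable height_op common_ker.
  move=> v K0v l; rewrite mulmx_suml mulmx_sumr big1 // => c _.
  by rewrite -scalemxAl -scalemxAr Htor_stable_common_ker // scaler0.
(* Raising a joint eigenvector [k] times produces an eigenvalue of [height_op]
   at least [k] steps above the initial one. *)
have climb k : forall z' (a : 'I_r -> F), last_ker z' -> ~ common_ker z' ->
    (forall c, common_ker (Htor c *m z' - a c *: z')) ->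
    exists2 k' : nat, (k <= k')%N & (\sum_(c < r) (c : nat).+1%:R * a c) + ii * k'%:R \in rs.
  elim: k => [|k IH] z' a Kz' nz' ha.
    exists 0%N => //; rewrite mulr0 addr0.
    exact: (quotient_eigenvalue subsp_common_ker st_h nz' (heig _ _ ha) rs0).
  have hmu c : exists k : int, a c = ii * (k%:~R + 2^-1).
    have [qs [qs1 qs0]] := strip_annihilates (Htor c).
    have aq := quotient_eigenvalue subsp_common_ker (@Htor_stable_common_ker c) nz' (ha c) qs0.
    by have [v v0 hv] := qs1 _ aq; apply: (hW v0 hv).
  have ii0 : ii != 0.
    by apply/eqP => i0; move: ii2; rewrite i0 mul0r => /eqP; rewrite eq_sym oppr_eq0 oner_eq0.
  have [hr|] := pselect (forall a b, height b < height a -> common_ker (Xbil (zeta a) (zeta (star b)) *m z')).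
    case: nz'; apply: (@highest_vector_common_ker z' (fun c => ii^-1 * a c)) => //.
      by move=> c; rewrite mulrA mulfV // mul1r.
    move=> c j; have [k0 ->] := hmu c; rewrite mulrA mulVf // mul1r.
    apply/eqP => e; have : (2 * (k0 + j) + 1)%:~R = 0 :> F.
      by rewrite rmorphD rmorphM rmorphD /= -[RHS](mulr0 2) -e; field.
    by move/eqP; rewrite intr_eq0; lia.
  move=> /existsNP[x /existsNP[y /not_implyP[xy nK0]]].
  pose wt c : F := (c == x.2)%:R * branch_sign x.1 - (c == y.2)%:R * branch_sign y.1.
  have [||c|k' kk' hk'] := IH (Xbil (zeta x) (zeta (star y)) *m z') (fun c => a c + ii * wt c).
  - by apply: stable_Xbil_last_ker; rewrite ?zeta_max.
  - exact: nK0.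
  - have := Htor_zeta_bracket c x y; rewrite -/(wt c) => /eqP; rewrite subr_eq => /eqP e.
    have -> : Htor c *m (Xbil (zeta x) (zeta (star y)) *m z')
        - (a c + ii * wt c) *: (Xbil (zeta x) (zeta (star y)) *m z')
      = Xbil (zeta x) (zeta (star y)) *m (Htor c *m z' - a c *: z').
      rewrite mulmxA e mulmxDl -scalemxAl mulmxBr -scalemxAr mulmxA.
      move: (_ *m z') (_ *m _ *m z') => u w.
      by apply/matrixP => p q; rewrite !mxE; ring.
    exact: stable_Xbil_common_ker.
  have [d dE d1] : exists2 d : nat, height x - height y = d%:Z & (0 < d)%N.
    by exists (`|height x - height y|)%N; lia.
  exists (d + k')%N; first by lia.
  move: hk'; rewrite (_ : \sum_(c < r) _ = \sum_(c < r) (c : nat).+1%:R * a c + ii * d%:R).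
    by rewrite natrD mulrDr addrA.
  under eq_bigr => c _ do rewrite mulrDr mulrCA.
  rewrite big_split /= -mulr_sumr; congr (_ + ii * _).
  under eq_bigr => c _ do rewrite mulrBr.
  rewrite sumrB !zeta_height -rmorphB dE //.
have [z1 [a [Kz1 nz1 ha]]] := joint.
have [N hN] := progression_bound rs (\sum_(c < r) (c : nat).+1%:R * a c).
have [k' kk' hk'] := climb N.+1 z1 a Kz1 nz1 ha.
by have := hN _ hk'; lia.
Qed.

End Ellipticity.

(** * Polynomials in several variables *)

Section IteratedPolynomials.
Variable F : numFieldType.

(** Polynomials in [m] variables over an iterated univariate ring, so that
    division by a polynomial monic in the outermost variable, of index 0, is the
    univariate one. *)
Fixpoint mpol (m : nat) : idomainType :=
  if m is m'.+1 then ({poly mpol m'} : idomainType) else F.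

Fixpoint pcst (m : nat) : {rmorphism F -> mpol m} :=
  match m return {rmorphism F -> mpol m} with
  | 0 => (idfun : {rmorphism F -> F})
  | m'.+1 => ((@polyC (mpol m')) \o pcst m' : {rmorphism F -> {poly mpol m'}})
  end.

Fixpoint pvar (m : nat) : 'I_m -> mpol m :=
  match m return 'I_m -> mpol m with
  | 0 => fun _ => 0
  | m'.+1 => fun i => if unlift ord0 i is Some j then (pvar j)%:P else 'X
  end.

Section Evaluation.
Variables (A : comNzRingType) (phi : {rmorphism F -> A}).

Lemma commr_all (B : nzRingType) (f : {rmorphism B -> A}) (u : A) : commr_rmorph f u.
Proof. by move=> x; apply: mulrC. Qed.

Fixpoint meval (m : nat) : ('I_m -> A) -> {rmorphism mpol m -> A} :=
  match m return ('I_m -> A) -> {rmorphism mpol m -> A} with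
  | 0 => fun _ => phi
  | m'.+1 => fun x =>
     (horner_morph (commr_all (meval (fun i : 'I_m' => x (lift ord0 i))) (x ord0))
       : {rmorphism {poly mpol m'} -> A})
  end.

Lemma meval_poly m (x : 'I_m.+1 -> A) (p : {poly mpol m}) :
  meval x (p : mpol m.+1) = (map_poly (meval (fun i => x (lift ord0 i))) p).[x ord0].
Proof. by []. Qed.

Lemma meval_pcst m (x : 'I_m -> A) c : meval x (pcst m c) = phi c.
Proof.
elim: m x => [|m IH] x //=.
by rewrite meval_poly map_polyC hornerC /= IH.
Qed.

Lemma meval_pvar m (x : 'I_m -> A) i : meval x (pvar i) = x i.
Proof.
elim: m x i => [|m IH] x i; first by case: i.
rewrite meval_poly /=; case: unliftP => [j ->|->].
  by rewrite map_polyC hornerC /= IH.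
by rewrite map_polyX hornerX.
Qed.
End Evaluation.

Lemma meval_morph (A A' : comNzRingType) (phi : {rmorphism F -> A})
    (phi' : {rmorphism F -> A'}) (psi : {rmorphism A -> A'}) m (x : 'I_m -> A) p :
  (forall c, psi (phi c) = phi' c) -> psi (meval phi x p) = meval phi' (fun i => psi (x i)) p.
Proof.
move=> h; elim: m x p => [|m IH] x p; first exact: h.
rewrite !meval_poly -(horner_map psi) -map_poly_comp; congr _.[_].
by apply: eq_map_poly => c; apply: IH.
Qed.

Lemma meval_ext (A : comNzRingType) (phi : {rmorphism F -> A}) m (x y : 'I_m -> A) p :
  x =1 y -> meval phi x p = meval phi y p.
Proof. by move=> /funext ->. Qed.

Definition meval_pt m (x : 'I_m -> F) : {rmorphism mpol m -> F} := meval idfun x.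

(** One variable at a time: a univariate polynomial with more roots than its size
    is zero, and the natural numbers supply enough of them. *)
Lemma mpol_eq0 m (p : mpol m) :
  (forall x : 'I_m -> nat, meval_pt (fun i => (x i)%:R) p = 0) -> p = 0.
Proof.
elim: m p => [|m IH] p h; first exact: (h (fun=> 0%N)).
apply/polyP => i; rewrite coef0; apply: IH => x.
pose f := meval (idfun : {rmorphism F -> F}) (fun i : 'I_m => (x i)%:R).
suff e : map_poly f p = 0 by rewrite /meval_pt -/f -coef_map e coef0.
apply/eqP; apply: contraT => nz.
pose rs : seq F := [seq k%:R | k <- iota 0 (size (map_poly f p))].
have := @max_poly_roots F (map_poly f p) rs nz.
rewrite size_map size_iota ltnn => hh; apply: hh.
  apply/allP => _ /mapP[k _ ->]; rewrite rootE.
  pose x' (i : 'I_m.+1) : nat := if unlift ord0 i is Some j then x j else k.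
  have := h x'; rewrite /meval_pt meval_poly /x' unlift_none => e; rewrite -[X in _ == X]e.
  apply/eqP; congr (_.[_]); apply: eq_map_poly => c; apply: meval_ext => j.
  by rewrite liftK.
by rewrite map_inj_uniq ?iota_uniq //; apply: (mulrIn (oner_neq0 F)).
Qed.

Definition quadric (m : nat) : mpol m := \sum_i pvar i ^+ 2.

Lemma quadricS m : quadric m.+1 = ('X^2 + (quadric m)%:P : {poly mpol m}).
Proof.
rewrite /quadric big_ord_recl /= unlift_none; congr (_ + _).
rewrite rmorph_sum /=; apply: eq_bigr => i _.
by rewrite liftK rmorphXn.
Qed.

Lemma meval_quadric m (x : 'I_m -> F) : meval_pt x (quadric m) = \sum_i x i ^+ 2.
Proof. by rewrite rmorph_sum; apply: eq_bigr => i _; rewrite rmorphXn /= /meval_pt meval_pvar. Qed.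

Lemma quadric_neq0 m : quadric m.+1 != 0.
Proof.
apply/eqP => e; have := meval_quadric (fun _ : 'I_m.+1 => 1); rewrite e rmorph0.
under eq_bigr => i _ do rewrite expr1n.
by rewrite sumr_const card_ord => /eqP; rewrite eq_sym pnatr_eq0.
Qed.

Lemma mpol_eq0_off_cone_nat m (p : mpol m.+1) :
  (forall x : 'I_m.+1 -> nat, \sum_i ((x i)%:R : F) ^+ 2 != 0 ->
     meval_pt (fun i => (x i)%:R) p = 0) -> p = 0.
Proof.
move=> h; have : p * quadric m.+1 = 0.
  apply: mpol_eq0 => x; rewrite rmorphM meval_quadric.
  case: (eqVneq (\sum_i (x i)%:R ^+ 2) (0 : F)) => [->|nz]; first by rewrite mulr0.
  by rewrite h // mul0r.
by move/eqP; rewrite mulf_eq0 (negPf (quadric_neq0 m)) orbF => /eqP.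
Qed.

Lemma mpol_eq0_off_cone m (p : mpol m.+1) :
  (forall x, \sum_i x i ^+ 2 != 0 -> meval_pt x p = 0) -> p = 0.
Proof. by move=> h; apply: mpol_eq0_off_cone_nat => x; apply: h. Qed.

Definition cons_pt m (s : F) (x : 'I_m -> F) (i : 'I_m.+1) : F :=
  if unlift ord0 i is Some j then x j else s.

Lemma meval_cons m (s : F) (x : 'I_m -> F) (p : {poly mpol m}) :
  meval_pt (cons_pt s x) (p : mpol m.+1) = (map_poly (meval_pt x) p).[s].
Proof.
rewrite /meval_pt meval_poly /cons_pt unlift_none; congr _.[_].
by apply: eq_map_poly => c; apply: meval_ext => j; rewrite liftK.
Qed.

(** The quadric is monic of degree 2 in the outermost variable, so the remainder
    is affine in it.  Over each base point with nonzero length the null cone has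
    two distinct points, and an affine function vanishing at both is zero. *)
Lemma quadric_dvd m (p : mpol m.+2) :
  (forall (x : 'I_m.+1 -> nat) (s : F), \sum_i ((x i)%:R : F) ^+ 2 != 0 ->
     s ^+ 2 = - \sum_i (x i)%:R ^+ 2 -> meval_pt (cons_pt s (fun i => (x i)%:R)) p = 0) ->
  (forall a : F, 0 <= a -> exists s : F, s ^+ 2 = - a) ->
  exists p', p = p' * quadric m.+2.
Proof.
move=> h hsq; pose q := ('X^2 + (quadric m.+1)%:P : {poly mpol m.+1}).
have szq : size q = 3%N.
  by rewrite size_polyDl size_polyXn // size_polyC; case: (_ != 0).
have mq : q \is monic.
  apply/monicP; rewrite lead_coefDl ?lead_coefXn // size_polyXn size_polyC.
  by case: (_ != 0).
pose d := Pdiv.Ring.rdivp (p : {poly _}) q; pose e := Pdiv.Ring.rmodp (p : {poly _}) q.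
have pE : (p : {poly mpol m.+1}) = d * q + e by apply: Pdiv.RingMonic.rdivp_eq.
exists d; rewrite quadricS -/q.
suff e0 : e = 0 by rewrite pE e0 addr0.
have sze : (size e <= 2)%N by rewrite -ltnS -szq Pdiv.Ring.ltn_rmodpN0 // monic_neq0.
have eE : e = (e`_0)%:P + (e`_1)%:P * 'X.
  apply/polyP => -[|[|i]]; rewrite coefD coefC coefMX coefC /= ?addr0 ?add0r //.
  by rewrite nth_default // (leq_trans sze).
have hx (x : 'I_m.+1 -> nat) : \sum_i ((x i)%:R : F) ^+ 2 != 0 ->
   meval_pt (fun i => (x i)%:R) e`_0 = 0 /\ meval_pt (fun i => (x i)%:R) e`_1 = 0.
  move=> nz; set xF := fun i => _.
  have [|s s2] := hsq (\sum_i ((x i)%:R : F) ^+ 2).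
    by apply: sumr_ge0 => i _; rewrite exprn_ge0.
  have hs t : t ^+ 2 = - \sum_i ((x i)%:R : F) ^+ 2 ->
      meval_pt xF e`_0 + meval_pt xF e`_1 * t = 0.
    move=> t2; have := h x t nz t2; rewrite pE meval_cons rmorphD rmorphM hornerD hornerM /=.
    rewrite [X in _ * X + _](_ : _ = 0) ?mulr0 ?add0r.
      by rewrite [in X in X -> _]eE rmorphD rmorphM /= !map_polyC map_polyX !hornerE.
    have -> : map_poly (meval_pt xF) q = 'X^2 + (meval_pt xF (quadric m.+1))%:P.
      by rewrite /q rmorphD; congr (_ + _); [apply: map_polyXn|apply: map_polyC].
    by rewrite hornerD hornerXn hornerC t2 meval_quadric addNr.
  have e1 := hs s s2; have e2 := hs (- s); rewrite sqrrN s2 mulrN in e2.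
  have e3 := e2 erefl.
  have a0 : meval_pt xF e`_0 = 0.
    have : 2 * meval_pt xF e`_0 = 0 by rewrite -[RHS](addr0 0) -{1}e1 -e3; ring.
    by move/eqP; rewrite mulf_eq0 pnatr_eq0 => /eqP.
  split=> //; move: e1; rewrite a0 add0r => /eqP; rewrite mulf_eq0 => /orP[/eqP //|/eqP s0].
  by move: nz; rewrite -oppr_eq0 -s2 s0 expr0n eqxx.
have z0 : e`_0 = 0 by apply: mpol_eq0_off_cone_nat => x /hx[].
have z1 : e`_1 = 0 by apply: mpol_eq0_off_cone_nat => x /hx[].
by rewrite eE z0 z1 polyC0 mul0r addr0.
Qed.

(** Substitution of linear forms, the action of matrices on polynomials. *)
Definition linsub m (g : 'I_m -> 'I_m -> F) (p : mpol m) : mpol m :=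
  meval (pcst m) (fun i => \sum_j pcst m (g i j) * pvar j) p.

Lemma meval_linsub m (g : 'I_m -> 'I_m -> F) (x : 'I_m -> F) (p : mpol m) :
  meval_pt x (linsub g p) = meval_pt (fun i => \sum_j g i j * x j) p.
Proof.
rewrite /linsub (@meval_morph _ _ (pcst m) idfun (meval_pt x)); last first.
  by move=> c; rewrite /meval_pt meval_pcst.
apply: meval_ext => i; rewrite rmorph_sum; apply: eq_bigr => j _.
by rewrite rmorphM /meval_pt meval_pcst meval_pvar.
Qed.

End IteratedPolynomials.

(** * Dividing a matrix identity by the quadric *)

Section Sylvester.
Variables (F : closedFieldType) (n : nat).

Lemma not_eigenvalue_unit (H : 'M[F]_n) (a : F) :
  (forall v : 'cV[F]_n, v != 0 -> H *m v <> a *: v) -> H - a%:M \in unitmx.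
Proof.
move=> h; rewrite unitmxE unitfE; apply/negP => /eqP d0.
have : \det (H - a%:M)^T == 0 by rewrite det_tr d0.
case/det0P => v v0 hv; case: (h v^T).
  by apply: contra v0 => /eqP e; rewrite -(trmxK v) e trmx0.
apply/eqP; rewrite -subr_eq0 -mul_scalar_mx -mulmxBl -[H - _]trmxK -trmx_mul hv.
by rewrite trmx0.
Qed.

(** The factors [H - a] annihilating everything can be removed one at a time: on
    the image of [B] such a factor acts as [B] after [H - (a - c)], which is
    invertible when [a - c] is not an eigenvalue. *)
Lemma sylvester_eq0 (H B : 'M[F]_n) (c : F) :
  H *m B = B *m (H + c%:M) ->
  (forall a (v : 'cV[F]_n), v != 0 -> H *m v = a *: v ->
   forall w : 'cV[F]_n, w != 0 -> H *m w <> (a - c) *: w) ->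
  B = 0.
Proof.
move=> HB hsp; have [rs [rs1 rs0]] := strip_annihilates H.
have sh (a : F) (v : 'cV[F]_n) : (H - a%:M) *m (B *m v) = B *m ((H - (a - c)%:M) *m v).
  rewrite !mulmxA; congr (_ *m _); rewrite mulmxBl HB mul_scalar_mx -mul_mx_scalar.
  rewrite -mulmxBr; congr (_ *m _).
  by apply/matrixP => i j; rewrite !mxE mulrnBl; ring.
have h : forall qs : seq F, (forall a, a \in qs -> a \in rs) ->
    (forall v, strip H qs (B *m v) = 0) -> forall v : 'cV[F]_n, B *m v = 0.
  elim=> [|a qs IH] hqs hv v; first exact: (hv v).
  apply: IH => [b bq|w]; first by apply: hqs; rewrite inE bq orbT.
  have [u u0 hu] := rs1 a (hqs a (mem_head _ _)).
  have U := not_eigenvalue_unit (hsp a u u0 hu).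
  have := hv (invmx (H - (a - c)%:M) *m w).
  by rewrite /= sh [_ *m (invmx _ *m _)]mulmxA mulmxV // mul1mx.
have B0 := h rs (fun a ha => ha) (fun v => rs0 (B *m v)).
by apply/matrixP => i j; have /colP/(_ i) := B0 (delta_mx j 0); rewrite -colE !mxE.
Qed.
End Sylvester.

Section Descent.
Variables (F : numFieldType) (m n : nat).
Local Notation M := m.+2.
Local Notation Pol := (mpol F M).
Variable P : 'I_M -> 'M[F]_n.

Definition symbol (x : 'I_M -> F) : 'M[F]_n := \sum_i x i *: P i.
Definition symbol_mx : 'M[Pol]_n := \sum_i pvar F i *: map_mx (pcst F M) (P i).
Definition qf (x : 'I_M -> F) : F := \sum_i x i ^+ 2.

Lemma ev_symbol_mx x : map_mx (meval_pt x) symbol_mx = symbol x.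
Proof.
apply/matrixP => i j; rewrite !mxE !summxE rmorph_sum; apply: eq_bigr => k _.
by rewrite !mxE rmorphM /meval_pt meval_pvar meval_pcst.
Qed.

Lemma ev_det_symbol_mx x : meval_pt x (\det symbol_mx) = \det (symbol x).
Proof. by rewrite -det_map_mx ev_symbol_mx. Qed.

(** An identity of polynomials holds if it holds at all points with natural
    coordinates. *)
Lemma det_symbol_mx_quadric (c : F) k :
  (forall x : 'I_M -> nat, \det (symbol (fun i => (x i)%:R)) ^+ 2 =
     c * qf (fun i => (x i)%:R) ^+ k) ->
  \det symbol_mx ^+ 2 = pcst F M c * quadric F M ^+ k.
Proof.
move=> h; apply/eqP; rewrite -subr_eq0; apply/eqP; apply: mpol_eq0 => x.
set D := \det symbol_mx; have := h x; rewrite -ev_det_symbol_mx -/D; move: D => D e.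
rewrite (rmorphB (meval_pt _)) (rmorphXn (meval_pt _)) e (rmorphM (meval_pt _)) (rmorphXn (meval_pt _)) meval_quadric.
by rewrite {1}/meval_pt meval_pcst subrr.
Qed.

Lemma symbolZ t x : symbol (fun i => t * x i) = t *: symbol x.
Proof. by rewrite /symbol scaler_sumr; apply: eq_bigr => i _; rewrite scalerA. Qed.

Lemma qfZ t x : qf (fun i => t * x i) = t ^+ 2 * qf x.
Proof. by rewrite /qf mulr_sumr; apply: eq_bigr => i _; rewrite exprMn. Qed.

Section Quotient.
Variables (B : 'M[Pol]_n) (c : F) (j : nat).
Hypotheses (c0 : c != 0)
  (hB : B *m symbol_mx = (pcst F M c * quadric F M ^+ j)%:M).

Definition quot (x : 'I_M -> F) : 'M[F]_n := map_mx (meval_pt x) B.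

Lemma quot_symbol x : quot x *m symbol x = (c * qf x ^+ j)%:M.
Proof.
rewrite /quot -ev_symbol_mx -map_mxM hB map_scalar_mx rmorphM rmorphXn meval_quadric.
by rewrite /meval_pt meval_pcst.
Qed.

Lemma symbol_cancel x (A : 'M[F]_n) : qf x != 0 -> A *m symbol x = 0 -> A = 0.
Proof.
move=> qx h; have nz : c * qf x ^+ j != 0 by rewrite mulf_neq0 ?expf_neq0.
have : ((c * qf x ^+ j)^-1 *: quot x) *m symbol x = 1%:M.
  by rewrite -scalemxAl quot_symbol -mul_scalar_mx -scalar_mxM mulVf.
move/mulmx1C => e.
by rewrite -[A]mulmx1 -e mulmxA h mul0mx.
Qed.

(** Where the quadric does not vanish, [quot] is a scalar multiple of the inverse
    of the symbol and inherits its equivariance; both sides are polynomial, so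
    the identity extends to the null cone, where it is used. *)
Lemma quot_equivariant (g : 'I_M -> 'I_M -> F) (A : 'M[F]_n) :
  (forall x, A *m symbol x = symbol (fun i => \sum_k g i k * x k) *m A) ->
  (forall x, qf (fun i => \sum_k g i k * x k) = qf x) ->
  forall x, A *m quot x = quot (fun i => \sum_k g i k * x k) *m A.
Proof.
move=> hA hg; pose gx x : 'I_M -> F := fun i => \sum_k g i k * x k.
pose D : 'M[Pol]_n := map_mx (pcst F M) A *m B - map_mx (linsub g) B *m map_mx (pcst F M) A.
have evc x : map_mx (meval_pt x) (map_mx (pcst F M) A) = A.
  by apply/matrixP => p q; rewrite !mxE /meval_pt meval_pcst.
have evg x : map_mx (meval_pt x) (map_mx (linsub g) B) = quot (gx x).
  by apply/matrixP => p q; rewrite !mxE meval_linsub.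
have evD x : map_mx (meval_pt x) D = A *m quot x - quot (gx x) *m A.
  by rewrite /D map_mxB !map_mxM evc evg.
have D0 : D = 0.
  apply/matrixP => p q; rewrite [RHS]mxE; apply: mpol_eq0_off_cone => x qx.
  suff : map_mx (meval_pt x) D = 0 by move/matrixP/(_ p q); rewrite !mxE.
  rewrite evD; apply: (symbol_cancel qx); rewrite mulmxBl -!mulmxA hA mulmxA.
  rewrite mulmxA -mulmxA quot_symbol [X in _ - X](_ : _ = (c * qf x ^+ j)%:M *m A).
    by rewrite scalar_mxC subrr.
  by rewrite quot_symbol hg.
by move=> x; apply/eqP; rewrite -subr_eq0 -evD D0 map_mx0.
Qed.

(** The same density argument; the degree is that of [q ^ j] minus the degree 1
    of the symbol. *)
Lemma quot_homogeneous t : t != 0 -> (0 < j)%N ->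
  forall x, quot (fun i => t * x i) = t ^+ (j.*2.-1) *: quot x.
Proof.
move=> t0 j0; pose D : 'M[Pol]_n := map_mx (linsub (fun i k => t * (i == k)%:R)) B
   - pcst F M (t ^+ (j.*2.-1)) *: B.
have evD x : map_mx (meval_pt x) D = quot (fun i => t * x i) - t ^+ (j.*2.-1) *: quot x.
  apply/matrixP => p q; rewrite !mxE rmorphB rmorphM meval_linsub /meval_pt meval_pcst.
  congr (_ - _); apply: meval_ext => i; rewrite (bigD1 i) //= eqxx mulr1 big1 ?addr0 //.
  by move=> k /negPf ki; rewrite eq_sym ki mulr0 mul0r.
have D0 : D = 0.
  apply/matrixP => p q; rewrite [RHS]mxE; apply: mpol_eq0_off_cone => x qx.
  suff : map_mx (meval_pt x) D = 0 by move/matrixP/(_ p q); rewrite !mxE.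
  rewrite evD; apply: (symbol_cancel qx); rewrite mulmxBl -scalemxAl quot_symbol.
  have := quot_symbol (fun i => t * x i); rewrite symbolZ qfZ -scalemxAr.
  move/(congr1 (fun A => t^-1 *: A)); rewrite scalerA mulVf // scale1r => ->.
  rewrite -!mul_scalar_mx -!scalar_mxM -raddfB /=.
  apply/eqP; rewrite (_ : _ - _ = 0) ?scalar_mx0 ?raddf0 //.
  case: j j0 => // k _; rewrite doubleS /= exprMn -exprM mulnC muln2 doubleS !exprS.
  by field.
by move=> x; apply/eqP; rewrite -subr_eq0 -evD D0 map_mx0.
Qed.
End Quotient.

(** While [j > J] the factor [B] vanishes on the null cone, hence is [q] times
    another matrix of polynomials, and [q] can be cancelled on both sides. *)
Lemma quotient_descent (J : nat) (c : F) : c != 0 ->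
  (forall a : F, 0 <= a -> exists s : F, s ^+ 2 = - a) ->
  (forall (B : 'M[Pol]_n) j, (J < j)%N ->
    B *m symbol_mx = (pcst F M c * quadric F M ^+ j)%:M ->
    forall (x : 'I_m.+1 -> nat) (s : F), \sum_i ((x i)%:R : F) ^+ 2 != 0 ->
     s ^+ 2 = - \sum_i (x i)%:R ^+ 2 -> quot B (cons_pt s (fun i => (x i)%:R)) = 0) ->
  forall j (B : 'M[Pol]_n), B *m symbol_mx = (pcst F M c * quadric F M ^+ j)%:M ->
  exists Q : 'M[Pol]_n, Q *m symbol_mx = (pcst F M c * quadric F M ^+ J)%:M.
Proof.
move=> c0 hsq van.
have small j B : (j <= J)%N -> B *m symbol_mx = (pcst F M c * quadric F M ^+ j)%:M ->
   exists Q : 'M[Pol]_n, Q *m symbol_mx = (pcst F M c * quadric F M ^+ J)%:M.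
  move=> jJ hB; exists (quadric F M ^+ (J - j) *: B).
  rewrite -scalemxAl hB -mul_scalar_mx -scalar_mxM.
  by congr (_%:M); rewrite mulrCA -exprD subnK.
elim=> [|j IH] B hB; first exact: small hB.
have [jJ|Jj] := leqP j.+1 J; first exact: small hB.
have dv p q : exists b, B p q = b * quadric F M.
  apply: quadric_dvd => // x s nz s2.
  by have /matrixP/(_ p q) := van B j.+1 Jj hB x s nz s2; rewrite !mxE.
pose b p q := projT1 (cid (dv p q)).
have bE : B = quadric F M *: \matrix_(p, q) b p q.
  by apply/matrixP => p q; rewrite !mxE mulrC; apply: (projT2 (cid (dv p q))).
apply: (IH (\matrix_(p, q) b p q)); apply: (scalemx_inj (quadric_neq0 F m.+1)).
by rewrite /= scalemxAl -bE hB -mul_scalar_mx -scalar_mxM mulrCA -exprS.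
Qed.
End Descent.

(** * Constant-coefficient operators on a module *)

Section ConstantCoefficientOperators.
Variables (F : numFieldType) (V : lmodType F).

(** The polynomial [p] evaluated at the operators [d].  Derivations are linear and
    commute only on smooth functions, which become the subspace [S] below; the
    evaluation is compatible with products only there, so it is not defined as a
    ring morphism. *)
Fixpoint diff_op (m : nat) : ('I_m -> V -> V) -> mpol F m -> V -> V :=
  match m return ('I_m -> V -> V) -> mpol F m -> V -> V with
  | 0 => fun _ (c : F) f => c *: f
  | m'.+1 => fun d (p : {poly mpol F m'}) f =>
     \sum_(k < size p) diff_op (fun i : 'I_m' => d (lift ord0 i)) p`_k (iter k (d ord0) f)
  end.

Lemma diff_opE m (d : 'I_m.+1 -> V -> V) (p : {poly mpol F m}) f :
  diff_op d (p : mpol F m.+1) f =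
  \sum_(k < size p) diff_op (fun i => d (lift ord0 i)) p`_k (iter k (d ord0) f).
Proof. by []. Qed.

Lemma diff_op0 m (d : 'I_m -> V -> V) f : diff_op d 0 f = 0.
Proof.
by case: m d => [|m] d; [apply: scale0r|rewrite diff_opE size_poly0 big_ord0].
Qed.

Lemma diff_op_bound m (d : 'I_m.+1 -> V -> V) (p : {poly mpol F m}) f N : (size p <= N)%N ->
  diff_op d (p : mpol F m.+1) f =
  \sum_(k < N) diff_op (fun i => d (lift ord0 i)) p`_k (iter k (d ord0) f).
Proof.
move=> sN; rewrite diff_opE.
rewrite (big_ord_widen N (fun k => diff_op (fun i => d (lift ord0 i)) p`_k (iter k (d ord0) f))) //.
rewrite big_mkcond /=; apply: eq_bigr => k _; case: ltnP => // sk.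
by rewrite nth_default // diff_op0.
Qed.

Lemma diff_opD m (d : 'I_m -> V -> V) p q f : diff_op d (p + q) f = diff_op d p f + diff_op d q f.
Proof.
elim: m d p q f => [|m IH] d p q f; first exact: scalerDl.
rewrite !(@diff_op_bound m d _ f (maxn (size (p : {poly _})) (size (q : {poly _})))) ?leq_maxl ?leq_maxr //.
  by rewrite -big_split /=; apply: eq_bigr => k _; rewrite coefD IH.
exact: size_polyD.
Qed.

Lemma diff_op_cst m (d : 'I_m -> V -> V) a p f : diff_op d (pcst F m a * p) f = a *: diff_op d p f.
Proof.
elim: m d p f => [|m IH] d p f; first by rewrite /= scalerA.
rewrite (@diff_op_bound m d _ f (size (p : {poly _}))); last first.
  by rewrite mul_polyC; apply: size_scale_leq.
rewrite diff_opE scaler_sumr; apply: eq_bigr => k _.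
by rewrite coefCM IH.
Qed.

Lemma diff_op1 m (d : 'I_m -> V -> V) f : diff_op d 1 f = f.
Proof.
elim: m d => [|m IH] d; first exact: scale1r.
by rewrite (@diff_op_bound m d _ f 1) ?size_poly1 // big_ord1 coef1 IH.
Qed.

Lemma diff_op_sum m (d : 'I_m -> V -> V) (I : Type) (s : seq I) (Q : pred I) (G : I -> mpol F m) f :
  diff_op d (\sum_(i <- s | Q i) G i) f = \sum_(i <- s | Q i) diff_op d (G i) f.
Proof. by elim/big_rec2: _ => [|i y z _ <-]; rewrite ?diff_op0 ?diff_opD. Qed.

Definition linear_on (S : V -> Prop) (d : V -> V) : Prop :=
  (forall f, S f -> S (d f)) /\
  (forall a f g, S f -> S g -> d (a *: f + g) = a *: d f + d g).

Variable S : V -> Prop.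
Hypothesis S0 : S 0.
Hypothesis SD : forall a f g, S f -> S g -> S (a *: f + g).

Lemma iter_linear_on d k : linear_on S d -> linear_on S (iter k d).
Proof.
case=> [h1 h2]; elim: k => [|k [k1 k2]] //.
split=> [f Sf /=|a f g Sf Sg /=]; first exact/h1/k1.
by rewrite k2 // h2 //; apply: k1.
Qed.

Lemma diff_op_linear m (d : 'I_m -> V -> V) p a f g : (forall i, linear_on S (d i)) ->
  S f -> S g -> diff_op d p (a *: f + g) = a *: diff_op d p f + diff_op d p g.
Proof.
elim: m d p f g => [|m IH] d p f g hd Sf Sg.
  by rewrite /= scalerDr !scalerA mulrC.
rewrite !diff_opE scaler_sumr -big_split /=; apply: eq_bigr => k _.
have [k1 k2] := iter_linear_on k (hd ord0).
by rewrite k2 // IH //; apply: k1.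
Qed.

Lemma diff_op_zero m (d : 'I_m -> V -> V) p : (forall i, linear_on S (d i)) -> diff_op d p 0 = 0.
Proof.
move=> hd; have := @diff_op_linear m d p (-1) 0 0 hd S0 S0; rewrite scaler0 addr0 => e.
by rewrite {1}e scaleN1r addNr.
Qed.

Lemma S_sum (I : Type) (s : seq I) (G : I -> V) :
  (forall i, S (G i)) -> S (\sum_(i <- s) G i).
Proof.
move=> h; elim: s => [|i s IH]; first by rewrite big_nil.
by rewrite big_cons -[G i]scale1r; apply: SD.
Qed.

Lemma diff_op_linear_sum m (d : 'I_m -> V -> V) p (I : Type) (s : seq I) (c : I -> F) (G : I -> V) :
  (forall i, linear_on S (d i)) -> (forall i, S (G i)) ->
  diff_op d p (\sum_(i <- s) c i *: G i) = \sum_(i <- s) c i *: diff_op d p (G i).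
Proof.
move=> hd hG; elim: s => [|i s IH]; first by rewrite !big_nil diff_op_zero.
rewrite !big_cons diff_op_linear ?IH //; apply: S_sum => k.
by rewrite -[_ *: _]addr0; apply: SD.
Qed.

Lemma diff_op_var m (d : 'I_m -> V -> V) p i f : (forall i, linear_on S (d i)) ->
  (forall i j f, S f -> d i (d j f) = d j (d i f)) -> S f ->
  diff_op d (p * pvar F i) f = diff_op d p (d i f).
Proof.
elim: m d p i f => [|m IH] d p i f hd hc Sf; first by case: i.
have itS k : S (iter k (d ord0) f) by have [h _] := iter_linear_on k (hd ord0); apply: h.
have itC j k : iter k (d ord0) (d j f) = d j (iter k (d ord0) f).
  by elim: k => //= k ->; rewrite hc.
rewrite [pvar _ _]/=; case: unliftP => [j ->|->].
  rewrite (@diff_op_bound m d _ f (size (p : {poly _}))); last first.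
    by rewrite mulrC mul_polyC; apply: size_scale_leq.
  rewrite diff_opE; apply: eq_bigr => k _.
  rewrite coefMC IH //; first by rewrite itC.
  by move=> i1 i2 g Sg; apply: hc.
rewrite (@diff_op_bound m d _ f (size (p : {poly _})).+1); last first.
  by case: (eqVneq p 0) => [->|p0]; rewrite ?mul0r ?size_poly0 // size_mulX.
rewrite diff_opE big_ord_recl coefMX eqxx diff_op0 add0r; apply: eq_bigr => k _.
by rewrite coefMX iterSr.
Qed.

Definition lap m (d : 'I_m -> V -> V) (f : V) : V := \sum_i d i (d i f).

Lemma diff_op_quadric m (d : 'I_m -> V -> V) J f : (forall i, linear_on S (d i)) ->
  (forall i j f, S f -> d i (d j f) = d j (d i f)) -> S f ->
  diff_op d (quadric F m ^+ J) f = iter J (lap d) f.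
Proof.
move=> hd hc; elim: J f => [|J IH] f Sf.
  by rewrite expr0 diff_op1.
have Sl : S (lap d f) by apply: S_sum => i; case: (hd i) => h _; apply/h/h.
rewrite iterSr -IH // exprSr /quadric mulr_sumr diff_op_sum.
rewrite /lap -[in RHS](eq_bigr _ (fun i _ => scale1r (d i (d i f)))).
rewrite diff_op_linear_sum //; last by move=> i; case: (hd i) => h _; apply/h/h.
apply: eq_bigr => i _; rewrite scale1r expr2 mulrA !diff_op_var //.
by case: (hd i) => h _; apply: h.
Qed.

(** Apply the rows of [Q *m symbol_mx P = c * q ^ J] to [f], seen as operators:
    read on the left it is [Q] applied to the system, hence zero, and on the
    right it is [c] times the iterated Laplacian. *)
Lemma system_polyharmonic (m n : nat) (d : 'I_m.+2 -> V -> V) (P : 'I_m.+2 -> 'M[F]_n)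
    (Q : 'M[mpol F m.+2]_n) (c : F) (J : nat) (f : 'I_n -> V) :
  (forall i, linear_on S (d i)) ->
  (forall i j g, S g -> d i (d j g) = d j (d i g)) ->
  c != 0 -> Q *m symbol_mx P = (pcst F m.+2 c * quadric F m.+2 ^+ J)%:M ->
  (forall k, S (f k)) ->
  (forall l, \sum_k \sum_i P i l k *: d i (f k) = 0) ->
  forall a, iter J (lap d) (f a) = 0.
Proof.
move=> hd hc c0 hQ Sf hsys a.
have Sd i k : S (d i (f k)) by case: (hd i) => h _; apply: h.
have h1 : \sum_b diff_op d ((Q *m symbol_mx P) a b) (f b) = c *: iter J (lap d) (f a).
  rewrite hQ (bigD1 a) // big1 => [|b ba]; last by rewrite mxE eq_sym (negPf ba) mulr0n diff_op0.
  by rewrite [LHS]addr0 mxE eqxx mulr1n diff_op_cst diff_op_quadric.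
have h2 : \sum_b diff_op d ((Q *m symbol_mx P) a b) (f b) = 0.
  transitivity (\sum_b \sum_l \sum_i P i l b *: diff_op d (Q a l) (d i (f b))).
    apply: eq_bigr => b _; rewrite mxE diff_op_sum; apply: eq_bigr => l _.
    rewrite summxE mulr_sumr diff_op_sum; apply: eq_bigr => i _.
    rewrite !mxE mulrA mulrC diff_op_cst diff_op_var //.
  rewrite exchange_big big1 //= => l _.
  transitivity (diff_op d (Q a l) (\sum_b 1 *: \sum_i P i l b *: d i (f b))).
    rewrite diff_op_linear_sum //.
      by apply: eq_bigr => b _; rewrite scale1r diff_op_linear_sum.
    move=> b; apply: S_sum => i; rewrite -[_ *: _]addr0; exact: SD.
  under eq_bigr => b _ do rewrite scale1r.
  by rewrite hsys (diff_op_zero _ hd).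
apply/eqP; move/eqP: h1; rewrite h2 eq_sym scaler_eq0 (negPf c0).
by [].
Qed.

End ConstantCoefficientOperators.

(** * The Casimir element *)

Section Casimir.
Variables (F : numFieldType) (m n : nat).
Variables (X : 'I_m -> 'I_m -> 'M[F]_n) (P : 'I_m -> 'M[F]_n).

Definition casimir : 'M[F]_n := \sum_j \sum_k X j k *m X j k.

(** The inner product is invariant under orthogonal matrices, in index form. *)
Lemma orth_contract (V : lmodType F) (S : 'M[F]_m) (Y : 'I_m -> 'I_m -> V) :
  S *m S^T = 1%:M ->
  \sum_j \sum_a \sum_c (S a j * S c j) *: Y a c = \sum_a Y a a.
Proof.
move=> SS; rewrite exchange_big /=; apply: eq_bigr => a _.
rewrite exchange_big /= (bigD1 a) //= [X in _ + X]big1 ?addr0 => [|c ca].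
  rewrite -scaler_suml; have /matrixP/(_ a a) := SS.
  rewrite !mxE eqxx mulr1n => e; rewrite -[RHS]scale1r -e; congr (_ *: _).
  by apply: eq_bigr => j _; rewrite mxE.
rewrite -scaler_suml; have /matrixP/(_ a c) := SS.
rewrite !mxE eq_sym (negPf ca) mulr0n => e; rewrite (_ : \sum_i _ = 0) ?scale0r //.
by rewrite -[RHS]e; apply: eq_bigr => j _; rewrite mxE.
Qed.

Lemma casimir_conj (S : 'M[F]_m) (A A' : 'M[F]_n) : S *m S^T = 1%:M -> A' *m A = 1%:M ->
  (forall j k, A *m X j k *m A' = \sum_a \sum_b (S a j * S b k) *: X a b) ->
  A *m casimir *m A' = casimir.
Proof.
move=> SS AA h.
have e1 j k : A *m (X j k *m X j k) *m A' =
    \sum_a \sum_c (S a j * S c j) *: \sum_b \sum_d (S b k * S d k) *: (X a b *m X c d).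
  have -> : A *m (X j k *m X j k) *m A' = (A *m X j k *m A') *m (A *m X j k *m A').
    by rewrite !mulmxA -[_ *m A' *m A]mulmxA AA mulmx1.
  rewrite h mulmx_suml; apply: eq_bigr => a _.
  rewrite mulmx_sumr; apply: eq_bigr => c _.
  rewrite mulmx_suml scaler_sumr; apply: eq_bigr => b _.
  rewrite mulmx_sumr scaler_sumr; apply: eq_bigr => d _.
  rewrite -scalemxAl -scalemxAr !scalerA; congr (_ *: _); ring.
rewrite /casimir mulmx_sumr mulmx_suml.
transitivity (\sum_j \sum_a \sum_c (S a j * S c j) *:
    \sum_k \sum_b \sum_d (S b k * S d k) *: (X a b *m X c d)).
  apply: eq_bigr => j _; rewrite mulmx_sumr mulmx_suml.
  under eq_bigr => k _ do rewrite e1.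
  rewrite exchange_big; apply: eq_bigr => a _.
  rewrite exchange_big; apply: eq_bigr => c _.
  by rewrite -scaler_sumr.
rewrite (orth_contract _ SS); apply: eq_bigr => a _.
by rewrite (orth_contract _ SS).
Qed.

Hypothesis hXN : forall j k, X k j = - X j k.
Hypothesis hXP : forall j k l,
  X j k *m P l - P l *m X j k = (l == j)%:R *: P k - (l == k)%:R *: P j.

(** Expanding the vanishing commutator of [\sum X_jk X_jk] with [P_l] by the
    Leibniz rule gives terms [X_lk P_k] and [P_k X_lk]; reordering the former
    costs multiples of [P_l]. *)
Lemma casimir_relation l : casimir *m P l = P l *m casimir ->
  \sum_k P k *m X l k = ((m%:R - 1) / 2) *: P l.
Proof.
move=> hc.
pose Y j k := (l == j)%:R *: P k - (l == k)%:R *: P j.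
have delta (Z : 'I_m -> 'M[F]_n) : \sum_j (l == j)%:R *: Z j = Z l.
  rewrite (bigD1 l) //= eqxx scale1r big1 ?addr0 // => j /negPf jl.
  by rewrite eq_sym jl scale0r.
have s0 : \sum_j \sum_k ((X j k *m Y j k - Y j k *m X j k) + 2 *: (Y j k *m X j k)) = 0.
  transitivity (casimir *m P l - P l *m casimir); last by rewrite hc subrr.
  rewrite /casimir mulmx_suml mulmx_sumr -sumrB; apply: eq_bigr => j _.
  rewrite mulmx_suml mulmx_sumr -sumrB; apply: eq_bigr => k _.
  rewrite /Y -hXP !mulmxBl !mulmxBr !mulmxA scaler_nat mulr2n.
  move: (_ *m _ *m P l) (_ *m P l *m _) (P l *m _ *m _) => p q t.
  by apply/matrixP => u v; rewrite !mxE; ring.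
have s1 : \sum_j \sum_k Y j k *m X j k = 2 *: \sum_k P k *m X l k.
  transitivity (\sum_j ((l == j)%:R *: (\sum_k P k *m X j k) - P j *m X j l)).
    apply: eq_bigr => j _; rewrite scaler_sumr -(delta (fun k => P j *m X j k)) -sumrB.
    by apply: eq_bigr => k _; rewrite mulmxBl -!scalemxAl.
  rewrite sumrB delta scaler_nat mulr2n; congr (_ + _).
  by rewrite -sumrN; apply: eq_bigr => k _; rewrite (hXN l k) mulmxN opprK.
have s2 : \sum_j \sum_k (X j k *m Y j k - Y j k *m X j k) = - (2 * (m%:R - 1)) *: P l.
  have h1 : \sum_k (X l k *m P k - P k *m X l k) = (1 - m%:R) *: P l.
    under eq_bigr => k _ do rewrite hXP eqxx scale1r eq_sym.
    by rewrite sumrB delta sumr_const card_ord scalerBl scale1r scaler_nat.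
  have h2 : \sum_j (X j l *m P j - P j *m X j l) = (m%:R - 1) *: P l.
    under eq_bigr => k _ do rewrite hXP eqxx scale1r eq_sym.
    by rewrite sumrB delta sumr_const card_ord scalerBl scale1r scaler_nat.
  transitivity (\sum_j ((l == j)%:R *: (\sum_k (X j k *m P k - P k *m X j k))
      - (X j l *m P j - P j *m X j l))).
    apply: eq_bigr => j _; rewrite scaler_sumr.
    rewrite -(delta (fun k => X j k *m P j - P j *m X j k)) -sumrB.
    apply: eq_bigr => k _.
    rewrite mulmxBl mulmxBr -!scalemxAl -!scalemxAr !scalerBr.
    move: (_ *: (_ *m _)) (_ *: (_ *m _)) (_ *: (_ *m _)) (_ *: (_ *m _)) => p q t w.
    by apply/matrixP => u v; rewrite !mxE; ring.
  rewrite sumrB delta h1 h2 -scalerBl; congr (_ *: _); ring.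
have : - (2 * (m%:R - 1)) *: P l + 4 *: \sum_k P k *m X l k = 0.
  rewrite -[RHS]s0 -s2.
  under [RHS]eq_bigr => j _ do rewrite big_split /= -scaler_sumr.
  rewrite big_split /= -scaler_sumr s1 scalerA; congr (_ + _ *: _); ring.
rewrite scaleNr => /eqP; rewrite addrC subr_eq0 => /eqP e.
apply: (scalerI (a := 4)); first by rewrite pnatr_eq0.
by rewrite e scalerA; congr (_ *: _); field.
Qed.

End Casimir.

(** * Symmetry of second derivatives, smooth functions *)

(** The final estimate of [derive_comm], in an abstract field. *)
Lemma quarter_absurd (F : realFieldType) (p q : F) : 0 < p -> 0 < q ->
  p * q <= q / 4 * p + q / 4 * p -> false.
Proof.
move=> p0 q0; have pq := mulr_gt0 p0 q0.
have -> : q / 4 * p + q / 4 * p = p * q / 2 by field.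
by move: pq; move: (p * q) => t; lra.
Qed.

Section Schwarz.
Variables (R : realType) (U : normedModType R).
Implicit Types (f g : U -> R) (x v w p : U).

Lemma is_derive_line f v p (s : R) : differentiable f (s *: v + p) ->
  is_derive s 1 (fun t : R => f (t *: v + p)) ('D_v f (s *: v + p)).
Proof.
move=> df; pose c := fun t : R => t *: v + p.
have dv : differentiable (fun t : R => t *: v) s by apply: differentiableZl.
have dc : differentiable c s by apply: differentiableD.
have cE : 'd c s 1 = v.
  rewrite (diffD dv (differentiable_cst _ _)) /= diffZl //= diff_cst addr0.
  by rewrite -deriveE // derive_id scale1r.
have dfc : differentiable (f \o c) s by apply: differentiable_comp.
have : is_derive s 1 (f \o c) ('D_1 (f \o c) s) by apply/derivableP/diff_derivable.
by move/is_derive_eq; apply; rewrite deriveE // diff_comp //= cE deriveE.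
Qed.

Lemma diff_bound g x (e : R) : differentiable g x -> 0 < e ->
  exists2 d : R, 0 < d & forall y, `|y| < d ->
    `|g (y + x) - g x - 'D_y g x| <= e * `|y|.
Proof.
move=> dg e0; have := diff_locally dg.
move=> /eqaddoP => /(_ e e0) => /nbhs_norm0P [d /= d0 hd]; exists d => // y yd.
have := hd y yd; rewrite /= deriveE // => h.
by rewrite -addrA -opprD.
Qed.

(** Symmetric in [v] and [w]: both mixed derivatives are its limit after division
    by [h ^+ 2]. *)
Definition second_difference f x v w (h : R) : R :=
  f (h *: v + (h *: w + x)) - f (h *: v + x) - f (h *: w + x) + f x.

(** The mean value theorem in the direction [v], followed by the differentiability
    of ['D_v f] at [x]. *)
Lemma second_difference_bound f x v w (e : R) :
  (forall y, differentiable f y) -> differentiable (fun y => 'D_v f y) x -> 0 < e ->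
  exists2 d : R, 0 < d & forall h, 0 < h -> h < d ->
    `|second_difference f x v w h - h ^+ 2 * 'D_w (fun y => 'D_v f y) x| <= e * h ^+ 2.
Proof.
move=> df dg e0; set g := fun y => 'D_v f y.
(* [h * K] bounds the distance from [x] of the points where the derivative is
   compared with its linear approximation, and the sum of both distances. *)
pose K := `|v| + `|w| + `|v| + 1.
have K0 : 0 < K by rewrite ltr_wpDl // !addr_ge0.
have [d d0 hd] := diff_bound dg (divr_gt0 e0 K0).
exists (d / K); first exact: divr_gt0.
move=> h h0 hK.
pose G := fun s : R => f (s *: v + (h *: w + x)) - f (s *: v + x).
have dG (s : R) : is_derive s 1 G (g (s *: v + (h *: w + x)) - g (s *: v + x)).
  by apply: is_deriveB; apply: is_derive_line.
have [s /andP[s0 sh] hs] : exists2 s : R, 0 < s < h &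
    G h - G 0 = (g (s *: v + (h *: w + x)) - g (s *: v + x)) * h.
  have [|c ch hc] := MVT h0 (fun s _ => dG s).
    apply: continuous_subspaceT => s; apply: differentiable_continuous.
    by apply/derivable1_diffP; have [] := dG s.
  by exists c; [move: ch; rewrite in_itv|rewrite hc subr0].
have -> : second_difference f x v w h = G h - G 0.
  rewrite /second_difference /G scale0r !add0r; ring.
rewrite hs.
have bv (y : U) : `|y| <= h * K -> `|y| < d.
  by move=> /le_lt_trans; apply; rewrite -ltr_pdivlMr.
have n1 : `|s *: v + h *: w| <= h * (`|v| + `|w|).
  rewrite mulrDr (le_trans (ler_normD _ _)) // !normrZ (gtr0_norm s0) (gtr0_norm h0).
  by rewrite lerD2r ler_wpM2r // ltW.
have n2 : `|s *: v| <= h * `|v|.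
  by rewrite normrZ (gtr0_norm s0) ler_wpM2r // ltW.
have b1 : `|s *: v + h *: w| < d.
  apply: bv; apply: (le_trans n1); rewrite ler_pM2l // /K -addrA.
  by rewrite lerDl addr_ge0.
have b2 : `|s *: v| < d.
  apply: bv; apply: (le_trans n2); rewrite ler_pM2l // /K -!addrA.
  by rewrite lerDl !addr_ge0.
have h1 := hd _ b1; have h2 := hd _ b2.
rewrite derive_addv // !derive_scalev // in h1; rewrite derive_scalev // in h2.
rewrite -[_ *: v + _ *: w + x]addrA in h1.
move: h1 h2; set A := g _; set B := g (s *: v + x); set Dv := 'D_v g x; set Dw := 'D_w g x.
move=> h1 h2.
have -> : (A - B) * h - h ^+ 2 * Dw =
  h * ((A - g x - (s * Dv + h * Dw)) - (B - g x - s * Dv)) by ring.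
rewrite normrM (gtr0_norm h0) expr2 mulrCA ler_pM2l //.
apply: (le_trans (ler_normB _ _)); apply: (le_trans (lerD h1 h2)).
rewrite -mulrDr; apply: (@le_trans _ _ (e / K * (h * K))).
  rewrite ler_pM2l ?divr_gt0 //; apply: (le_trans (lerD n1 n2)).
  by rewrite -mulrDr ler_pM2l // /K lerDl.
by rewrite mulrCA divfK ?gt_eqF // mulrC.
Qed.

(** Schwarz's theorem under Young's hypotheses: the first derivatives are
    differentiable at [x], without continuity of the second ones. *)
Lemma derive_comm f x v w : (forall y, differentiable f y) ->
  differentiable (fun y => 'D_v f y) x -> differentiable (fun y => 'D_w f y) x ->
  'D_w (fun y => 'D_v f y) x = 'D_v (fun y => 'D_w f y) x.
Proof.
move=> df dv dw; set a := LHS; set b := RHS.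
apply/eqP; rewrite -subr_eq0 -normr_eq0; apply: contraT => ab.
have e0 : 0 < `|a - b| / 4 by rewrite divr_gt0 // lt_def ab normr_ge0.
have [d1 d10 h1] := @second_difference_bound f x v w _ df dv e0.
have [d2 d20 h2] := @second_difference_bound f x w v _ df dw e0.
pose h := Num.min d1 d2 / 2.
have m0 : 0 < Num.min d1 d2 by rewrite lt_min d10.
have hp : 0 < h by rewrite divr_gt0.
have hm : h < Num.min d1 d2 by rewrite /h ltr_pdivrMr // ltr_pMr // ltr1n.
have [hd1 hd2] : h < d1 /\ h < d2 by move: hm; rewrite lt_min => /andP[].
have {}h1 := h1 h hp hd1; have {}h2 := h2 h hp hd2.
have sE : second_difference f x w v h = second_difference f x v w h.
  by rewrite /second_difference addrCA; ring.
rewrite sE in h2; move: h1 h2; rewrite -/a -/b; set S := second_difference _ _ _ _ _.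
move=> h1 h2; have : `|h ^+ 2 * (a - b)| <= `|a - b| / 4 * h ^+ 2 + `|a - b| / 4 * h ^+ 2.
  have -> : h ^+ 2 * (a - b) = (S - h ^+ 2 * b) - (S - h ^+ 2 * a) by ring.
  exact: (le_trans (ler_normB _ _) (lerD h2 h1)).
rewrite normrM (ger0_norm (sqr_ge0 h)).
have ab0 : 0 < `|a - b| by rewrite lt_def ab normr_ge0.
have h20 : 0 < h ^+ 2 by rewrite exprn_gt0.
by move=> hh; apply: quarter_absurd h20 ab0 hh.
Qed.

End Schwarz.

Section SmoothFunctions.
Variables (R : realType) (U : normedModType R).
Local Notation C := (R[i]).
Implicit Types (f g : U -> C) (v w : U).

Lemma ndiff_linear k (f g : U -> R) (a b : R) : ndiff k f -> ndiff k g ->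
  ndiff k (fun x => a * f x + b * g x).
Proof.
elim: k f g => [//|k IH] f g [df hf] [dg hg]; split.
  move=> x; have -> : (fun x => a * f x + b * g x) = a *: f + b *: g by [].
  by apply: differentiableD; apply: differentiableZ.
move=> v; have -> : (fun x => 'D_v (fun x => a * f x + b * g x) x) =
   (fun x => a * 'D_v f x + b * 'D_v g x).
  apply/funext => x.
  have e1 : is_derive x v f ('D_v f x) by apply/derivableP/diff_derivable.
  have e2 : is_derive x v g ('D_v g x) by apply/derivableP/diff_derivable.
  exact: (@derive_val _ _ _ _ _ _ _ (is_deriveD (is_deriveZ a e1) (is_deriveZ b e2))).
exact: IH (hf v) (hg v).
Qed.

Lemma smooth_linear (f g : U -> R) (a b : R) : smooth f -> smooth g ->
  smooth (fun x => a * f x + b * g x).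
Proof. by move=> hf hg k; apply: ndiff_linear. Qed.

Lemma smooth_derive (f : U -> R) v : smooth f -> smooth (fun x => 'D_v f x).
Proof. by move=> hf k; have [_] := hf k.+1; apply. Qed.

Lemma ndiff0 k : ndiff k (fun _ : U => 0 : R).
Proof.
elim: k => [//|k IH]; split; first by move=> x; apply: differentiable_cst.
move=> v; have -> : (fun x : U => 'D_v (fun _ : U => 0 : R) x) = (fun _ => 0) => //.
by apply/funext => x; apply: derive_cst.
Qed.

Lemma smoothC0 : smoothC (0 : U -> C).
Proof. by split => k; apply: ndiff0. Qed.

Lemma smoothC_linear (a : C) f g : smoothC f -> smoothC g -> smoothC (a *: f + g).
Proof.
case=> [f1 f2] [g1 g2]; split.
  have -> : (fun x => complex.Re ((a *: f + g) x)) = (fun x => 1 *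
     (complex.Re a * complex.Re (f x) + - complex.Im a * complex.Im (f x)) + 1 * complex.Re (g x)).
    by apply/funext => x; rewrite /= Re_add Re_mul; ring.
  by apply: smooth_linear => //; apply: smooth_linear.
have -> : (fun x => complex.Im ((a *: f + g) x)) = (fun x => 1 *
   (complex.Re a * complex.Im (f x) + complex.Im a * complex.Re (f x)) + 1 * complex.Im (g x)).
  by apply/funext => x; rewrite /= Im_add Im_mul; ring.
by apply: smooth_linear => //; apply: smooth_linear.
Qed.

Lemma smoothC_derive v f : smoothC f -> smoothC (deriveC v f).
Proof. by case=> f1 f2; split; apply: smooth_derive. Qed.

Lemma deriveC_linear v (a : C) f g : smoothC f -> smoothC g ->
  deriveC v (a *: f + g) = a *: deriveC v f + deriveC v g.
Proof.
case=> [f1 f2] [g1 g2]; apply/funext => x.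
have Df1 := smooth_differentiable f1 x; have Df2 := smooth_differentiable f2 x.
have Dg1 := smooth_differentiable g1 x; have Dg2 := smooth_differentiable g2 x.
have lin (u1 u2 u3 : U -> R) (c1 c2 : R) : differentiable u1 x -> differentiable u2 x ->
   differentiable u3 x ->
   'D_v (fun y => c1 * u1 y + c2 * u2 y + u3 y) x = c1 * 'D_v u1 x + c2 * 'D_v u2 x + 'D_v u3 x.
  move=> d1 d2 d3.
  have e1 : is_derive x v u1 ('D_v u1 x) by apply/derivableP/diff_derivable.
  have e2 : is_derive x v u2 ('D_v u2 x) by apply/derivableP/diff_derivable.
  have e3 : is_derive x v u3 ('D_v u3 x) by apply/derivableP/diff_derivable.
  exact: (@derive_val _ _ _ _ _ _ _
    (is_deriveD (is_deriveD (is_deriveZ c1 e1) (is_deriveZ c2 e2)) e3)).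
apply/eqP; rewrite eq_complex /= Re_add Im_add Re_mul Im_mul /=; apply/andP; split; apply/eqP.
  rewrite -mulNr -lin //; congr ('D_v _ x); apply/funext => y.
  by rewrite /= Re_add Re_mul mulNr.
by rewrite -lin //; congr ('D_v _ x); apply/funext => y; rewrite /= Im_add Im_mul.
Qed.

Lemma smooth_derive_comm (g : U -> R) v w x : smooth g ->
  'D_v (fun y => 'D_w g y) x = 'D_w (fun y => 'D_v g y) x.
Proof.
move=> sg; apply: derive_comm (smooth_differentiable sg) _ _.
  exact: (smooth_differentiable (smooth_derive w sg)).
exact: (smooth_differentiable (smooth_derive v sg)).
Qed.

Lemma deriveC_comm v w f : smoothC f ->
  deriveC v (deriveC w f) = deriveC w (deriveC v f).
Proof.
case=> f1 f2; apply/funext => x.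
rewrite /deriveC /=; apply: f_equal2.
  exact: (smooth_derive_comm v w x f1).
exact: (smooth_derive_comm v w x f2).
Qed.

Lemma deriveC_linear_on v : linear_on (@smoothC R U) (deriveC v).
Proof. by split=> [f|a f g]; [apply: smoothC_derive|apply: deriveC_linear]. Qed.

End SmoothFunctions.

(** * The symbol of an equivariant projection *)

Section VectorOperator.
Variables (R : realType) (m n : nat).
Local Notation C := (R[i]).
Variable rho : cliff R m -> 'M[C]_n.
Variable proj : {linear 'M[C]_(m, n) -> 'cV[C]_n}.

(** The coefficient of the [l]-th partial derivative in the operator [proj \o
    gradient]. *)
Definition symbol_coef (l : 'I_m) : 'M[C]_n := \matrix_(a, k) proj (delta_mx l k) a 0.

Lemma proj_sum (T : 'M[C]_(m, n)) : proj T = \sum_l symbol_coef l *m (row l T)^T.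
Proof.
rewrite [in LHS](matrix_sum_delta T) linear_sum; apply: eq_bigr => l _.
rewrite linear_sum; apply/matrixP => a b; rewrite ord1 summxE mxE.
by apply: eq_bigr => k _; rewrite linearZ !mxE mulrC.
Qed.

(** The contragredient of an orthogonal matrix is the matrix itself, so the
    equivariance of [proj] makes its coefficients transform as the components
    of a vector. *)
Lemma symbol_coef_equivariant s l : Spin s ->
  (forall T, proj (tensor_act rho s T) = rho s *m proj T) ->
  rho s *m symbol_coef l = (\sum_a (spin_vec s a l)%:C%C *: symbol_coef a) *m rho s.
Proof.
move=> Ss h.
have SV : (invmx (spin_vec s))^T = spin_vec s.
  have o := spin_vec_orth Ss; have [u _] := mulmx1_unit o.
  by rewrite -[(invmx _)^T]mul1mx -o -mulmxA -trmx_mul mulVmx // trmx1 mulmx1.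
have colP (z : 'cV[C]_n) : symbol_coef l *m z = proj (delta_mx l 0 *m z^T).
  rewrite proj_sum (bigD1 l) //= [X in _ + X]big1 ?addr0 => [|a al].
    rewrite row_mul rowE mul_delta_mx (_ : delta_mx 0 0 = 1%:M) ?mul1mx ?trmxK //.
    by apply/matrixP => i j; rewrite !ord1 !mxE.
  by rewrite row_mul rowE mul_delta_mx_0 // mul0mx trmx0 mulmx0.
suff hz (z : 'cV[C]_n) : rho s *m symbol_coef l *m z =
    (\sum_a (spin_vec s a l)%:C%C *: symbol_coef a) *m rho s *m z.
  apply/matrixP => i j; have := congr1 (fun v : 'cV[C]_n => v i 0) (hz (delta_mx j 0)).
  by rewrite -!colE !mxE.
rewrite -mulmxA colP -h /tensor_act SV proj_sum.
rewrite -[RHS]mulmxA [RHS]mulmx_suml; apply: eq_bigr => a _.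
rewrite -scalemxAl scalemxAr; congr (_ *m _).
set T := map_mx _ _; have -> : T *m (delta_mx l 0 *m z^T) *m (rho s)^T =
    (T *m delta_mx l 0) *m (rho s *m z)^T by rewrite trmx_mul !mulmxA.
rewrite row_mul (_ : row a _ = (T a l)%:M).
  by rewrite mul_scalar_mx linearZ /= trmxK mxE.
apply/matrixP => i j; rewrite !ord1 [RHS]mxE eqxx mulr1n mxE -colE mxE.
by [].
Qed.

Lemma symbol_coef_eq0 : (forall l, symbol_coef l = 0) -> forall T, proj T = 0.
Proof. by move=> h T; rewrite proj_sum big1 // => l _; rewrite h mul0mx. Qed.

End VectorOperator.

Section Schur.
Variables (R : realType) (m n : nat).
Local Notation C := (R[i]).
Variable rho : cliff R m -> 'M[C]_n.
Hypothesis hirr : spin_irreducible rho.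

(** The common kernel of the [A i] is an invariant subspace, hence zero or
    everything. *)
Lemma irreducible_kernel (I : finType) (A : I -> 'M[C]_n) :
  (forall s (z : 'cV[C]_n), Spin s -> (forall i, A i *m z = 0) -> forall i, A i *m (rho s *m z) = 0) ->
  (forall z : 'cV[C]_n, (forall i, A i *m z = 0) -> z = 0) \/
  (forall i, A i = 0).
Proof.
move=> h; pose U : {vspace 'cV[C]_n} :=
  (\bigcap_(i in I) lker (linfun (mulmx (A i) : 'cV[C]_n -> 'cV[C]_n)))%VS.
have UP z : reflect (forall i, A i *m z = 0) (z \in U).
  rewrite memvE; apply: (iffP (@subv_bigcapP _ _ _ _ _ _)) => hz i.
    by have := hz i isT; rewrite -memvE memv_ker lfunE => /eqP.
  by move=> _; rewrite -memvE memv_ker lfunE; apply/eqP/hz.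
have [_ /(_ U) hU] := hirr.
have st s u : Spin s -> u \in U -> rho s *m u \in U.
  by move=> Ss /UP uU; apply/UP; apply: h.
case: (hU st) => [U0|UT]; first by left=> z /UP; rewrite U0 memv0 => /eqP.
right=> i; apply/matrixP => a b.
have /UP/(_ i) : (delta_mx b 0 : 'cV[C]_n) \in U by rewrite UT memvf.
by rewrite -colE => /colP/(_ a); rewrite !mxE.
Qed.

(** Irreducibility applied to the kernel of [M - a], for an eigenvalue [a]. *)
Lemma schur (M : 'M[C]_n) : (forall s, Spin s -> M *m rho s = rho s *m M) ->
  exists a : C, M = a%:M.
Proof.
move=> hM; have [n0 _] := hirr.
have [rs [rs1 rs0]] := strip_annihilates M.
have z0 : (delta_mx (Ordinal n0) 0 : 'cV[C]_n) != 0.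
  apply/eqP => /colP/(_ (Ordinal n0)); rewrite !mxE !eqxx /= => /eqP.
  by rewrite oner_eq0.
case: rs rs1 rs0 => [_ rs0|a rs rs1 _]; first by case/eqP: z0; apply: (rs0 (delta_mx _ 0)).
have [v v0 hv] := rs1 a (mem_head _ _).
exists a; apply/eqP; rewrite -subr_eq0; apply/eqP.
have [] := @irreducible_kernel unit (fun=> M - a%:M).
- move=> s z Ss hz i; rewrite mulmxA mulmxBl hM // -scalar_mxC -mulmxBr -mulmxA.
  by rewrite hz // mulmx0.
- by move/(_ v) => h; case/eqP: v0; apply: h => _; rewrite mulmxBl mul_scalar_mx hv subrr.
by move/(_ tt).
Qed.

End Schur.

(** * Ellipticity of the higher spin Dirac operator *)

Lemma bracket_diag (F : fieldType) (V : lmodType F) (a b : F) (x y : V) :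
  a *: x - a *: x + b *: y - b *: y = 0.
Proof. by rewrite subrr add0r subrr. Qed.

(** Inverting the equivariance relation with the transposed rotation. *)
Lemma orth_recover (F : fieldType) (m n : nat) (S : 'M[F]_m) (A : 'M[F]_n) (P : 'I_m -> 'M[F]_n) :
  S *m S^T = 1%:M ->
  (forall l, A *m P l = (\sum_a S a l *: P a) *m A) ->
  forall b, P b *m A = \sum_l S b l *: (A *m P l).
Proof.
move=> SS h b; under eq_bigr => l _ do rewrite h mulmx_suml scaler_sumr.
rewrite exchange_big /= (bigD1 b) //= [X in _ + X]big1 ?addr0 => [|a ab].
  under eq_bigr => l _ do rewrite -scalemxAl scalerA.
  rewrite -scaler_suml; have /matrixP/(_ b b) := SS.
  rewrite !mxE eqxx mulr1n => e; rewrite -[LHS]scale1r -e; congr (_ *: _).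
  by apply: eq_bigr => l _; rewrite mxE.
under eq_bigr => l _ do rewrite -scalemxAl scalerA.
rewrite -scaler_suml; have /matrixP/(_ b a) := SS.
rewrite !mxE eq_sym (negPf ab) mulr0n => e; rewrite (_ : \sum_i _ = 0) ?scale0r //.
by rewrite -[RHS]e; apply: eq_bigr => l _; rewrite mxE.
Qed.

Section HigherSpin.
Variables (R : realType) (r n : nat).
Local Notation C := (R[i]).
Local Notation m := (r.*2.+1).
Local Notation ev i := (delta_mx 0 i : 'rV[R]_m).
Variables (lam : 'I_r -> nat) (rho : cliff R m -> 'M[C]_n).
Hypothesis hirrep : spin_irrep lam rho.
Variable proj : {linear 'M[C]_(m, n) -> 'cV[C]_n}.
Hypothesis hproj : summand_projection rho proj.

Let hrho : spin_rep rho. Proof. by case: hirrep. Qed.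
Let hirr : spin_irreducible rho. Proof. by case: hirrep. Qed.
Let hw : spin_highest_weight rho (fun i => (lam i)%:R + 2^-1).
Proof. by case: hirrep. Qed.

Local Notation X := (Xgen rho).
Local Notation P := (symbol_coef proj).
Local Notation ii := (Complex 0 1 : C).

Lemma dirac_equivariant s l : Spin s ->
  rho s *m P l = (\sum_a (spin_vec s a l)%:C%C *: P a) *m rho s.
Proof. by case: hproj => h _ Ss; apply: symbol_coef_equivariant => // T; apply: h. Qed.

Lemma spin_bracket j k a b :
  X j k *m X a b - X a b *m X j k =
  (b == j)%:R *: X a k - (b == k)%:R *: X a j
  + (a == j)%:R *: X k b - (a == k)%:R *: X j b.
Proof.
case: (eqVneq j k) => [<-|jk]; last exact: Xgen_bracket.
rewrite Xgen_diag mul0mx mulmx0 subrr; apply/esym/bracket_diag.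
Qed.

Lemma dirac_bracket j k l :
  X j k *m P l - P l *m X j k = (l == j)%:R *: P k - (l == k)%:R *: P j.
Proof.
case: (eqVneq j k) => [<-|jk]; last by apply: Xgen_vector_bracket => // s l'; apply: dirac_equivariant.
by rewrite Xgen_diag mul0mx mulmx0 subrr; apply/esym/subrr.
Qed.

Definition cxmx (S : 'M[R]_m) : 'M[C]_m := map_mx (real_complex R) S.

Lemma cxmxE (S : 'M[R]_m) a b : cxmx S a b = (S a b)%:C%C.
Proof. by rewrite mxE. Qed.

Lemma cxmx_orth s : Spin s -> cxmx (spin_vec s) *m (cxmx (spin_vec s))^T = 1%:M.
Proof. by move=> Ss; rewrite /cxmx map_trmx -map_mxM spin_vec_orth // map_mx1. Qed.

(** The Casimir element is invariant under conjugation, hence a scalar. *)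
Lemma casimir_symbol_comm l : casimir X *m P l = P l *m casimir X.
Proof.
have [a ->] : exists a : C, casimir X = a%:M; last by rewrite scalar_mxC.
apply: (schur hirr) => s Ss.
have := @casimir_conj C m n X (cxmx (spin_vec s)) (rho s) (rho (cl_conj s))
  (cxmx_orth Ss) (rho_conjl hrho Ss).
move=> h; have {}h : rho s *m casimir X *m rho (cl_conj s) = casimir X.
  apply: h => j k; rewrite Xgen_conj //; apply: eq_bigr => c _; apply: eq_bigr => d _.
  by rewrite !cxmxE -rmorphM.
by rewrite -{1}h -mulmxA (rho_conjl hrho Ss) mulmx1.
Qed.

Lemma dirac_casimir l : \sum_k P k *m X l k = r%:R *: P l.
Proof.
have hXN j k : X k j = - X j k by apply: Xgen_anti.
rewrite (casimir_relation hXN dirac_bracket (casimir_symbol_comm l)).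
congr (_ *: _); rewrite -addn1 natrD addrK -muln2 natrM mulfK //.
Qed.

Lemma ii2 : ii * ii = -1 :> C.
Proof. by apply/eqP; rewrite eq_complex /=; apply/andP; split; apply/eqP; ring. Qed.

(** All weights differ from the highest one by integral combinations of roots, whose
    coordinates are integers. *)
Lemma torus_eigenvalue_half_integral c (v : 'cV[C]_n) (a : C) : v != 0 -> Hgen rho c *m v = a *: v ->
  exists k : int, a = ii * (k%:~R + 2^-1).
Proof.
move=> v0 hv; have [nu wnu ->] := eigenvalue_weight hrho v0 hv.
have [_ /(_ nu wnu)[b hb]] := hw.
exists ((lam c)%:Z - \sum_(k < r) (b k)%:Z * ((c == k)%:Z - (c == k.+1 :> nat)%:Z)).
have e : nu c = ((lam c)%:Z - \sum_(k < r) (b k)%:Z * ((c == k)%:Z - (c == k.+1 :> nat)%:Z))%:~R + 2^-1.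
  rewrite rmorphB rmorph_sum /= (eq_bigr (fun k => (b k)%:R * simple_root R k c)).
    by rewrite -hb; ring.
  by move=> k _; rewrite rmorphM rmorphB.
rewrite {1}e; move: (_ - _) => z.
have -> : (z%:~R + 2^-1 : C) = (z%:~R + 2^-1 : R)%:C%C.
  by rewrite rmorphD rmorph_int fmorphV rmorph_nat.
by apply/eqP; rewrite eq_complex /=; apply/andP; split; apply/eqP; ring.
Qed.

(** [symbol_kernel] puts [z] in the common kernel of the coefficients.  That kernel
    is invariant, so it is zero or all the coefficients vanish; the latter is
    impossible because [proj] has a section. *)
Lemma symbol_injective (z : 'cV[C]_n) : P ord_max *m z = 0 -> z = 0.
Proof.
move=> hz; have hXN j k : X k j = - X j k by apply: Xgen_anti.
have K := @symbol_kernel C ii ii2 r n X P hXN spin_bracket dirac_bracket dirac_casimir torus_eigenvalue_half_integral z hz.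
have st s (w : 'cV[C]_n) : Spin s -> (forall i, P i *m w = 0) ->
    forall i, P i *m (rho s *m w) = 0.
  move=> Ss hw' i; rewrite mulmxA (orth_recover (cxmx_orth Ss)).
    by rewrite mulmx_suml big1 // => l _; rewrite -scalemxAl -mulmxA hw' mulmx0 scaler0.
  by move=> l; rewrite dirac_equivariant //; congr (_ *m _); apply: eq_bigr => a _; rewrite cxmxE.
case: (irreducible_kernel hirr st) => [h|P0]; first exact: h.
have [_ [iota [_ hi]]] := hproj.
by rewrite -(hi z) (symbol_coef_eq0 P0).
Qed.

End HigherSpin.

(** * The determinant of the symbol *)

Lemma mul_reflm_self (R : realType) (m : nat) (u : 'rV[R]_m) :
  unit_vec u -> u *m reflm u = u.
Proof.
rewrite unit_vecE => /eqP u1; rewrite mul_reflm u1.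
by apply/rowP => k; rewrite !mxE; ring.
Qed.

Lemma mul_reflm_orth (R : realType) (m : nat) (u a : 'rV[R]_m) :
  dotv u a = 0 -> u *m reflm a = - u.
Proof. by move=> h; rewrite mul_reflm h mulr0 scale0r sub0r. Qed.

Section SymbolDeterminant.
Variables (R : realType) (r n : nat).
Local Notation C := (R[i]).
Local Notation m := (r.+1.*2.+1).
Local Notation M := (r.*2.+1).+2.
Local Notation ev i := (delta_mx 0 i : 'rV[R]_m).
Variables (lam : 'I_r.+1 -> nat) (rho : cliff R m -> 'M[C]_n).
Hypothesis hirrep : spin_irrep lam rho.
Variable proj : {linear 'M[C]_(m, n) -> 'cV[C]_n}.
Hypothesis hproj : summand_projection rho proj.

Let hrho : spin_rep rho. Proof. by case: hirrep. Qed.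

Definition dirac_symbol (x : 'I_m -> C) : 'M[C]_n := @symbol C r.*2.+1 n (symbol_coef proj) x.
Definition complexify (u : 'rV[R]_m) : 'I_m -> C := fun i => (u 0 i)%:C%C.
Definition mxact (S : 'M[R]_m) (x : 'I_m -> C) : 'I_m -> C :=
  fun i => \sum_k cxmx S i k * x k.

Lemma dirac_symbol_equivariant s (x : 'I_m -> C) : Spin s ->
  rho s *m dirac_symbol x = dirac_symbol (mxact (spin_vec s) x) *m rho s.
Proof.
move=> Ss; rewrite /dirac_symbol /symbol mulmx_sumr.
transitivity (\sum_i x i *: ((\sum_a cxmx (spin_vec s) a i *: symbol_coef proj a) *m rho s)).
  apply: eq_bigr => i _; rewrite -scalemxAr (dirac_equivariant hproj) //.
  by congr (_ *: (_ *m _)); apply: eq_bigr => a _; rewrite cxmxE.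
under eq_bigr => i _ do rewrite scalemxAl scaler_sumr.
rewrite -mulmx_suml exchange_big /=; congr (_ *m _); apply: eq_bigr => a _.
rewrite /mxact scaler_suml; apply: eq_bigr => i _.
by rewrite scalerA mulrC.
Qed.

Lemma mxact_complexify S u : mxact S (complexify u) = complexify (u *m S^T).
Proof.
apply/funext => i; rewrite /mxact /complexify mxE rmorph_sum; apply: eq_bigr => k _.
by rewrite cxmxE mxE -rmorphM mulrC.
Qed.

Lemma dirac_symbol_ev k : dirac_symbol (complexify (ev k)) = symbol_coef proj k.
Proof.
rewrite /dirac_symbol /symbol (bigD1 k) //= [X in _ + X]big1 ?addr0 => [|i /negPf ik].
  by rewrite /complexify mxE !eqxx scale1r.
by rewrite /complexify mxE ik andbF scale0r.
Qed.

Lemma dirac_symbolZ t x : dirac_symbol (fun i => t * x i) = t *: dirac_symbol x.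
Proof. exact: symbolZ. Qed.

Lemma dirac_symbol_realZ (t : R) u : dirac_symbol (complexify (t *: u)) = t%:C%C *: dirac_symbol (complexify u).
Proof.
rewrite -dirac_symbolZ; congr dirac_symbol; apply/funext => i.
by rewrite /complexify mxE rmorphM.
Qed.

(** The determinant is invariant under rotations.  The square removes the sign
    coming from a product of two reflections that maps the last basis vector to
    [- u]. *)
Lemma det_dirac_symbol_unit u : unit_vec u ->
  \det (dirac_symbol (complexify u)) ^+ 2 = \det (symbol_coef proj ord_max) ^+ 2.
Proof.
move=> u1; case: (eqVneq (ev ord_max) u) => [<-|eu]; first by rewrite dirac_symbol_ev.
have [a1 ea _] := @reflm_swap R m (ev ord_max) u 0 (unit_ev _ _) u1 eu.
(* The second factor fixes the last basis vector, the first one sends it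
   to [- u]. *)
set a := (_ *: _) in a1 ea.
have Ss := Spin_pair a1 (unit_ev R (ord_max : 'I_m)).
have := dirac_symbol_equivariant (complexify (ev ord_max)) Ss.
rewrite mxact_complexify spin_vec_pair ?unit_ev // trmx_mul !reflm_tr mulmxA.
rewrite (mul_reflm_self (unit_ev _ _)) ea dirac_symbol_ev.
rewrite -[- u]scaleN1r dirac_symbol_realZ => /(congr1 determinant).
rewrite !det_mulmx detZ mulrC => /mulIf e.
have dr : \det (rho (cl_mul (cl_vec a) (cl_vec (ev ord_max)))) != 0.
  have := rho_conjr hrho Ss => /(congr1 determinant); rewrite det_mulmx det1 => h.
  by apply/eqP => d0; move: h; rewrite d0 mul0r => /eqP; rewrite eq_sym oner_eq0.
rewrite (e dr) exprMn exprAC (_ : ((-1)%:C)%C = -1); last by rewrite rmorphN rmorph1.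
by rewrite sqrrN !expr1n mul1r.
Qed.

Definition det_const : C := \det (symbol_coef proj ord_max) ^+ 2.

Lemma det_const_neq0 : det_const != 0.
Proof.
rewrite /det_const expf_neq0 // -det_tr; apply/negP => /det0P[v v0 hv].
have : v^T = 0.
  apply: (symbol_injective hirrep hproj); apply: (can_inj (@trmxK _ _ _)).
  by rewrite trmx_mul trmxK hv trmx0.
by move/(congr1 trmx); rewrite trmxK trmx0 => e; rewrite e eqxx in v0.
Qed.

Lemma qf_complexify u : @qf C r.*2.+1 (complexify u) = (dotv u u)%:C%C.
Proof.
rewrite /qf /dotv rmorph_sum; apply: eq_bigr => i _.
by rewrite /complexify expr2 -rmorphM.
Qed.

Lemma det0n0 k : (0 < k)%N -> \det (0 : 'M[C]_k) = 0.
Proof. by case: k => // k _; rewrite det0. Qed.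

Lemma dotv_eq0 (u : 'rV[R]_m) : dotv u u = 0 -> u = 0.
Proof.
move=> h; apply/rowP => i; rewrite mxE.
have pos (j : 'I_m) : true -> 0 <= u 0 j * u 0 j by rewrite -expr2 sqr_ge0.
have := psumr_eq0P pos h (isT : xpredT i).
by rewrite -expr2 => /eqP; rewrite sqrf_eq0 => /eqP.
Qed.

Let symM : 'M[mpol C M]_n := @symbol_mx C r.*2.+1 n (symbol_coef proj).

(** By homogeneity the determinant is determined by its values on the unit sphere. *)
Lemma det_symbol_mx :
  \det symM ^+ 2 = pcst C M det_const * quadric C M ^+ n.
Proof.
have [n0 _] : spin_irreducible rho by case: hirrep.
apply: det_symbol_mx_quadric => x.
pose w : 'rV[R]_m := \row_i (x i)%:R.
have -> : (fun i : 'I_M => (x i)%:R) = complexify w.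
  by apply/funext => i; rewrite /complexify mxE rmorph_nat.
rewrite qf_complexify -/(dirac_symbol (complexify w)).
have [q0|qn] := eqVneq (dotv w w) 0.
  have -> : dirac_symbol (complexify w) = 0.
    have -> : w = 0 *: w by rewrite scale0r; apply: dotv_eq0.
    by rewrite dirac_symbol_realZ rmorph0 scale0r.
  by rewrite q0 rmorph0 det0n0 // !expr0n /= eqn0Ngt n0 mulr0.
have qp : 0 < dotv w w by rewrite lt_def qn; apply: sumr_ge0 => i _; rewrite -expr2 sqr_ge0.
pose t := Num.sqrt (dotv w w); have t0 : 0 < t by rewrite sqrtr_gt0.
have tt : t ^+ 2 = dotv w w by rewrite sqr_sqrtr // ltW.
have u1 : unit_vec (t^-1 *: w).
  rewrite unit_vecE dotvZl dotvC dotvZl mulrA -tt -invfM -expr2 mulVf //.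
  by rewrite expf_neq0 // gt_eqF.
have wE : w = t *: (t^-1 *: w) by rewrite scalerA mulfV ?scale1r // gt_eqF.
rewrite {1}wE.
rewrite dirac_symbol_realZ detZ exprMn (det_dirac_symbol_unit u1) mulrC -/det_const; congr (_ * _).
by rewrite exprAC -rmorphXn tt.
Qed.

End SymbolDeterminant.

(** * Vanishing on the null cone *)

Lemma cder_exp (R : realType) (F : R -> R[i]) t d k :
  cder F t d -> cder (fun s => F s ^+ k.+1) t (k.+1%:R * F t ^+ k * d).
Proof.
move=> h; elim: k => [|k IH]; first by rewrite expr0 !mul1r.
have e s : F s * F s ^+ k.+1 = F s ^+ k.+2 by rewrite -exprS.
apply: (cder_ext e); apply: (cder_eq (cder_mul h IH)).
by rewrite -[in RHS]natr1 exprS; ring.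
Qed.

Lemma orth_qf (F : numFieldType) (m : nat) (S : 'M[F]_m.+2) (x : 'I_m.+2 -> F) :
  S *m S^T = 1%:M -> qf (fun i => \sum_k S i k * x k) = qf x.
Proof.
move=> /mulmx1C SS; rewrite /qf.
transitivity (\sum_i \sum_k \sum_l (S i k * S i l) * (x k * x l)).
  apply: eq_bigr => i _; rewrite expr2 mulr_suml; apply: eq_bigr => k _.
  by rewrite mulr_sumr; apply: eq_bigr => l _; ring.
rewrite exchange_big /=; apply: eq_bigr => k _; rewrite exchange_big /=.
rewrite (bigD1 k) //= [X in _ + X]big1 ?addr0 => [|l lk].
  rewrite -mulr_suml; have /matrixP/(_ k k) := SS.
  rewrite !mxE eqxx mulr1n => e; rewrite -expr2 -[RHS]mul1r -e; congr (_ * _).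
  by apply: eq_bigr => i _; rewrite mxE.
rewrite -mulr_suml; have /matrixP/(_ k l) := SS.
rewrite !mxE eq_sym (negPf lk) mulr0n => e; rewrite (_ : \sum_i _ = 0) ?mul0r //.
by rewrite -[RHS]e; apply: eq_bigr => i _; rewrite mxE.
Qed.

Lemma natr_mul_im (R : realType) (k : nat) (y : R) :
  (k%:R : R[i]) * Complex 0 y = Complex 0 (k%:R * y).
Proof.
rewrite -(rmorph_nat (real_complex R) k) /=.
by apply/eqP; rewrite eq_complex /=; apply/andP; split; apply/eqP; ring.
Qed.

Section NullCone.
Variables (R : realType) (r n : nat).
Local Notation C := (R[i]).
Local Notation m := (r.+1.*2.+1).
Local Notation M := (r.*2.+1).+2.
Local Notation ev i := (delta_mx 0 i : 'rV[R]_m).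
Local Notation ii := (Complex 0 1 : C).
Variables (lam : 'I_r.+1 -> nat) (rho : cliff R m -> 'M[C]_n).
Hypothesis hirrep : spin_irrep lam rho.
Variable proj : {linear 'M[C]_(m, n) -> 'cV[C]_n}.
Hypothesis hproj : summand_projection rho proj.

Let hrho : spin_rep rho. Proof. by case: hirrep. Qed.
Let hw : spin_highest_weight rho (fun i => (lam i)%:R + 2^-1).
Proof. by case: hirrep. Qed.

Lemma ev_row_spin_vec (S : 'M[R]_m) (j k : 'I_m) (c : R) :
  ev j *m S^T = c *: ev k -> forall a, S a j = c * (a == k)%:R.
Proof.
move=> h a; have /rowP/(_ a) := h; rewrite -rowE.
by rewrite [row j S^T _ _]mxE [S^T _ _]mxE => ->; rewrite !mxE eqxx.
Qed.

(** Among the simple roots only [epsilon_1 - epsilon_2] (or [epsilon_1] in rank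
    one) involves the first coordinate, and with a positive coefficient. *)
Lemma weight_upper nu : spin_weight rho nu -> nu ord0 <= (lam ord0)%:R + 2^-1.
Proof.
move=> wnu; have [_ /(_ nu wnu)[b /(_ ord0) hb]] := hw.
rewrite -subr_ge0 hb; apply: sumr_ge0 => k _; rewrite mulr_ge0 //.
by rewrite /simple_root /= subr0.
Qed.

Local Notation x0 := (ix0 (ord0 : 'I_r.+1)).
Local Notation x1 := (ix1 (ord0 : 'I_r.+1)).

Let ne01 : x0 != x1. Proof. by rewrite ix01. Qed.

(** The bound from below comes from the bound from above by a Weyl group element:
    the lift of a rotation by [pi] that negates one vector of the first
    coordinate plane. *)
Lemma Hgen_eigen_bound (v : 'cV[C]_n) (a : C) : v != 0 -> Hgen rho ord0 *m v = a *: v ->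
  exists2 nu : R, a = Complex 0 nu & `|nu| <= (lam ord0)%:R + 2^-1.
Proof.
move=> v0 hv; have [nu wnu e] := eigenvalue_weight hrho v0 hv.
exists (nu ord0) => //; rewrite ler_norml weight_upper // andbT.
(* [s] negates [e_x0] twice and [e_x1] once, so it reverses the rotations of
   this plane. *)
pose s := cl_mul (cl_vec (ev x1)) (cl_vec (ev (ord_max : 'I_m))).
have Ss : Spin s by apply: Spin_pair; apply: unit_ev.
have S0 : ev x0 *m (spin_vec s)^T = 1 *: ev x0.
  rewrite spin_vec_pair ?unit_ev // trmx_mul !reflm_tr mulmxA.
  rewrite (mul_reflm_orth (a := ev ord_max)) ?dotv_ev ?ix0m // mulNmx.
  by rewrite mul_reflm_orth ?opprK ?scale1r // dotv_ev ix01.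
have S1 : ev x1 *m (spin_vec s)^T = (-1) *: ev x1.
  rewrite spin_vec_pair ?unit_ev // trmx_mul !reflm_tr mulmxA.
  rewrite (mul_reflm_orth (a := ev ord_max)) ?dotv_ev ?ix1m // mulNmx.
  by rewrite (mul_reflm_self (unit_ev _ _)) scaleN1r.
have hc : rho s *m Hgen rho ord0 *m rho (cl_conj s) = - Hgen rho ord0.
  rewrite /Hgen Xgen_conj // (bigD1 x0) //= [X in _ + X]big1 ?addr0 => [|a' na]; last first.
    by apply: big1 => b _; rewrite (ev_row_spin_vec S0) (negPf na) mulr0 mul0r scale0r.
  rewrite (bigD1 x1) //= [X in _ + X]big1 ?addr0 => [|b nb]; last first.
    by rewrite (ev_row_spin_vec S1) (negPf nb) !mulr0 scale0r.
  rewrite (ev_row_spin_vec S0) (ev_row_spin_vec S1) !eqxx !mulr1 mul1r.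
  by rewrite rmorphN rmorph1 scaleN1r.
pose w := rho s *m v.
have vw : v = rho (cl_conj s) *m w by rewrite mulmxA rho_conjl // mul1mx.
have w0 : w != 0 by apply: contra v0 => /eqP w0; rewrite vw w0 mulmx0.
have hw' : Hgen rho ord0 *m w = - a *: w.
  have e1 : rho s *m Hgen rho ord0 *m rho (cl_conj s) *m w = a *: w.
    by rewrite -(mulmxA _ (rho (cl_conj s))) -vw -mulmxA hv -scalemxAr.
  by rewrite scaleNr -e1 hc mulNmx opprK.
have [nu' wnu' e'] := eigenvalue_weight hrho w0 hw'.
have : nu' ord0 = - nu ord0 by move: e'; rewrite e => -[].
by move=> e2; have := weight_upper wnu'; rewrite e2 lerNl.
Qed.

(** The null vector [e_1 + sigma i e_0], for [sigma = 1] or [-1]. *)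
Definition zeta0 (sigma : R) : 'I_m -> C :=
  fun i => complexify (ev x1) i + Complex 0 sigma * complexify (ev x0) i.

Lemma complexify_ev (k i : 'I_m) : complexify (ev k) i = (i == k)%:R.
Proof. by rewrite /complexify mxE eqxx rmorph_nat. Qed.

Lemma mxact_zeta0 (S : 'M[R]_m) sigma i :
  mxact S (zeta0 sigma) i = (S i x1)%:C%C + Complex 0 sigma * (S i x0)%:C%C.
Proof.
have h k : \sum_j cxmx S i j * complexify (ev k) j = (S i k)%:C%C.
  rewrite (bigD1 k) //= [X in _ + X]big1 ?addr0 => [|j jk].
    by rewrite cxmxE complexify_ev eqxx mulr1.
  by rewrite complexify_ev (negPf jk) mulr0.
rewrite /mxact -!h mulr_sumr -big_split /=; apply: eq_bigr => j _.
by rewrite /zeta0 mulrDr mulrCA.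
Qed.

Definition rot01 (th : R) : 'M[R]_m := spin_vec (spin_rot x0 x1 th).
(** The character through which the rotations of the first coordinate plane act
    on its null vector. *)
Definition rot_char (sigma th : R) : C :=
  (rot01 th x1 x1)%:C%C + Complex 0 sigma * (rot01 th x1 x0)%:C%C.

Lemma half_vec01 (th : R) i : half_vec x0 x1 th 0 i =
  cos (th / 2) * (i == x0)%:R + sin (th / 2) * (i == x1)%:R.
Proof. by rewrite /half_vec !mxE eqxx. Qed.

Lemma rot01_zeta0 sigma th : sigma * sigma = 1 ->
  mxact (rot01 th) (zeta0 sigma) = (fun i => rot_char sigma th * zeta0 sigma i).
Proof.
move=> s2; apply/funext => i; rewrite mxact_zeta0 /rot_char /zeta0 !complexify_ev.
rewrite /rot01 !spin_vec_rot_entry ?ix01 // !half_vec01.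
rewrite !(ix10, ix01) !eqxx.
have := cos2Dsin2 (th / 2); move: (cos (th / 2)) (sin (th / 2)) => c s cs.
have [->|i0] := eqVneq i x0.
  rewrite ix01 !mulr1n !mulr0n; apply/eqP; rewrite eq_complex /=.
  apply/andP; split; apply/eqP; last first.
    apply: subr0_eq; transitivity (2 * sigma * (c ^+ 2 + s ^+ 2 - 1)); first ring.
    by rewrite cs subrr mulr0.
  transitivity (- (2 * c * s) * (sigma * sigma)); last ring.
  by rewrite s2; ring.
have [_|_] := eqVneq i x1.
  by rewrite !mulr1n !mulr0n; apply/eqP; rewrite eq_complex /=; apply/andP; split; apply/eqP; ring.
by rewrite !mulr0n; apply/eqP; rewrite eq_complex /=; apply/andP; split; apply/eqP; ring.
Qed.

Lemma rot_char_neq0 sigma th : sigma * sigma = 1 -> rot_char sigma th != 0.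
Proof.
move=> s2; rewrite /rot_char /rot01 !spin_vec_rot_entry ?ix01 // !half_vec01.
rewrite !(ix10, ix01) !eqxx.
have := cos2Dsin2 (th / 2); move: (cos (th / 2)) (sin (th / 2)) => c s cs.
apply/negP; rewrite eq_complex /= => /andP[/eqP h1 /eqP h2].
have e1 : 1 - 2 * s ^+ 2 = 0 by rewrite -[RHS]h1; ring.
have e2 : sigma * (2 * c * s) = 0 by rewrite -[RHS]h2; ring.
have e3 : 2 * c * s = 0.
  transitivity (sigma * (sigma * (2 * c * s))); first by rewrite mulrA s2 mul1r.
  by rewrite e2 mulr0.
have : (1 - 2 * s ^+ 2) ^+ 2 + (2 * c * s) ^+ 2 = 1.
  transitivity (1 - 4 * s ^+ 2 + 4 * s ^+ 2 * (c ^+ 2 + s ^+ 2)); first ring.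
  by rewrite cs; ring.
by rewrite e1 e3 expr0n addr0 => /eqP; rewrite eq_sym oner_eq0.
Qed.

Lemma rot_char0 sigma : rot_char sigma 0 = 1.
Proof.
rewrite /rot_char /rot01 spin_vec_rot0 !mxE eqxx ix10.
by rewrite mulr1n mulr0n rmorph0 mulr0 addr0 rmorph1.
Qed.

Lemma rot_char_der sigma : cder (rot_char sigma) 0 (Complex 0 sigma).
Proof.
apply: (cder_eq (cder_add (spin_vec_rot_der R x1 x1 ne01)
   (cder_mul (cder_cst (Complex 0 sigma) 0) (spin_vec_rot_der R x1 x0 ne01)))).
rewrite /Lrot !eqxx ix10 !(ix01, ix10) !mulr0n !mulr1n.
by apply/eqP; rewrite eq_complex /=; apply/andP; split; apply/eqP; ring.
Qed.

Section Vanishing.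
Variables (B : 'M[mpol C M]_n) (c : C) (j : nat).
Hypotheses (c0 : c != 0) (hj : (lam ord0 + 1 < j)%N)
  (hB : B *m @symbol_mx C r.*2.+1 n (symbol_coef proj) = (pcst C M c * quadric C M ^+ j)%:M).

Let quot_at (x : 'I_m -> C) : 'M[C]_n := @quot C r.*2.+1 n B x.
Let N := j.*2.-1.

Lemma quot_at_equivariant s x : Spin s ->
  rho s *m quot_at x = quot_at (mxact (spin_vec s) x) *m rho s.
Proof.
move=> Ss; apply: (quot_equivariant c0 hB) => y.
  exact: (dirac_symbol_equivariant hproj y Ss).
exact: (@orth_qf C r.*2.+1 (cxmx (spin_vec s)) y (cxmx_orth Ss)).
Qed.

Lemma quot_at_homogeneous t x : t != 0 -> quot_at (fun i => t * x i) = t ^+ N *: quot_at x.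
Proof. by move=> t0; apply: (quot_homogeneous c0 hB) => //; lia. Qed.

(** Differentiating the equivariance along the rotations of the first coordinate
    plane gives [H B = B (H + (2 j - 1) sigma i)].  The eigenvalues of [H] have
    modulus at most [lam ord0 + 1/2], and [2 j - 1] exceeds twice this bound. *)
Lemma quot_at_zeta0 sigma : sigma = 1 \/ sigma = -1 -> quot_at (zeta0 sigma) = 0.
Proof.
move=> hs; have s2 : sigma * sigma = 1 by case: hs => ->; ring.
set b := quot_at (zeta0 sigma).
have h th : rho (spin_rot x0 x1 th) *m b = rot_char sigma th ^+ N *: (b *m rho (spin_rot x0 x1 th)).
  rewrite /b quot_at_equivariant; last exact: Spin_rot.
  rewrite -/(rot01 th) rot01_zeta0 // quot_at_homogeneous ?rot_char_neq0 //.
  by rewrite scalemxAl.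
have NE : N = N.-1.+1 by rewrite /N; lia.
have d1 := mxder_mul (gen_rot hrho ne01) (mxder_cst b 0).
have d2 := mxder_scale (cder_exp N.-1 (rot_char_der sigma)) (mxder_mul (mxder_cst b 0) (gen_rot hrho ne01)).
have h' th : rot_char sigma th ^+ N.-1.+1 *: (b *m rho (spin_rot x0 x1 th)) =
    rho (spin_rot x0 x1 th) *m b by rewrite -NE h.
have e := mxder_uniq d1 (mxder_ext h' d2).
apply: (@sylvester_eq0 C n (Hgen rho ord0) b (N%:R * Complex 0 sigma)).
  move: e; rewrite -/(Hgen rho ord0) mulmx0 addr0 mul0mx add0r spin_rot0 (rho1 hrho) mulmx1.
  rewrite rot_char0 !expr1n scale1r mulr1 -NE => ->.
  by rewrite mulmxDr mul_mx_scalar addrC.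
move=> a v v0 hv w w0 hw'.
have [nu ae] := Hgen_eigen_bound v0 hv; have [nu' ae'] := Hgen_eigen_bound w0 hw'.
have nE : N%:R * Complex 0 sigma = Complex 0 (N%:R * sigma) :> C.
  exact: natr_mul_im.
have nuE : nu' = nu - N%:R * sigma.
  by have := congr1 (@complex.Im R) ae'; rewrite nE ae /=.
have hN : 2 * (lam ord0)%:R + 3 <= (N%:R : R).
  rewrite -natrM -natrD ler_nat /N; lia.
rewrite !ler_norml nuE => /andP[h1 h2] /andP[h3 h4].
move: (N%:R : R) (lam ord0)%:R h1 h2 h3 h4 hN => k l.
by case: hs => ->; lra.
Qed.

(** The point is a multiple of [u + sigma i e_0] with [u] a real unit vector
    orthogonal to [e_0], hence in the orbit of [zeta0], up to scaling. *)
Lemma quot_at_null (x : 'I_(r.*2.+2) -> nat) (s : C) :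
  \sum_i ((x i)%:R : C) ^+ 2 != 0 -> s ^+ 2 = - \sum_i (x i)%:R ^+ 2 ->
  quot_at (cons_pt s (fun i => (x i)%:R)) = 0.
Proof.
move=> nz s2.
pose q : R := \sum_i (x i)%:R ^+ 2.
have qE : \sum_i ((x i)%:R : C) ^+ 2 = q%:C%C.
  rewrite /q rmorph_sum; apply: eq_bigr => i _.
  by rewrite rmorphXn rmorph_nat.
have q0 : 0 < q.
  rewrite lt_def; apply/andP; split; last by apply: sumr_ge0 => i _; rewrite sqr_ge0.
  by apply: contra nz => /eqP h; rewrite qE h rmorph0.
pose t := Num.sqrt q; have t0 : 0 < t by rewrite sqrtr_gt0.
have tt : t ^+ 2 = q by rewrite sqr_sqrtr // ltW.
have [sigma hs sE] : exists2 sigma : R, sigma = 1 \/ sigma = -1 & s = Complex 0 (sigma * t).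
  have : s ^+ 2 = (Complex 0 t) ^+ 2.
    rewrite s2 qE -tt; apply/eqP; rewrite eq_complex /=; apply/andP; split; apply/eqP; ring.
  move/eqP; rewrite eqf_sqr => /orP[] /eqP ->; [exists 1|exists (-1)]; try by [left|right].
    by rewrite mul1r.
  by rewrite mulN1r; apply/eqP; rewrite eq_complex /= oppr0 !eqxx.
pose u : 'rV[R]_m := \row_i (if unlift (ord0 : 'I_M) i is Some k then t^-1 * (x k)%:R else 0).
have x00 : x0 = ord0 by apply/val_inj; rewrite /= val_ix0.
have uu : dotv u u = 1.
  rewrite /dotv (@big_ord_recl _ _ _ r.*2.+2) /= !mxE unlift_none mulr0 add0r.
  transitivity (t^-1 ^+ 2 * q).
    rewrite /q mulr_sumr; apply: eq_bigr => i _; rewrite !mxE liftK; ring.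
  by rewrite exprVn tt mulVf // gt_eqF.
have u0 : dotv u (ev x0) = 0.
  rewrite /dotv big1 // => i _; rewrite !mxE eqxx /=.
  case: eqP => [->|_]; last by rewrite mulr0.
  by rewrite x00 unlift_none mul0r.
have ptE i : cons_pt s (fun i => (x i)%:R) i = t%:C%C * (complexify u i + Complex 0 sigma * complexify (ev x0) i).
  rewrite complexify_ev /cons_pt /complexify mxE x00; case: unliftP => [k ->|->].
    rewrite eq_sym (negPf (neq_lift _ _)) mulr0n mulr0 addr0 -rmorphM mulrA mulfV ?gt_eqF //.
    by rewrite mul1r rmorph_nat.
  rewrite eqxx mulr1n sE; apply/eqP; rewrite eq_complex /=; apply/andP; split; apply/eqP; ring.
have t0C : t%:C%C != 0 :> C by rewrite eq_complex /= gt_eqF.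
have unit_u : unit_vec u by rewrite unit_vecE uu.
(* If [u] is [e_x1] there is nothing to move.  Otherwise the product of two
   reflections fixes [e_x0] and sends [e_x1] to [- u], which replaces [sigma]
   by [- sigma]. *)
have [eu|eu] := eqVneq (ev x1) u.
  rewrite (_ : cons_pt _ _ = (fun i => t%:C%C * zeta0 sigma i)); last first.
    by apply/funext => i; rewrite ptE -eu.
  by rewrite quot_at_homogeneous // quot_at_zeta0 // scaler0.
have [a1 ea ha] := @reflm_swap R m (ev x1) u (ev x0) (unit_ev _ _) unit_u eu.
set a := (_ *: _) in a1 ea ha.
have {}ha : ev x0 *m reflm a = - ev x0 by apply: ha; rewrite u0 dotv_ev ix10.
pose g := cl_mul (cl_vec a) (cl_vec (ev x1)).
have Sg : Spin g by apply: Spin_pair => //; apply: unit_ev.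
have SE w : w *m (spin_vec g)^T = w *m reflm (ev x1) *m reflm a.
  by rewrite spin_vec_pair ?unit_ev // trmx_mul !reflm_tr mulmxA.
have gz : (fun i => (- t%:C%C) * mxact (spin_vec g) (zeta0 (- sigma)) i) =
   cons_pt s (fun i => (x i)%:R).
  apply/funext => i; rewrite ptE.
  have -> : mxact (spin_vec g) (zeta0 (- sigma)) i =
     mxact (spin_vec g) (complexify (ev x1)) i + Complex 0 (- sigma) * mxact (spin_vec g) (complexify (ev x0)) i.
    rewrite /mxact mulr_sumr -big_split /=; apply: eq_bigr => k _.
    by rewrite /zeta0 mulrDr mulrCA.
  rewrite !mxact_complexify !SE (mul_reflm_self (unit_ev _ _)) ea.
  rewrite (mul_reflm_orth (a := ev x1)) ?dotv_ev ?ix01 // mulNmx ha opprK.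
  rewrite /complexify [(- u) 0 i]mxE.
  by apply/eqP; rewrite eq_complex /=; apply/andP; split; apply/eqP; ring.
rewrite -gz quot_at_homogeneous ?oppr_eq0 //.
have := quot_at_equivariant (zeta0 (- sigma)) Sg.
rewrite quot_at_zeta0; last by case: hs => ->; rewrite ?opprK; [right|left].
rewrite mulmx0 => /(congr1 (fun A => A *m rho (cl_conj g))).
by rewrite mul0mx -mulmxA (rho_conjr hrho Sg) mulmx1 => <-; rewrite scaler0.
Qed.
End Vanishing.

(** The descent starts from the adjugate matrix: [(\det P) adj P] times [P] is
    [(\det P) ^ 2], a multiple of [q ^ n]. *)
Theorem symbol_divides : exists2 c : C, c != 0 &
  exists Q : 'M[mpol C M]_n, Q *m @symbol_mx C r.*2.+1 n (symbol_coef proj) =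
    (pcst C M c * quadric C M ^+ (lam ord0).+1)%:M.
Proof.
exists (det_const proj); first exact: (det_const_neq0 hirrep hproj).
have d2 := det_symbol_mx hirrep hproj.
set S := symbol_mx _ in d2 *.
have hB : (\det S *: \adj S) *m S =
    (pcst C M (det_const proj) * quadric C M ^+ n)%:M.
  by rewrite -scalemxAl mul_adj_mx -d2 expr2 -mul_scalar_mx -scalar_mxM.
apply: (quotient_descent (det_const_neq0 hirrep hproj) _ _ hB).
  move=> a a0; exists (ii * sqrtC a); rewrite exprMn sqrtCK expr2.
  by rewrite (ii2 R) mulN1r.
move=> B j hj hBj x s nz hs; apply: (quot_at_null (det_const_neq0 hirrep hproj) _ hBj nz hs).
by rewrite addn1.
Qed.

End NullCone.

(** * Components of fields *)

Section Components.
Variables (R : realType) (m n : nat).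
Local Notation C := (R[i]).
Local Notation U := ('rV[R]_m).

Definition component (f : U -> 'cV[C]_n) (k : 'I_n) : U -> C := fun x => f x k 0.

Definition pd (i : 'I_m) : (U -> C) -> (U -> C) := deriveC (delta_mx 0 i : U).

Lemma partial_component i f k x : partial i f x k 0 = pd i (component f k) x.
Proof. by rewrite mxE. Qed.

Lemma laplacian_component f k : component (laplacian f) k = lap pd (component f k).
Proof.
apply/funext => x; rewrite /component /laplacian /lap summxE fct_sumE.
apply: eq_bigr => i _; rewrite partial_component; congr (pd i _ x).
by apply/funext => y; rewrite /component partial_component.
Qed.

Lemma iter_laplacian_component J f k :
  component (iter J (@laplacian R m n) f) k = iter J (lap pd) (component f k).
Proof. by elim: J => //= J IH; rewrite laplacian_component IH. Qed.

Lemma dirac_component (proj : {linear 'M[C]_(m, n) -> 'cV[C]_n}) (f : U -> 'cV[C]_n) :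
  (forall x, higher_spin_dirac proj f x = 0) ->
  forall l, \sum_k \sum_i symbol_coef proj i l k *: pd i (component f k) = 0.
Proof.
move=> h l; apply/funext => x; rewrite fct_sumE.
under eq_bigr => k _ do rewrite fct_sumE.
have /colP/(_ l) := h x; rewrite /higher_spin_dirac proj_sum summxE [RHS]mxE => e.
rewrite -[RHS]e exchange_big /=; apply: eq_bigr => i _; rewrite mxE.
apply: eq_bigr => k _; congr (_ * _).
by rewrite [RHS]mxE [RHS]mxE [RHS]mxE partial_component.
Qed.
End Components.

Theorem corollary1 (R : realType) (r : nat) (hr : (0 < r)%N)
    (lam : 'I_r -> nat) (hlam : dominant lam)
    (n : nat) (rho : cliff R r.*2.+1 -> 'M[R[i]]_n)
    (hrho : spin_irrep lam rho)
    (proj : {linear 'M[R[i]]_(r.*2.+1, n) -> 'cV[R[i]]_n})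
    (hproj : summand_projection rho proj)
    (f : 'rV[R]_(r.*2.+1) -> 'cV[R[i]]_n) (hf : smooth_field f) :
  (forall x, higher_spin_dirac proj f x = 0%R) ->
  forall x, iter (lam (Ordinal hr)).+1 (@laplacian R r.*2.+1 n) f x = 0%R.
Proof.
(* The descent lemmas are stated in [m.+2] variables, which for [m = 2 r + 1]
   becomes definitional once [r] is a successor. *)
case: r hr lam hlam rho hrho proj hproj f hf => [//|r] hr lam _ rho hrho proj hproj f hf Rf x.
have -> : Ordinal hr = ord0 by apply/val_inj.
have [c c0 [Q hQ]] := symbol_divides hrho hproj.
apply/colP => a; rewrite [RHS]mxE.
have /(congr1 (fun g : _ -> R[i] => g x)) := iter_laplacian_component (lam ord0).+1 f a.
rewrite {1}/component => ->.
have h := @system_polyharmonic R[i] ('rV[R]_(r.+1.*2.+1) -> R[i]) (@smoothC R _)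
  (smoothC0 _) (@smoothC_linear R _) r.*2.+1 n (@pd R r.+1.*2.+1) (symbol_coef proj) Q c
  (lam ord0).+1 (component f).
have pdL i : linear_on (@smoothC R _) (@pd R r.+1.*2.+1 i) by apply: deriveC_linear_on.
have pdC i j g : smoothC g -> @pd R r.+1.*2.+1 i (pd j g) = pd j (pd i g).
  by move=> Sg; apply: deriveC_comm.
have E := h pdL pdC c0 hQ hf (dirac_component Rf) a.
exact: (congr1 (fun g : _ -> R[i] => g x) E).
Qed.
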